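(* Let $(M,F)$ be a Finsler manifold admitting a concurrent $\pi$-vector field $\overline{\varphi}$ with associated $\pi$-form $\phi=i_{\overline{\varphi}}g$; put $\Phi=\phi(\overline{\eta})$ and $p^2=g(\overline\varphi,\overline\varphi)$. Let $\widehat F=\frac{F^2}{F-\Phi}$ on $\mathcal D=\{(x,y)\in TM : F(x,y)>\Phi(x,y)\}$ be a generalized $\phi$-Matsumoto metric (i.e. a conic pseudo-Finsler structure), with $F(1+2p^2)-3\Phi\ne0$ on $\mathcal D$, and set $$f_1=\frac{F(4\Phi-F)}{F(1+2p^2)-3\Phi},\qquad f_2=\frac{2F^3}{F(1+2p^2)-3\Phi}.$$ Then on $\mathcal D$ the horizontal and vertical projectors $\widehat h,\widehat v$ of $\widehat F$ and $h,v$ of $F$ are related by $$\widehat h=h+\mathbb S,\qquad \widehat v=v-\mathbb S,$$ where $\mathbb S$ is the semi-basic vector $1$-form $$\mathbb S:=-\frac12\left\{f_1\,J+d_Jf_1\otimes\gamma\overline\eta-d_Jf_2\otimes\gamma\overline\varphi\right\}.$$ Moreover, the Barthel curvature tensors $\widehat{\mathfrak R}$ of $\widehat F$ and $\mathfrak R$ of $F$ are related by $$\widehat{\mathfrak R}=\mathfrak R-[h,\mathbb S]-N_{\mathbb S}.$$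
   Context: Setting. $M$ is an $n$-dimensional paracompact smooth manifold, $\pi:TM\to M$ its tangent bundle, $\mathcal TM=TM\setminus\{0\}$ the slit tangent bundle. $\pi$-vector fields are smooth sections of the pullback of the bundle $TM\to M$ over $\mathcal TM$ (local basis $\overline{\partial}_i$); $\pi$-forms/tensors are the corresponding (dual) tensor sections. $\gamma$ is the natural injection (vertical lift) $\gamma(W^i\overline\partial_i)=W^i\partial_{y^i}$, $\rho(a^i\partial_{x^i}+b^i\partial_{y^i})=a^i\overline\partial_i$, $J=\gamma\circ\rho$, $\overline\eta(u)=(u,u)$ (i.e. $\overline\eta=y^i\overline\partial_i$), $\mathcal C=\gamma\overline\eta$, and $d_Jf=df\circ J$ for functions $f$. A vector 1-form $\mathbb S$ is semi-basic if $J\mathbb S=0$ and $\mathbb S J=0$. For vector 1-forms $\mathbb K,\mathbb L$ the Frölicher–Nijenhuis bracket is $[\mathbb K,\mathbb L](W,Z)=[\mathbb KW,\mathbb LZ]+[\mathbb LW,\mathbb KZ]+\mathbb K\mathbb L[W,Z]+\mathbb L\mathbb K[W,Z]-\mathbb K[\mathbb LW,Z]-\mathbb K[W,\mathbb LZ]-\mathbb L[\mathbb KW,Z]-\mathbb L[W,\mathbb KZ]$, and $N_{\mathbb L}=\frac12[\mathbb L,\mathbb L]$ is the Nijenhuis torsion. Finsler structure: $F:TM\to[0,\infty)$, $C^\infty$ on $\mathcal TM$, $C^0$ on $TM$, positively homogeneous of degree 1 in $y$, with $dd_JE$ of maximal rank, $E=\frac12F^2$. Metric tensor: $g(\rho W,\rho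 Z)=dd_JE(JW,Z)$ (it is positive definite). Geodesic spray $G$: the vector field with $JG=\mathcal C$, $[\mathcal C,G]=G$, $i_Gdd_JE=-dE$. Barthel connection $\Gamma=[J,G]$ (i.e. $\Gamma X=[JX,G]-J[X,G]$), horizontal and vertical projectors $h=\frac12(I+\Gamma)$, $v=\frac12(I-\Gamma)$, curvature $\mathfrak R=-\frac12[h,h]$, horizontal map $\beta=(\rho|_{\mathrm{Im}\,h})^{-1}$. Berwald connection $D^\circ$: $\gamma D^\circ_{hZ}\rho W=v[hZ,JW]$, $D^\circ_{\gamma\overline Z}\overline W=\rho[\gamma\overline Z,\beta\overline W]$. Cartan connection $\nabla$: determined by $2g(\nabla_{\gamma\overline X}\overline Y,\overline Z)=\gamma\overline X\cdot g(\overline Y,\overline Z)+g(\overline Y,\rho[\beta\overline Z,\gamma\overline X])+g(\overline Z,\rho[\gamma\overline X,\beta\overline Y])$ and $2g(\nabla_{\beta\overline X}\overline Y,\overline Z)=\beta\overline X\cdot g(\overline Y,\overline Z)+\beta\overline Y\cdot g(\overline Z,\overline X)-\beta\overline Z\cdot g(\overline X,\overline Y)-g(\overline X,\rho[\beta\overline Y,\beta\overline Z])+g(\overline Y,\rho[\beta\overline Z,\beta\overline X])+g(\overline Z,\rho[\beta\overline X,\beta\overline Y])$. Concurrent $\pi$-vector field: a non-vanishing $\pi$-vector field $\overline\varphi$ with $\nabla_{\beta\overline W}\overline\varphi=-\overline W=D^\circ_{\beta\overline W}\overline\varphi$ and $\nabla_{\gamma\overline W}\overline\varphi=0=D^\circ_{\gamma\overline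 W}\overline\varphi$ for all $\overline W$. Conic pseudo-Finsler structure on $M$: a smooth function to $[0,\infty)$ on a conic sub-bundle $\mathcal D\subset\mathcal TM$ (non-empty, open, invariant under scaling by positive reals, $\pi(\mathcal D)=M$, each fibre $\mathcal D_x$ connected), positively 1-homogeneous in $y$, whose form $dd_J(\frac12(\cdot)^2)$ has maximal rank. For the conic pseudo-Finsler structure $\widehat F$, the energy $\widehat E=\frac12\widehat F^2$, metric tensor $\widehat g$, geodesic spray $\widehat G$, Barthel connection $\widehat\Gamma$, projectors $\widehat h,\widehat v$, curvature $\widehat{\mathfrak R}$, horizontal map $\widehat\beta$, Berwald connection $\widehat D^\circ$ and Cartan connection $\widehat\nabla$ are defined on $\mathcal D$ by the same formulas as the corresponding unhatted objects of $F$. *)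

(* Defs.v *)
From HB Require Import structures.
From mathcomp Require Import all_boot all_order all_algebra.
From mathcomp Require Import all_classical all_reals all_analysis.

Set Implicit Arguments.
Unset Strict Implicit.
Unset Printing Implicit Defensive.

Import Order.TTheory GRing.Theory Num.Theory.
Import numFieldNormedType.Exports.

Local Open Scope classical_set_scope.
Local Open Scope ring_scope.

(* Only meant for open A and finite-dimensional V. *)
Fixpoint class_C {R : realType} {V W : normedModType R} (k : nat)
    (A : set V) (f : V -> W) : Prop :=
  match k with
  | 0%N => forall x, A x -> {for x, continuous f}
  | k'.+1 => (forall x, A x -> differentiable f x) /\
             (forall v, class_C k' A ('D_v f))
  end.

Definition class_Coo {R : realType} {V W : normedModType R}
    (A : set V) (f : V -> W) : Prop := forall k, class_C k A f.

(* Every point p comes with a preferred chart [chart_at p] around it.  As in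
   Mathlib, the tangent space at p is the model space V itself: v : V stands
   for the tangent vector with components v in the chart [chart_at p]. *)
Record charted (V : Type) := Charted {
  point :> Type ;
  chart : Type ;
  dom : chart -> set point ;
  crd : chart -> point -> V ;
  chart_at : point -> chart }.

Arguments chart {V} N : rename.
Arguments dom {V N} c : rename.
Arguments crd {V N} c p : rename.
Arguments chart_at {V N} p : rename.

Section Calculus.
Context {R : realType} {V : normedModType R} {N : charted V}.

(* f read in the chart c, that is f \o (crd c)^-1, extended by 0 outside of the
   image of c *)
Definition loc {W : zmodType} (c : chart N) (f : N -> W) (x : V) : W :=
  if pselect (exists2 p : N, dom c p & crd c p = x) is left h
  then f (s2val (cid2 h)) else 0.

Definition opn (A : set N) : Prop :=
  forall c : chart N, open (crd c @` (A `&` dom c)).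

Definition smooth {W : normedModType R} (A : set N) (f : N -> W) : Prop :=
  forall c : chart N, class_Coo (crd c @` (A `&` dom c)) (loc c f).

Definition differential_at {W : normedModType R} (f : N -> W) (p : N) (v : V) :
    W :=
  'D_v (loc (chart_at p) f) (crd (chart_at p) p).

Definition der {W : normedModType R} (X : N -> V) (f : N -> W) : N -> W :=
  fun p => differential_at f p (X p).

(* differential_at (crd c) p v lists the components in the chart c of the
   tangent vector v at p, so smoothness of X is that of its components. *)
Definition vfield (U : set N) (X : N -> V) : Prop :=
  forall c : chart N, smooth (U `&` dom c) (der X (crd c)).

(* [X, Y](f) = X(Y(f)) - Y(X(f)), where f is the tuple of the coordinate
   functions of the preferred chart at p *)
Definition lie (X Y : N -> V) : N -> V := fun p =>
  let c := chart_at p in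
  der X (der Y (crd c)) p - der Y (der X (crd c)) p.

Definition hausdorff : Prop :=
  forall p q : N, p <> q ->
    exists A B : set N, [/\ opn A, opn B, A p, B q & A `&` B = set0].

Definition paracompact : Prop :=
  forall C : set (set N),
    (forall A, C A -> opn A) -> (forall p, exists2 A, C A & A p) ->
    exists C' : set (set N),
      [/\ forall B, C' B -> opn B /\ (exists2 A, C A & B `<=` A),
          forall p, exists2 B, C' B & B p
        & forall p, exists A, [/\ opn A, A p
            & finite_set [set B | C' B /\ B `&` A !=set0]]].

Definition manifold : Prop :=
  [/\ forall p : N, dom (chart_at p) p,
      forall c : chart N, {in dom c &, injective (crd c)},
      forall c d : chart N, open (crd c @` (dom c `&` dom d)),
      forall c d : chart N,
        class_Coo (crd c @` (dom c `&` dom d)) (loc c (crd d))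
    & hausdorff /\ paracompact].

(* Vector 1-forms are operators on vector fields.  An operator on the sections
   over a set A (here and for connections below) also acts on the sections over
   the open subsets of A, and identities between them are required on these
   local sections; this is equivalent, by locality, to the version with sections
   over A only.  Values outside of the open subset are irrelevant. *)
Definition vform := (N -> V) -> (N -> V).

Definition vector_form (A : set N) (K : vform) : Prop :=
  forall U : set N, opn U -> U `<=` A ->
  [/\ forall X, vfield U X -> vfield U (K X),
      forall X Y, vfield U X -> vfield U Y -> {in U, X =1 Y} ->
        {in U, K X =1 K Y}
    & forall (f : N -> R) X Y, smooth U f -> vfield U X -> vfield U Y ->
        {in U, K (fun p => f p *: X p + Y p)
               =1 fun p => f p *: K X p + K Y p}].

Definition eq_vform (A : set N) (K L : vform) : Prop :=
  forall U X, opn U -> U `<=` A -> vfield U X -> {in U, K X =1 L X}.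

Definition eq_vform2 (A : set N) (K L : (N -> V) -> vform) : Prop :=
  forall U X Y, opn U -> U `<=` A -> vfield U X -> vfield U Y ->
    {in U, K X Y =1 L X Y}.

Definition fn_bracket (K L : vform) (X Y : N -> V) : N -> V :=
  lie (K X) (L Y) \+ lie (L X) (K Y) \+ K (L (lie X Y)) \+ L (K (lie X Y))
  \- K (lie (L X) Y) \- K (lie X (L Y)) \- L (lie (K X) Y) \- L (lie X (K Y)).

Definition nijenhuis (L : vform) (X Y : N -> V) : N -> V :=
  fun p => 2^-1 *: fn_bracket L L X Y p.

End Calculus.

Arguments hausdorff {R V} N.
Arguments paracompact {R V} N.
Arguments manifold {R V} N.
Arguments vform {R V} N.

(* (p, y) is the vector y tangent to M at p; the chart of TM induced by the
   chart c of M is (x^i, y^i). *)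
Definition tangent {R : realType} {n : nat} (M : charted 'rV[R]_n) :
    charted ('rV[R]_n * 'rV[R]_n)%type :=
  {| point := (M * 'rV[R]_n)%type ;
     chart := chart M ;
     dom c := [set z | dom c z.1] ;
     crd c z := (crd c z.1, differential_at (crd c) z.1 z.2) ;
     chart_at z := chart_at z.1 |}.

Section Finsler.
Context {R : realType} {n : nat} {M : charted 'rV[R]_n}.

Local Notation TM := (tangent M).
Local Notation V1 := 'rV[R]_n.
Local Notation V2 := ('rV[R]_n * 'rV[R]_n)%type.

Definition slit : set TM := [set z | z.2 != 0].

(* pi-vector fields are the sections W of the pullback of TM over TM, so that
   W z is tangent to M at z.1. *)
Definition pvfield (U : set TM) (W : TM -> V1) : Prop :=
  forall c : chart M,
    smooth (U `&` @dom _ TM c) (fun z : TM => differential_at (crd c) z.1 (W z)).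

(* The preferred chart of TM at z is induced by the preferred chart of M at
   z.1, so (a, b) : V2 is the vector a^i d/dx^i + b^i d/dy^i tangent to TM at z
   for the coordinates (x^i, y^i) of this induced chart. *)
Definition rho (X : TM -> V2) : TM -> V1 := fun z => (X z).1.
Definition gam (W : TM -> V1) : TM -> V2 := fun z => (0, W z).
Definition J (X : TM -> V2) : TM -> V2 := gam (rho X).
Definition eta : TM -> V1 := fun z => z.2.
Definition liouville : TM -> V2 := gam eta.

Definition dJ (f : TM -> R) (X : TM -> V2) : TM -> R := der (J X) f.

Definition ddJ (f : TM -> R) (X Y : TM -> V2) : TM -> R :=
  der X (dJ f Y) \- der Y (dJ f X) \- dJ f (lie X Y).

Definition energy (F : TM -> R) : TM -> R := fun z => 2^-1 * F z ^+ 2.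

Definition semibasic (A : set TM) (S : vform TM) : Prop :=
  [/\ vector_form A S, eq_vform A (J \o S) (fun _ _ => 0)
    & eq_vform A (S \o J) (fun _ _ => 0)].

(* Tangent vectors at z are taken as values of vector fields defined near z. *)
Definition max_rank (A : set TM) (F : TM -> R) : Prop :=
  forall (U : set TM) (z : TM) (X : TM -> V2),
    opn U -> U `<=` A -> U z -> vfield U X ->
    (forall Y, vfield U Y -> ddJ (energy F) X Y z = 0) -> X z = 0.

Definition homogeneous1 (A : set TM) (F : TM -> R) : Prop :=
  forall (z : TM) (l : R), A z -> 0 < l -> F (z.1, l *: z.2) = l * F z.

Definition finsler (F : TM -> R) : Prop :=
  [/\ forall z, 0 <= F z,
      smooth slit F,
      forall c : chart TM, class_C 0 (crd c @` dom c) (loc c F),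
      homogeneous1 setT F
    & max_rank slit F].

Definition conic (D : set TM) : Prop :=
  [/\ D `<=` slit, D !=set0 /\ opn D,
      forall (z : TM) (l : R), D z -> 0 < l -> D (z.1, l *: z.2),
      forall p : M, exists y, D (p, y)
    & forall p : M, connected [set y | D (p, y)]].

Definition conic_pseudo_finsler (D : set TM) (F : TM -> R) : Prop :=
  conic D /\ [/\ forall z, D z -> 0 <= F z, smooth D F, homogeneous1 D F
    & max_rank D F].

Definition geodesic_spray (A : set TM) (F : TM -> R) (G : TM -> V2) : Prop :=
  [/\ vfield A G,
      {in A, J G =1 liouville},
      {in A, lie liouville G =1 G}
    & forall U X, opn U -> U `<=` A -> vfield U X ->
        {in U, ddJ (energy F) G X =1 \- der X (energy F)}].

Definition barthel (G : TM -> V2) : vform TM := fun X =>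
  lie (J X) G \- J (lie X G).

Definition hproj (G : TM -> V2) : vform TM := fun X z =>
  2^-1 *: (X z + barthel G X z).

Definition vproj (G : TM -> V2) : vform TM := fun X z =>
  2^-1 *: (X z - barthel G X z).

Definition curvature (G : TM -> V2) (X Y : TM -> V2) : TM -> V2 := fun z =>
  - (2^-1 *: fn_bracket (hproj G) (hproj G) X Y z).

Definition ptensor2 := TM -> V1 -> V1 -> R.

Definition pair2 (g : ptensor2) (W Z : TM -> V1) : TM -> R :=
  fun z => g z (W z) (Z z).

Definition metric_tensor (A : set TM) (F : TM -> R) (g : ptensor2) : Prop :=
  forall U X Y, opn U -> U `<=` A -> vfield U X -> vfield U Y ->
    {in U, pair2 g (rho X) (rho Y) =1 ddJ (energy F) (J X) Y}.

(* beta is the inverse of the restriction of rho to the image of h *)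
Definition horizontal_map (A : set TM) (G : TM -> V2)
    (beta : (TM -> V1) -> (TM -> V2)) : Prop :=
  forall U W, opn U -> U `<=` A -> pvfield U W ->
    [/\ vfield U (beta W), {in U, rho (beta W) =1 W}
      & {in U, hproj G (beta W) =1 beta W}].

Definition linear_connection (A : set TM)
    (D : (TM -> V2) -> (TM -> V1) -> (TM -> V1)) : Prop :=
  forall U : set TM, opn U -> U `<=` A ->
  [/\ forall X W, vfield U X -> pvfield U W -> pvfield U (D X W),
      forall X X' W W', vfield U X -> vfield U X' -> pvfield U W ->
        pvfield U W' -> {in U, X =1 X'} -> {in U, W =1 W'} ->
        {in U, D X W =1 D X' W'},
      forall (f : TM -> R) X Y W, smooth U f -> vfield U X -> vfield U Y ->
        pvfield U W ->
        {in U, D (fun z => f z *: X z + Y z) W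
               =1 fun z => f z *: D X W z + D Y W z}
    & forall (f : TM -> R) X W Z, smooth U f -> vfield U X -> pvfield U W ->
        pvfield U Z ->
        {in U, D X (fun z => f z *: W z + Z z)
               =1 fun z => der X f z *: W z + f z *: D X W z + D X Z z}].

Definition berwald (A : set TM) (G : TM -> V2)
    (beta : (TM -> V1) -> (TM -> V2))
    (D : (TM -> V2) -> (TM -> V1) -> (TM -> V1)) : Prop :=
  [/\ linear_connection A D,
      forall U Z W, opn U -> U `<=` A -> vfield U Z -> vfield U W ->
        {in U, gam (D (hproj G Z) (rho W))
               =1 vproj G (lie (hproj G Z) (J W))}
    & forall U Z W, opn U -> U `<=` A -> pvfield U Z -> pvfield U W ->
        {in U, D (gam Z) W =1 rho (lie (gam Z) (beta W))}].

Definition cartan (A : set TM) (g : ptensor2)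
    (beta : (TM -> V1) -> (TM -> V2))
    (D : (TM -> V2) -> (TM -> V1) -> (TM -> V1)) : Prop :=
  [/\ linear_connection A D,
      forall U X Y Z, opn U -> U `<=` A -> pvfield U X -> pvfield U Y ->
        pvfield U Z -> {in U, forall z,
        2 * pair2 g (D (gam X) Y) Z z =
          der (gam X) (pair2 g Y Z) z
          + pair2 g Y (rho (lie (beta Z) (gam X))) z
          + pair2 g Z (rho (lie (gam X) (beta Y))) z}
    & forall U X Y Z, opn U -> U `<=` A -> pvfield U X -> pvfield U Y ->
        pvfield U Z -> {in U, forall z,
        2 * pair2 g (D (beta X) Y) Z z =
          der (beta X) (pair2 g Y Z) z
          + der (beta Y) (pair2 g Z X) z
          - der (beta Z) (pair2 g X Y) z
          - pair2 g X (rho (lie (beta Y) (beta Z))) z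
          + pair2 g Y (rho (lie (beta Z) (beta X))) z
          + pair2 g Z (rho (lie (beta X) (beta Y))) z}].

Definition concurrent (beta : (TM -> V1) -> (TM -> V2))
    (nabla D : (TM -> V2) -> (TM -> V1) -> (TM -> V1))
    (phi : TM -> V1) : Prop :=
  [/\ pvfield slit phi, forall z, slit z -> phi z != 0
    & forall U W, opn U -> U `<=` slit -> pvfield U W ->
        [/\ {in U, nabla (beta W) phi =1 \- W},
            {in U, D (beta W) phi =1 \- W},
            {in U, nabla (gam W) phi =1 fun=> 0}
          & {in U, D (gam W) phi =1 fun=> 0}]].

Definition iform (g : ptensor2) (phi : TM -> V1) (W : TM -> V1) : TM -> R :=
  pair2 g phi W.

End Finsler.

(* Main.v *)
(** Let C = gamma eta and K = gamma phi.  Since nabla phi and D phi vanish in the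
    vertical directions and nabla_(beta W) phi = - W, the function Phi satisfies
    d_J Phi = phi o rho, dd_J Phi = 0 and G(Phi) = - F^2.  As moreover dE vanishes
    on horizontal vectors and i_K dd_J E = d_J Phi, the Euler-Lagrange equation of
    Fhat, whose energy is a function of F and Phi, is solved by
    G - f1 C + f2 K; this is therefore the spray of Fhat, by maximal rank.  Now
    [J, C] = J and [J, K] = 0, so that [J, Ghat] = [J, G] + 2 S, which gives the
    projectors; the curvatures are then compared by bilinearity of the
    Froelicher-Nijenhuis bracket.

    Everything is done with local vector fields, from the derivation rules, the
    identities [X, Y] f = X (Y f) - Y (X f), N_J = 0 and J [JX, G] = JX, and
    Euler's relation C(F) = F; charts and the symmetry of second derivatives are
    needed just to establish these. *)

From HB Require Import structures.
Require Import Defs.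
From mathcomp Require Import all_boot all_order all_algebra.
From mathcomp Require Import all_classical all_reals all_analysis.
From mathcomp Require Import ring lra.
Set Implicit Arguments.
Unset Strict Implicit.
Unset Printing Implicit Defensive.
Import Order.TTheory GRing.Theory Num.Theory.
Import numFieldNormedType.Exports.
Local Open Scope classical_set_scope.
Local Open Scope ring_scope.

(** * Functions of class C^k on open sets *)

Section FlatCalculus.
Context {R : realType}.
Implicit Types U V W Z : normedModType R.

(** The coefficients [f1] and [f2] come from an ansatz. Put L(F, Phi) = F^4 / (2 (F - Phi)^2). For G
    - f1 C + f2 K the Euler-Lagrange equation of L involves only dF, dPhi, d_J F and d_J Phi. The
    parts in dF and dPhi balance for all coefficients, because L is 2-homogeneous in (F, Phi). The
    parts in d_J F and d_J Phi are two linear equations in f1 and f2, with determinant (F / (F -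
    Phi))^6 Delta: this is where [Delta] comes from, and f1, f2 are the solution.

    [J, K] = 0 is the vertical Berwald condition read through N_J = 0; the same condition removes
    the bracket left over in the Cartan formula for vertical derivatives of g(phi, .).

    Two features of the encoding shape the proof. A tangent vector is a tuple of components in a
    preferred chart, which may jump from point to point, so smoothness and brackets are reached by
    passing to a fixed chart. And [g] is known only through its values on projected vector fields,
    so even its symmetry has to come from dd_J E. *)

Lemma near_differentiable V W (f g : V -> W) (x : V) :
  (\near x, f x = g x) -> differentiable f x -> differentiable g x.
Proof.
move=> fg df.
have gf0 : \near x, (g - f) x = 0.
  by apply: filterS fg => y fgy; rewrite !fctE -fgy subrr.
(* A function vanishing near x is its own o-remainder, so uniqueness of the differential gives it
   the zero differential. *)
have h0 : forall h : V -> W, (\near x, h x = 0) -> differentiable h x.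
  move=> h hx0.
  have e : h \o shift x = cst (h x) + (0 : V -> W) +o_ 0 id.
    have hx : h x = 0 by exact: nbhs_singleton hx0.
    apply/eqaddoP => eps eps0; rewrite hx.
    have : \forall y \near (0 : V), h (y + x) = 0.
      by move: hx0; rewrite (@near_shift _ _ 0 x); apply: filterS => y /=; rewrite subr0.
    apply: filterS => y hy /=; rewrite !fctE /= hy !(subr0, addr0, normr0).
    by rewrite mulr_ge0 // ltW.
  have zc : continuous (\0 : V -> W) by exact: cst_continuous.
  have d0 := @diff_unique _ _ _ h \0 x zc e.
  by apply/diff_locallyP; rewrite d0; split.
rewrite (_ : g = f + (g - f)); last by rewrite addrC subrK.
by apply: differentiableD => //; exact: h0.
Qed.

Lemma near_open V W (A : set V) (f g : V -> W) x :
  open A -> A x -> (forall y, A y -> f y = g y) -> \near x, f x = g x.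
Proof. by move=> oA Ax AP; apply: filterS (open_nbhs_nbhs (conj oA Ax)). Qed.

Lemma class_C_eq V W k (A : set V) (f g : V -> W) : open A ->
  (forall x, A x -> f x = g x) -> class_C k A f -> class_C k A g.
Proof.
move=> oA; elim: k f g => [|k IH] f g fg /=.
  move=> fc x Ax; apply: cvg_trans (_ : f @ x --> g x).
    apply: near_eq_cvg; exact: (near_open oA Ax).
  by rewrite -fg //; exact: fc.
move=> [fd fD]; split=> [x Ax|v].
  apply: near_differentiable (fd x Ax); exact: (near_open oA Ax).
apply: (IH ('D_v f)) => // x Ax.
by apply: near_eq_derive; exact: (near_open oA Ax).
Qed.

Lemma class_CS V W k (A B : set V) (f : V -> W) :
  A `<=` B -> class_C k B f -> class_C k A f.
Proof.
move=> AB; elim: k f => [|k IH] f /=; first by move=> fc x /AB; exact: fc.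
by move=> [fd fD]; split=> [x /AB/fd//|v]; exact/IH/fD.
Qed.

Lemma class_C_pred V W k (A : set V) (f : V -> W) :
  class_C k.+1 A f -> class_C k A f.
Proof.
elim: k f => [|k IH] f; first by move=> [fd _] x /fd/differentiable_continuous.
by move=> [fd fD]; split=> // v; exact/IH/fD.
Qed.

Lemma class_C_cst V W k (A : set V) (w : W) : class_C k A (cst w : V -> W).
Proof.
elim: k w => [|k IH] w /=; first by move=> x _; exact: cst_continuous.
split=> [x _|v]; first exact: differentiable_cst.
rewrite (_ : 'D_v (cst w) = cst 0); first exact: IH.
by apply/funext => x; rewrite derive_cst.
Qed.

Lemma class_CD V W k (A : set V) (f g : V -> W) : open A ->
  class_C k A f -> class_C k A g -> class_C k A (f \+ g).
Proof.
move=> oA; elim: k f g => [|k IH] f g /=.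
  by move=> cf cg x Ax; apply: continuousD; [exact: cf|exact: cg].
move=> [df Df] [dg Dg]; split=> [x Ax|v].
  by apply: differentiableD; [exact: df|exact: dg].
apply: (class_C_eq oA (f := 'D_v f \+ 'D_v g)); last exact: IH.
move=> x Ax; rewrite -[RHS]/('D_v (f + g) x) deriveD //.
  by apply: diff_derivable; exact: df.
by apply: diff_derivable; exact: dg.
Qed.

Lemma derive_lin V W Z (L : {linear W -> Z}) (f : V -> W) v x :
  continuous L -> differentiable f x -> 'D_v (L \o f) x = L ('D_v f x).
Proof.
move=> cL df; have dL := linear_differentiable (f x) cL.
have dc : differentiable (L \o f) x by exact: differentiable_comp.
rewrite (deriveE _ df) (deriveE _ dc) (diff_comp df dL).
by rewrite [LHS]/= (diff_lin _ cL).
Qed.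

Lemma class_C_lin V W Z k (A : set V) (L : {linear W -> Z}) (f : V -> W) :
  open A -> continuous L -> class_C k A f -> class_C k A (L \o f).
Proof.
move=> oA cL; elim: k f => [|k IH] f /=.
  by move=> cf x Ax; apply: continuous_comp; [exact: cf|exact: cL].
move=> [df Df]; split=> [x Ax|v].
  by apply: differentiable_comp; [exact: df|exact: linear_differentiable].
apply: (class_C_eq oA (f := L \o 'D_v f)); last exact: IH.
by move=> x Ax; rewrite derive_lin //; exact: df.
Qed.

Lemma class_C_precomp V W Z k (A : set V) (L : {linear W -> V}) (f : V -> Z) :
  open A -> continuous L -> class_C k A f -> class_C k (L @^-1` A) (f \o L).
Proof.
move=> oA cL; have oLA : open (L @^-1` A) by move/continuousP : cL; exact.
elim: k f => [|k IH] f /=.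
  by move=> cf x Ax; apply: continuous_comp; [exact: cL|exact: cf].
move=> [df Df]; split=> [x Ax|v].
  by apply: differentiable_comp; [exact: linear_differentiable|exact: df].
apply: (class_C_eq oLA (f := 'D_(L v) f \o L)); last exact: IH.
move=> x Ax; have dL := linear_differentiable x cL.
have dfx : differentiable f (L x) by exact: df.
have dc : differentiable (f \o L) x by exact: differentiable_comp.
rewrite [LHS]/= (deriveE _ dfx) (deriveE _ dc) (diff_comp dL dfx).
by rewrite [RHS]/= (diff_lin _ cL).
Qed.

Lemma class_CM V k (A : set V) (f g : V -> R) : open A ->
  class_C k A f -> class_C k A g -> class_C k A (f \* g).
Proof.
move=> oA; elim: k f g => [|k IH] f g.
  by move=> cf cg x Ax; apply: continuousM; [exact: cf|exact: cg].
move=> cf cg; have [df Df] := cf; have [dg Dg] := cg; split=> [x Ax|v].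
  by apply: differentiableM; [exact: df|exact: dg].
apply: (class_C_eq oA (f := (f \* 'D_v g) \+ (g \* 'D_v f))); last first.
  by apply: class_CD => //; apply: IH;
     first [exact: Df|exact: Dg|exact: class_C_pred].
move=> x Ax; rewrite -[RHS]/('D_v (f * g) x) deriveM //.
  by apply: diff_derivable; exact: df.
by apply: diff_derivable; exact: dg.
Qed.

(** The induction closes because (1/f)' = - f' (1/f)^2 is a product of functions already known to be
    of the lower class. *)
Lemma class_CV V k (A : set V) (f : V -> R) : open A ->
  (forall x, A x -> f x != 0) ->
  class_C k A f -> class_C k A (fun x => (f x)^-1).
Proof.
move=> oA f0; elim: k => [|k IH] cf.
  by move=> x Ax; apply: continuousV; [exact: f0|exact: cf].
have [df Df] := cf; split=> [x Ax|v].
  by apply: differentiableV; [exact: df|exact: f0].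
have cI := IH (class_C_pred cf).
apply: (class_C_eq oA
  (f := (cst (-1) \* 'D_v f) \* ((fun x => (f x)^-1) \* (fun x => (f x)^-1)))).
  move=> x Ax; rewrite /= deriveV ?f0//; last exact/diff_derivable/df.
  by rewrite -exprVn expr2 /cst mulN1r mulNr scaleNr mulrC.
apply: class_CM => //; last exact: class_CM.
by apply: class_CM => //; first [exact: Df|exact: class_C_cst].
Qed.

End FlatCalculus.

(** * Symmetry of second derivatives *)

Section Schwarz.
Context {R : realType}.
Implicit Types V W : normedModType R.

(** Reduction of a directional derivative to one real variable, for the mean value theorem here and
    for Euler's relation later. *)
Lemma line_derive V W (f : V -> W) (a u : V) (s : R) :
  differentiable f (a + s *: u) ->
  is_derive s (1 : R) (fun t => f (a + t *: u)) ('D_u f (a + s *: u)).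
Proof.
move=> df; pose g := cst a + ( *:%R ^~ u : R -> V).
have dg : is_diff s g (0 + ( *:%R ^~ u)) by exact: is_diffD.
have dfg : differentiable f (g s) by [].
have dc : differentiable (f \o g) s by apply: differentiable_comp => //.
rewrite -[fun t => _]/(f \o g); apply: DeriveDef; first exact: diff_derivable.
rewrite (deriveE _ dc) diff_comp//= diff_val /= (deriveE _ df).
by rewrite !fctE add0r scale1r.
Qed.

Lemma MVT_from0 (g dg : R -> R) (h : R) : 0 < h ->
  (forall s, 0 <= s <= h -> is_derive s (1 : R) g (dg s)) ->
  exists2 c, 0 <= c <= h & g h - g 0 = dg c * h.
Proof.
move=> h0 gd; have [||c c0h ->] := @MVT_segment R g dg 0 h (ltW h0).
- by move=> s /[!in_itv]/= /andP[s0 sh]; apply: gd; rewrite !ltW.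
- apply: derivable_within_continuous => s /[!in_itv]/= s0h.
  by have [] := gd s s0h.
by exists c => //; rewrite subr0.
Qed.

(** The mean value theorem is applied twice: in s to the difference g of f along two parallel sides,
    then in t to 'D_u f. *)
Lemma second_difference V (f : V -> R) (A : set V) (x u v : V) (h : R) :
  class_C 2 A f -> 0 < h ->
  (forall s t : R, 0 <= s <= h -> 0 <= t <= h -> A (x + s *: u + t *: v)) ->
  exists s t : R, [/\ 0 <= s <= h, 0 <= t <= h &
    f (x + h *: u + h *: v) - f (x + h *: u) - (f (x + h *: v) - f x) =
    'D_v ('D_u f) (x + s *: u + t *: v) * h * h].
Proof.
move=> [df Df] h0 Ah; have [du _] := Df u.
have hh : 0 <= h <= h by rewrite lexx ltW.
have zh : (0 : R) <= 0 <= h by rewrite lexx ltW.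
pose g s := f (x + h *: v + s *: u) - f (x + s *: u).
have [s s0h gE] : exists2 s, 0 <= s <= h & g h - g 0 =
    ('D_u f (x + h *: v + s *: u) - 'D_u f (x + s *: u)) * h.
  apply: (MVT_from0 (dg := fun s => _ - _)) => // s s0h.
  apply: is_deriveB; apply: line_derive; apply: df.
    by rewrite addrAC; exact: Ah.
  by have := Ah s 0 s0h zh; rewrite scale0r addr0.
have [t t0h kE] := MVT_from0 (g := fun t => 'D_u f (x + s *: u + t *: v)) h0
  (fun t t0h => line_derive (du _ (Ah s t s0h t0h))).
exists s, t; split => //.
rewrite -kE scale0r addr0 [X in _ = (_ - X) * _]/= (addrAC x (s *: u)).
by rewrite -gE /g !scale0r !addr0 (addrAC x (h *: u)).
Qed.

Lemma eq_of_dist (a b : R) : (forall e, 0 < e -> `|a - b| <= e + e) -> a = b.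
Proof.
move=> ab; apply/eqP; rewrite -subr_eq0 -normr_le0.
by apply/ler_addgt0Pl => e e0; rewrite addr0 [e]splitr ab// divr_gt0.
Qed.

Lemma continuous2_ball V (f g : V -> R) (A : set V) (x : V) (e : R) :
  open A -> A x -> 0 < e -> {for x, continuous f} -> {for x, continuous g} ->
  exists2 d : R, 0 < d & forall y, `|x - y| < d ->
    [/\ A y, `|f y - f x| < e & `|g y - g x| < e].
Proof.
move=> oA Ax e0 /cvgrPdistC_lt/(_ e e0) cf /cvgrPdistC_lt/(_ e e0) cg.
have /nbhs_normP[d /= d0 dx] : nbhs x (A `&` [set y | `|f y - f x| < e] `&`
    [set y | `|g y - g x| < e]).
  by apply: filterI => //; apply: filterI => //; exact: open_nbhs_nbhs.
by exists d => // y /dx[[]].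
Qed.

(** The second difference does not change when u and v are exchanged, so the two mixed derivatives
    take a common value at two points of a small parallelogram; continuity at x then identifies
    them. *)
Lemma derive_sym_real V (f : V -> R) (A : set V) (x u v : V) :
  open A -> A x -> class_C 2 A f -> 'D_v ('D_u f) x = 'D_u ('D_v f) x.
Proof.
move=> oA Ax cf.
pose D2 : V -> R := 'D_v ('D_u f); pose D2' : V -> R := 'D_u ('D_v f).
have cD2 : {for x, continuous D2} by have [_ /(_ u)[_ /(_ v) /(_ x Ax)]] := cf.
have cD2' : {for x, continuous D2'} by have [_ /(_ v)[_ /(_ u) /(_ x Ax)]] := cf.
apply: (@eq_of_dist (D2 x) (D2' x)) => e e0.
have [d d0 dx] := continuous2_ball oA Ax e0 cD2 cD2'.
(* With sides scaled by h = d / m the parallelogram lies in the ball of radius d; the summand 1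
   keeps m positive and the bound strict. *)
pose m : R := `|u| + `|v| + 1.
have m0 : 0 < m by rewrite ltr_pwDr// addr_ge0.
pose h := d / m; have h0 : 0 < h by rewrite divr_gt0.
have xb (s t : R) : 0 <= s <= h -> 0 <= t <= h ->
    `|x - (x + s *: u + t *: v)| < d.
  move=> /andP[s0 sh] /andP[t0 th]; rewrite -addrA opprD addNKr.
  rewrite normrN (le_lt_trans (ler_normD _ _))// !normrZ !ger0_norm//.
  have -> : d = h * m by rewrite /h divfK// gt_eqF.
  by rewrite /m mulrDr mulr1 ltr_pwDr// mulrDr lerD// ler_wpM2r.
have xb' (s t : R) : 0 <= s <= h -> 0 <= t <= h ->
    `|x - (x + s *: v + t *: u)| < d.
  by move=> ? ?; rewrite addrAC; exact: xb.
have inA (s t : R) : 0 <= s <= h -> 0 <= t <= h -> A (x + s *: u + t *: v).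
  by move=> s0 t0; have [] := dx _ (xb s t s0 t0).
have inA' (s t : R) : 0 <= s <= h -> 0 <= t <= h -> A (x + s *: v + t *: u).
  by move=> s0 t0; have [] := dx _ (xb' s t s0 t0).
have [s [t [s0h t0h E1']]] := second_difference cf h0 inA.
have E1 : _ = D2 _ * h * h := E1'.
have [s' [t' [s0h' t0h' E2']]] := second_difference cf h0 inA'.
have E2 : _ = D2' _ * h * h := E2'.
have [_ + _] := dx _ (xb _ _ s0h t0h).
have [_ _ +] := dx _ (xb' _ _ s0h' t0h').
clear E1' E2'; move: (D2 _) (D2' _) (D2 x) (D2' x) E1 E2 => b b' a c; rewrite (addrAC x (h *: v)).
move: (f _) (f _) (f _) (f _) => p q r w E1 E2.
(* Both are the same second difference divided by h^2. *)
have -> : b' = b.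
  have hN0 : h != 0 by rewrite gt_eqF.
  by apply: (mulIf hN0); apply: (mulIf hN0); rewrite -E1 -E2; ring.
move=> bc ba; rewrite (_ : a - c = (a - b) + (b - c)); last by ring.
by rewrite (le_trans (ler_normD _ _))// lerD// ltW// distrC.
Qed.

End Schwarz.

(* Finite dimension, in the only form in which it is used. *)
Record frame (R : realType) (V : normedModType R) := Frame {
  fdim : nat ;
  fvec : 'I_fdim -> V ;
  fcoord : 'I_fdim -> {linear V -> R} ;
  fcoord_continuous : forall i, continuous (fcoord i) ;
  frameE : forall v, v = \sum_i fcoord i v *: fvec i }.

Arguments fvec {R V} f i : rename.
Arguments fcoord {R V} f i : rename.
Arguments fcoord_continuous {R V} f i : rename.
Arguments frameE {R V} f v : rename.

Section Frames.
Context {R : realType}.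
Implicit Types V W : normedModType R.

Lemma rV_frame n : frame 'rV[R]_n.
Proof.
have lin i : linear (fun v : 'rV[R]_n => v ord0 i : R).
  by move=> a u v; rewrite !mxE.
pose L i : {linear 'rV[R]_n -> R} :=
  HB.pack (fun v : 'rV[R]_n => v ord0 i : R) (GRing.isLinear.Build _ _ _ _ _ (lin i)).
apply: (@Frame R 'rV[R]_n n (fun i => delta_mx 0 i) L) => [i|v].
  exact: coord_continuous.
exact: row_sum_delta.
Qed.

Lemma prod_frame V W : frame V -> frame W -> frame (V * W)%type.
Proof.
move=> [m e l lc lE] [n e' l' lc' lE'].
have lin1 i : linear (fun v : V * W => l i v.1 : R).
  by move=> a u v; rewrite /= linearP.
have lin2 i : linear (fun v : V * W => l' i v.2 : R).
  by move=> a u v; rewrite /= linearP.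
pose L1 i : {linear (V * W)%type -> R} :=
  HB.pack (fun v : V * W => l i v.1 : R) (GRing.isLinear.Build _ _ _ _ _ (lin1 i)).
pose L2 i : {linear (V * W)%type -> R} :=
  HB.pack (fun v : V * W => l' i v.2 : R) (GRing.isLinear.Build _ _ _ _ _ (lin2 i)).
pose b i : (V * W)%type :=
  match fintype.split i with inl j => (e j, 0) | inr j => (0, e' j) end.
pose L i : {linear (V * W)%type -> R} :=
  match fintype.split i with inl j => L1 j | inr j => L2 j end.
refine (@Frame R (V * W)%type (m + n) b L _ _).
  move=> i; rewrite /L; case: (fintype.split i) => j x.
    by apply: continuous_comp; [exact: cvg_fst|exact: lc].
  by apply: continuous_comp; [exact: cvg_snd|exact: lc'].
move=> [v w]; rewrite big_split_ord /b /L /=.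
under eq_bigr do rewrite (unsplitK (inl _)).
under [X in _ + X]eq_bigr do rewrite (unsplitK (inr _)).
have E1 : \sum_(i < m) L1 i (v, w) *: (e i, 0 : W) = (v, 0).
  rewrite [LHS]surjective_pairing (raddf_sum fst) (raddf_sum snd) /=.
  by rewrite -lE big1 // => i _; rewrite scaler0.
have E2 : \sum_(i < n) L2 i (v, w) *: (0 : V, e' i) = (0, w).
  rewrite [LHS]surjective_pairing (raddf_sum fst) (raddf_sum snd) /=.
  by rewrite -lE' big1 // => i _; rewrite scaler0.
by rewrite E1 E2; congr pair; rewrite ?addr0 ?add0r.
Qed.
End Frames.

(** * Calculus of vector-valued functions through frames *)

Section FrameCalculus.
Context {R : realType}.
Implicit Types V W Z : normedModType R.

Lemma deriveD_dir V W (f : V -> W) (x u v : V) : differentiable f x ->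
  'D_(u + v) f x = 'D_u f x + 'D_v f x.
Proof. by move=> df; rewrite !(deriveE _ df) linearD. Qed.

Lemma deriveB_dir V W (f : V -> W) (x u v : V) : differentiable f x ->
  'D_(u - v) f x = 'D_u f x - 'D_v f x.
Proof. by move=> df; rewrite !(deriveE _ df) linearB. Qed.

Lemma deriveZ_dir V W (f : V -> W) (x v : V) (a : R) : differentiable f x ->
  'D_(a *: v) f x = a *: 'D_v f x.
Proof. by move=> df; rewrite !(deriveE _ df) linearZ. Qed.

Lemma derive_frame V W (e : frame V) (f : V -> W) (x v : V) :
  differentiable f x -> 'D_v f x = \sum_i fcoord e i v *: 'D_(fvec e i) f x.
Proof.
move=> df; rewrite (deriveE _ df) [in LHS](frameE e v) linear_sum.
by apply: eq_bigr => i _; rewrite linearZ (deriveE _ df).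
Qed.

Lemma derive_chain V W Z (f : V -> W) (g : W -> Z) x v :
  differentiable f x -> differentiable g (f x) ->
  'D_v (g \o f) x = 'D_('D_v f x) g (f x).
Proof.
move=> df dg; have dc : differentiable (g \o f) x by exact: differentiable_comp.
by rewrite (deriveE _ dc) (deriveE _ df) (deriveE _ dg) diff_comp.
Qed.

Lemma class_C_Zl V W k (A : set V) (f : V -> R) (w : W) : open A ->
  class_C k A f -> class_C k A (fun x => f x *: w).
Proof.
move=> oA; elim: k f => [|k IH] f /=.
  by move=> cf x Ax; apply: continuousZl; exact: cf.
move=> [df Df]; split=> [x Ax|v].
  by apply: differentiableZl; exact: df.
apply: (class_C_eq oA (f := fun x => 'D_v f x *: w)); last exact: IH.
move=> x Ax; have dfx := df x Ax.
by rewrite [in RHS]deriveE ?[in RHS]diffZl ?(deriveE _ dfx)//;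
   exact: differentiableZl.
Qed.

Lemma class_C_sum V W k (A : set V) n (f : 'I_n -> V -> W) : open A ->
  (forall i, class_C k A (f i)) -> class_C k A (fun x => \sum_i f i x).
Proof.
move=> oA; elim: n f => [|n IH] f cf.
  apply: (class_C_eq oA (f := cst 0)); last exact: class_C_cst.
  by move=> x _; rewrite big_ord0.
apply: (class_C_eq oA (f := (fun x => \sum_(i < n) f (lift ord0 i) x) \+ f ord0)).
  by move=> x _; rewrite big_ord_recl addrC.
by apply: class_CD => //; exact: IH.
Qed.

(** Expanding g in the frame reduces the claim to products of real functions times constant
    vectors. *)
Lemma class_CZ V W (e : frame W) k (A : set V) (f : V -> R) (g : V -> W) :
  open A -> class_C k A f -> class_C k A g -> class_C k A (fun x => f x *: g x).
Proof.
move=> oA cf cg.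
apply: (class_C_eq oA
  (f := fun x => \sum_i (f \* (fcoord e i \o g)) x *: fvec e i)).
  move=> x _; rewrite [in RHS](frameE e (g x)) scaler_sumr.
  by apply: eq_bigr => i _; rewrite scalerA.
apply: class_C_sum => // i; apply: class_C_Zl => //; apply: class_CM => //.
by apply: class_C_lin => //; exact: fcoord_continuous.
Qed.

Lemma differentiable_scale V W (e : frame W) (f : V -> R) (g : V -> W) x :
  differentiable f x -> differentiable g x ->
  differentiable (fun y => f y *: g y) x.
Proof.
move=> df dg.
rewrite (_ : (fun _ => _) = \sum_i (fun x => (f * (fcoord e i \o g)) x *: fvec e i)).
  apply: differentiable_sum => i; apply: differentiableZl.
  apply: differentiableM => //; apply: differentiable_comp => //.
  exact/linear_differentiable/fcoord_continuous.
apply/funext => y; rewrite fct_sumE [in LHS](frameE e (g y)) scaler_sumr.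
by apply: eq_bigr => i _; rewrite scalerA.
Qed.

Lemma derive_scale V W (e : frame W) (f : V -> R) (g : V -> W) x v :
  differentiable f x -> differentiable g x ->
  'D_v (fun y => f y *: g y) x = 'D_v f x *: g x + f x *: 'D_v g x.
Proof.
move=> df dg.
rewrite (_ : (fun _ => _) = \sum_i (fun x => (f * (fcoord e i \o g)) x *: fvec e i));
  last first.
  apply/funext => y; rewrite fct_sumE [in LHS](frameE e (g y)) scaler_sumr.
  by apply: eq_bigr => i _; rewrite scalerA.
have dl i : differentiable (fcoord e i \o g) x.
  apply: differentiable_comp => //.
  exact/linear_differentiable/fcoord_continuous.
have dfl i : differentiable (f * (fcoord e i \o g)) x by exact: differentiableM.
have dfz i : differentiable (fun x => (f * (fcoord e i \o g)) x *: fvec e i) x.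
  exact: differentiableZl.
rewrite derive_sum; last by move=> i; exact/diff_derivable.
rewrite [in RHS](frameE e (g x)) [in RHS](frameE e ('D_v g x)) !scaler_sumr.
rewrite -big_split; apply: eq_bigr => i _ /=.
rewrite (deriveE _ (dfz i)) diffZl// -(deriveE _ (dfl i)).
rewrite deriveM; [|exact: diff_derivable..].
rewrite derive_lin//; last exact: fcoord_continuous.
rewrite !scalerA -scalerDl addrC; congr ((_ + _) *: _); exact: mulrC.
Qed.

(** The direction varies with the point; in a frame of V the derivative becomes a combination of
    derivatives in fixed directions, with the coordinates of Y as coefficients. *)
Lemma class_C_along V W (e : frame V) (e' : frame W) k (A : set V)
    (f : V -> W) (Y : V -> V) :
  open A -> class_C k.+1 A f -> class_C k A Y ->
  class_C k A (fun x => 'D_(Y x) f x).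
Proof.
move=> oA [df Df] cY.
apply: (class_C_eq oA
  (f := fun x => \sum_i (fcoord e i \o Y) x *: 'D_(fvec e i) f x)).
  by move=> x Ax; rewrite [RHS](derive_frame e)//; exact: df.
apply: class_C_sum => // i; apply: (class_CZ e') => //; last exact: Df.
by apply: class_C_lin => //; exact: fcoord_continuous.
Qed.

Lemma derive_sym V W (e : frame W) (f : V -> W) (A : set V) (x u v : V) :
  open A -> A x -> class_C 2 A f -> 'D_v ('D_u f) x = 'D_u ('D_v f) x.
Proof.
move=> oA Ax cf; have [df Df] := cf.
have lD i w y : A y -> 'D_w (fcoord e i \o f) y = fcoord e i ('D_w f y).
  by move=> Ay; rewrite derive_lin//; [exact: fcoord_continuous|exact: df].
have H i u' v' :
    fcoord e i ('D_v' ('D_u' f) x) = 'D_v' ('D_u' (fcoord e i \o f)) x.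
  rewrite -derive_lin//; [|exact: fcoord_continuous|].
    by apply/esym/near_eq_derive; apply: (near_open oA Ax) => y Ay; exact: lD.
  by have [+ _] := Df u'; exact.
have E i : fcoord e i ('D_v ('D_u f) x) = fcoord e i ('D_u ('D_v f) x).
  rewrite !H; apply: (derive_sym_real u v oA Ax).
  by apply: class_C_lin => //; exact: fcoord_continuous.
rewrite (frameE e ('D_v _ x)) (frameE e ('D_u _ x)).
by apply: eq_bigr => i _; rewrite E.
Qed.

(** The product rule on the frame expansion; symmetry of second derivatives then lets f be
    differentiated along u first. *)
Lemma derive_along V W (e : frame V) (e' : frame W) (A : set V) (f : V -> W)
    (Y : V -> V) (x u : V) :
  open A -> A x -> class_C 2 A f -> differentiable Y x ->
  'D_u (fun y => 'D_(Y y) f y) x = 'D_('D_u Y x) f x + 'D_(Y x) ('D_u f) x.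
Proof.
move=> oA Ax cf dY; have [df Df] := cf.
have dl i : differentiable (fcoord e i \o Y) x.
  apply: differentiable_comp => //.
  exact/linear_differentiable/fcoord_continuous.
have dDf w : differentiable ('D_w f) x by have [+ _] := Df w; exact.
transitivity ('D_u (\sum_i (fun y => (fcoord e i \o Y) y *: 'D_(fvec e i) f y)) x).
  apply: near_eq_derive; apply: (near_open oA Ax) => y Ay.
  by rewrite fct_sumE [LHS](derive_frame e)//; exact: df.
rewrite derive_sum; last first.
  by move=> i; apply: diff_derivable; exact: differentiable_scale.
rewrite [X in _ = X + _](derive_frame e); last exact: df.
rewrite [X in _ = _ + X](derive_frame e)// -big_split; apply: eq_bigr => i _ /=.
rewrite (derive_scale e' _ (dl i) (dDf _)) (derive_sym e' _ _ oA Ax cf).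
by rewrite derive_lin//; exact: fcoord_continuous.
Qed.

(** The second derivatives of f in the two orders cancel by symmetry, which leaves the derivative
    along the coordinate commutator. *)
Lemma derive_bracket V W (e : frame V) (e' : frame W) (A : set V) (f : V -> W)
    (X Y : V -> V) (x : V) :
  open A -> A x -> class_C 2 A f -> differentiable X x -> differentiable Y x ->
  'D_(X x) (fun y => 'D_(Y y) f y) x - 'D_(Y x) (fun y => 'D_(X y) f y) x =
  'D_('D_(X x) Y x - 'D_(Y x) X x) f x.
Proof.
move=> oA Ax cf dX dY.
have E1 := derive_along e e' (X x) oA Ax cf dY.
have E2 := derive_along e e' (Y x) oA Ax cf dX.
have E3 := derive_sym e' (Y x) (X x) oA Ax cf.
have df : differentiable f x by case: cf => df _; exact: df.
rewrite E1 E2 E3 (deriveB_dir _ _ df) opprD addrACA.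
by rewrite [X in _ + X]subrr addr0.
Qed.

End FrameCalculus.

(** * Vector fields and Lie brackets in charts *)

(** The chart axioms of [manifold], in a form that passes from [M] to [tangent M]. *)
Definition atlas (R : realType) (V : normedModType R) (N : charted V) : Prop :=
  [/\ forall p : N, dom (chart_at p) p,
      forall c : chart N, {in dom c &, injective (crd c)},
      forall c d : chart N, open (crd c @` (dom c `&` dom d))
    & forall c d : chart N,
        class_Coo (crd c @` (dom c `&` dom d)) (loc c (crd d))].

Lemma loc_inj (R : realType) (V W : normedModType R) (N : charted V)
    (c : chart N) (f : N -> W) (p : N) :
  {in dom c &, injective (crd c)} -> dom c p -> loc c f (crd c p) = f p.
Proof.
move=> inj cp; rewrite /loc; case: pselect => [h|[]]; last by exists p.
by case: cid2 => q cq qp; congr f; apply: inj qp; rewrite inE.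
Qed.

Section Atlas.
Context {R : realType} {V : normedModType R}.
Variables (e : frame V) (N : charted V) (hN : atlas N).
Implicit Types (W Z : normedModType R) (U : set N) (c d : chart N) (p : N).
Implicit Types (X Y : N -> V).

Lemma dom_chart_at p : dom (chart_at p) p. Proof. by case: hN. Qed.

Lemma crd_inj c p q : dom c p -> dom c q -> crd c p = crd c q -> p = q.
Proof.
by case: hN => _ h _ _ cp cq; apply: h; rewrite inE.
Qed.

Lemma locE W c (f : N -> W) p : dom c p -> loc c f (crd c p) = f p.
Proof. by apply: loc_inj; case: hN. Qed.

Lemma opn_dom c : opn (dom c).
Proof. by case: hN => _ _ h _ d; rewrite setIC. Qed.

Lemma opnI (A B : set N) : opn A -> opn B -> opn (A `&` B).
Proof.
move=> oA oB c; rewrite (_ : _ @` _ = crd c @` (A `&` dom c) `&` crd c @` (B `&` dom c)).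
  exact: openI.
apply/seteqP; split=> [_ [p [[Ap Bp] cp] <-]|_ [[p [Ap cp] <-] [q [Bq cq]]]].
  by split; exists p.
by move=> /(crd_inj cq cp) qp; exists p => //; split => //; split => //; rewrite -qp.
Qed.

Lemma image_crd U c p : U p -> dom c p -> (crd c @` (U `&` dom c)) (crd c p).
Proof. by move=> Up cp; exists p. Qed.
Hint Resolve dom_chart_at image_crd : core.

Definition diff_at W (f : N -> W) p : Prop :=
  differentiable (loc (chart_at p) f) (crd (chart_at p) p).

Lemma smooth_diff W U c (f : N -> W) p :
  smooth U f -> U p -> dom c p -> differentiable (loc c f) (crd c p).
Proof. by move=> /(_ c 1%N)[+ _] Up cp; apply; exists p. Qed.

Lemma smooth_diff_at W U (f : N -> W) p : smooth U f -> U p -> diff_at f p.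
Proof. by move=> sf Up; exact: smooth_diff sf Up (dom_chart_at p). Qed.

Lemma smoothS W U U' (f : N -> W) : U `<=` U' -> smooth U' f -> smooth U f.
Proof.
move=> UU' sf c k; apply: class_CS (sf c k) => _ [p [Up cp] <-].
by exists p => //; split => //; exact: UU'.
Qed.

Lemma smooth_eq W U (f g : N -> W) : opn U ->
  (forall p, U p -> f p = g p) -> smooth U f -> smooth U g.
Proof.
move=> oU fg sf c k; apply: (class_C_eq (oU c) _ (sf c k)).
by move=> _ [p [Up cp] <-]; rewrite !locE// fg.
Qed.

(** Closure of class C^k under [op] on the model space is carried over to [N] chart by chart;
    [smooth_loc2] is the binary case. *)
Lemma smooth_loc W W' (op : W -> W') U (f : N -> W) (g : N -> W') : opn U ->
  (forall k (A : set V) h, open A -> class_C k A h -> class_C k A (op \o h)) ->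
  (forall p, U p -> g p = op (f p)) -> smooth U f -> smooth U g.
Proof.
move=> oU opC fg sf c k; apply: (class_C_eq (oU c) _ (opC k _ _ (oU c) (sf c k))).
by move=> _ [p [Up cp] <-]; rewrite /= !locE// fg.
Qed.

Lemma smooth_loc2 W1 W2 W (op : W1 -> W2 -> W) U (f1 : N -> W1) (f2 : N -> W2)
    (g : N -> W) : opn U ->
  (forall k (A : set V) h1 h2, open A -> class_C k A h1 -> class_C k A h2 ->
    class_C k A (fun x => op (h1 x) (h2 x))) ->
  (forall p, U p -> g p = op (f1 p) (f2 p)) ->
  smooth U f1 -> smooth U f2 -> smooth U g.
Proof.
move=> oU opC fg s1 s2 c k.
apply: (class_C_eq (oU c) _ (opC k _ _ _ (oU c) (s1 c k) (s2 c k))).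
by move=> _ [p [Up cp] <-]; rewrite /= !locE// fg.
Qed.

Lemma smooth_cst W U (w : W) : opn U -> smooth U (fun _ => w).
Proof.
move=> oU c k; apply: (class_C_eq (oU c) _ (class_C_cst k _ w)).
by move=> _ [p [Up cp] <-]; rewrite locE.
Qed.

Lemma smoothD W U (f g : N -> W) : opn U ->
  smooth U f -> smooth U g -> smooth U (fun p => f p + g p).
Proof.
by move=> oU; apply: (smooth_loc2 (op := fun a b => a + b)) => // *; exact: class_CD.
Qed.

Lemma smoothM U (f g : N -> R) : opn U ->
  smooth U f -> smooth U g -> smooth U (fun p => f p * g p).
Proof.
by move=> oU; apply: (@smooth_loc2 R R R (fun a b => a * b)) => // *; exact: class_CM.
Qed.

Lemma smoothZ W (e' : frame W) U (f : N -> R) (g : N -> W) : opn U ->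
  smooth U f -> smooth U g -> smooth U (fun p => f p *: g p).
Proof.
by move=> oU; apply: (@smooth_loc2 R W W (fun a b => a *: b)) => // *; exact: class_CZ.
Qed.

Lemma smooth_lin W Z (L : {linear W -> Z}) U (f : N -> W) : opn U ->
  continuous L -> smooth U f -> smooth U (fun p => L (f p)).
Proof.
by move=> oU cL; apply: (smooth_loc (op := L)) => // *; exact: class_C_lin.
Qed.

Lemma smoothN W U (f : N -> W) (e' : frame W) : opn U ->
  smooth U f -> smooth U (fun p => - f p).
Proof.
move=> oU sf; apply: (smooth_eq (f := fun p => (-1) *: f p)) => //.
  by move=> p _; rewrite scaleN1r.
by apply: (smoothZ e') => //; exact: smooth_cst.
Qed.

Lemma smoothV U (f : N -> R) : opn U -> (forall p, U p -> f p != 0) ->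
  smooth U f -> smooth U (fun p => (f p)^-1).
Proof.
move=> oU f0 sf c k; have cV : class_C k (crd c @` (U `&` dom c)) (fun x => (loc c f x)^-1).
  apply: (class_CV (oU c) _ (sf c k)).
  by move=> _ [p [Up cp] <-]; rewrite locE// f0.
apply: (class_C_eq (oU c) _ cV).
by move=> _ [p [Up cp] <-]; rewrite /= !locE.
Qed.

Lemma smooth_crd c : smooth (dom c) (crd c).
Proof. by case: hN => _ _ _ h d; rewrite setIC; exact: h. Qed.

(** The chain rule through the transition map from the preferred chart: a differential may be
    computed in any chart around p. *)
Lemma differential_loc W c (f : N -> W) p (v : V) : dom c p ->
  differentiable (loc c f) (crd c p) ->
  differential_at f p v = 'D_(differential_at (crd c) p v) (loc c f) (crd c p).
Proof.
move=> cp df; rewrite /differential_at; set c0 := chart_at p.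
have c0p : dom c0 p := dom_chart_at p.
have dt : differentiable (loc c0 (crd c)) (crd c0 p).
  exact: smooth_diff (smooth_crd c) cp (dom_chart_at p).
have tp : loc c0 (crd c) (crd c0 p) = crd c p.
  by rewrite locE//; exact: dom_chart_at.
rewrite -[in RHS]tp -derive_chain//; last by rewrite tp.
apply: near_eq_derive; apply: (near_open (opn_dom c c0)).
  exact: image_crd.
by move=> _ [q [cq c0q] <-]; rewrite /= !locE.
Qed.

Lemma der_local W U X X' (f g : N -> W) p : opn U -> U p -> X p = X' p ->
  (forall q, U q -> f q = g q) -> der X f p = der X' g p.
Proof.
move=> oU Up XX' fg; rewrite /der /differential_at XX'.
apply: near_eq_derive; apply: (near_open (oU _)); first exact: image_crd.
by move=> _ [q [Uq cq] <-]; rewrite !locE// fg.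
Qed.

(** The coordinates of the preferred chart read in that same chart are the identity; hence v is its
    own tuple of components there. *)
Lemma differential_crd p (v : V) : differential_at (crd (chart_at p)) p v = v.
Proof.
rewrite /differential_at -[RHS](derive_id (crd (chart_at p) p)).
apply: near_eq_derive; apply: (near_open (opn_dom _ (chart_at p))).
  exact: image_crd.
by move=> _ [q [Uq cq] <-]; rewrite !locE.
Qed.

Lemma der_crd X p : der X (crd (chart_at p)) p = X p.
Proof. exact: differential_crd. Qed.

Lemma differentialD W (f : N -> W) p u v : diff_at f p ->
  differential_at f p (u + v) = differential_at f p u + differential_at f p v.
Proof. exact: deriveD_dir. Qed.

Lemma differentialZ W (f : N -> W) p a v : diff_at f p ->
  differential_at f p (a *: v) = a *: differential_at f p v.
Proof. exact: deriveZ_dir. Qed.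

Lemma differential0 W (f : N -> W) p : differential_at f p 0 = 0.
Proof. exact: derive0. Qed.

Lemma derD_dir W (f : N -> W) X Y p : diff_at f p ->
  der (fun q => X q + Y q) f p = der X f p + der Y f p.
Proof. exact: differentialD. Qed.

Lemma derZ_dir W (f : N -> W) (a : N -> R) X p : diff_at f p ->
  der (fun q => a q *: X q) f p = a p *: der X f p.
Proof. exact: differentialZ. Qed.

Lemma der_cst W U X (f : N -> W) w p : opn U -> U p ->
  (forall q, U q -> f q = w) -> der X f p = 0.
Proof.
move=> oU Up fw; rewrite /der /differential_at.
rewrite -[RHS](derive_cst w (crd (chart_at p) p) (X p)).
apply: near_eq_derive; apply: (near_open (oU _)); first exact: image_crd.
by move=> _ [q [Uq cq] <-]; rewrite !locE// fw.
Qed.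

Lemma der_lin W Z (L : {linear W -> Z}) X (f : N -> W) p : continuous L ->
  diff_at f p -> der X (fun q => L (f q)) p = L (der X f p).
Proof.
move=> cL df; rewrite -[RHS](derive_lin _ cL df).
apply: near_eq_derive; apply: (near_open (opn_dom _ (chart_at p))).
  exact: image_crd.
by move=> _ [q [Uq cq] <-]; rewrite /= !locE.
Qed.

Lemma derD W X (f g : N -> W) p : diff_at f p -> diff_at g p ->
  der X (fun q => f q + g q) p = der X f p + der X g p.
Proof.
move=> df dg.
rewrite -[RHS](deriveD (diff_derivable df) (diff_derivable dg)).
apply: near_eq_derive; apply: (near_open (opn_dom _ (chart_at p))).
  exact: image_crd.
by move=> _ [q [Uq cq] <-]; rewrite fctE !locE.
Qed.

Lemma derZ W (e' : frame W) X (f : N -> R) (g : N -> W) p : diff_at f p ->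
  diff_at g p ->
  der X (fun q => f q *: g q) p = der X f p *: g p + f p *: der X g p.
Proof.
move=> df dg; have := derive_scale e' (X p) df dg.
rewrite [X in _ = _ *: X + _]locE// [X in _ = _ + X *: _]locE// => <-.
apply: near_eq_derive; apply: (near_open (opn_dom _ (chart_at p))).
  exact: image_crd.
by move=> _ [q [Uq cq] <-]; rewrite !locE.
Qed.

Lemma derV X (f : N -> R) p : diff_at f p -> f p != 0 ->
  der X (fun q => (f q)^-1) p = - (der X f p / f p ^+ 2).
Proof.
move=> df f0; pose c := chart_at p.
have cp : dom c p := dom_chart_at p.
have f0' : loc c f (crd c p) != 0 by rewrite locE.
have /= := deriveV f0' (diff_derivable (v := X p) df).
rewrite [in RHS]locE// => E; transitivity ('D_(X p) (fun x => (loc c f x)^-1) (crd c p)).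
  apply: near_eq_derive; apply: (near_open (opn_dom _ (chart_at p))).
    exact: image_crd.
  by move=> _ [q [Uq cq] <-]; rewrite !locE.
by rewrite E scaleNr; congr (- _); rewrite mulrC.
Qed.

Lemma vfieldS U U' X : U `<=` U' -> vfield U' X -> vfield U X.
Proof.
by move=> UU' vX c; apply: smoothS (vX c) => p [/UU'].
Qed.

Lemma vfield_eq U X Y : opn U -> (forall p, U p -> X p = Y p) ->
  vfield U X -> vfield U Y.
Proof.
move=> oU XY vX c; apply: smooth_eq (vX c); first exact: opnI (opn_dom c).
by move=> p [Up _]; rewrite /der XY.
Qed.

Lemma diff_at_crd c p : dom c p -> diff_at (crd c) p.
Proof. exact: smooth_diff_at (smooth_crd c). Qed.

Lemma vfield0 U : opn U -> vfield U (fun _ => 0).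
Proof.
move=> oU c; have oUc := opnI oU (opn_dom c).
apply: smooth_eq (smooth_cst 0 oUc) => // p _.
by rewrite /der differential0.
Qed.

Lemma vfieldD U X Y : opn U -> vfield U X -> vfield U Y ->
  vfield U (fun p => X p + Y p).
Proof.
move=> oU vX vY c; have oUc := opnI oU (opn_dom c).
apply: smooth_eq (smoothD oUc (vX c) (vY c)) => // p [Up cp].
by rewrite /der differentialD//; exact: diff_at_crd.
Qed.

Lemma vfieldZ U (f : N -> R) X : opn U -> smooth U f -> vfield U X ->
  vfield U (fun p => f p *: X p).
Proof.
move=> oU sf vX c; have oUc := opnI oU (opn_dom c).
have sf' : smooth (U `&` dom c) f by apply: smoothS sf => p [].
apply: smooth_eq (smoothZ e oUc sf' (vX c)) => // p [Up cp].
by rewrite /der differentialZ//; exact: diff_at_crd.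
Qed.

Lemma vfieldN U X : opn U -> vfield U X -> vfield U (fun p => - X p).
Proof.
move=> oU vX; apply: (vfield_eq (X := fun p => (-1) *: X p)) => //.
  by move=> p _; rewrite scaleN1r.
by apply: vfieldZ => //; exact: smooth_cst.
Qed.

(** The preferred chart is not constant near p, so [der X f] is read in one fixed chart c, where it
    is a derivative along the components of X. *)
Lemma smooth_der W (e' : frame W) U X (f : N -> W) : opn U ->
  vfield U X -> smooth U f -> smooth U (der X f).
Proof.
move=> oU vX sf c k.
have oUc : open (crd c @` (U `&` dom c)) by exact: oU.
have cX : class_C k (crd c @` (U `&` dom c)) (loc c (der X (crd c))).
  have := vX c c k; congr (class_C k (_ @` _) _).
  by rewrite -setIA setIid.
apply: (class_C_eq oUc _ (class_C_along e e' oUc (sf c k.+1) cX)).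
move=> _ [p [Up cp] <-]; rewrite !locE// [RHS](differential_loc _ cp)//.
exact: smooth_diff sf Up cp.
Qed.

(** The inner derivatives are rewritten in the chart of p on a whole neighbourhood, after which the
    flat identity [derive_bracket] applies. *)
Lemma der_lie W (e' : frame W) U X Y (f : N -> W) p : opn U -> U p ->
  vfield U X -> vfield U Y -> smooth U f ->
  der (lie X Y) f p = der X (der Y f) p - der Y (der X f) p.
Proof.
move=> oU Up vX vY sf; pose c := chart_at p.
have cp : dom c p := dom_chart_at p.
have oUc : open (crd c @` (U `&` dom c)) by exact: oU.
have dX A : vfield U A -> differentiable (loc c (der A (crd c))) (crd c p).
  by move=> /(_ c) vZ; apply: smooth_diff vZ _ _.
have E A B : vfield U B -> der A (der B f) p =
    'D_(A p) (fun x => 'D_(loc c (der B (crd c)) x) (loc c f) x) (crd c p).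
  move=> vB; apply: near_eq_derive; apply: (near_open oUc).
    exact: image_crd.
  move=> _ [q [Uq cq] <-]; rewrite !locE// [LHS](differential_loc _ cq)//.
  exact: smooth_diff sf Uq cq.
have xE A : loc c (der A (crd c)) (crd c p) = A p by rewrite locE// der_crd.
have img : (crd c @` (U `&` dom c)) (crd c p) by exact: image_crd.
(* Only the directions at the centre x are replaced; stating this for arbitrary functions leaves
   those under the derivatives untouched. *)
have subst (Xc Yc : V -> V) (fc : V -> W) x : Xc x = X p -> Yc x = Y p ->
    'D_(Xc x) (fun y => 'D_(Yc y) fc y) x - 'D_(Yc x) (fun y => 'D_(Xc y) fc y) x =
      'D_('D_(Xc x) Yc x - 'D_(Yc x) Xc x) fc x ->
    'D_(X p) (fun y => 'D_(Yc y) fc y) x - 'D_(Y p) (fun y => 'D_(Xc y) fc y) x =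
      'D_('D_(X p) Yc x - 'D_(Y p) Xc x) fc x by move=> -> ->.
have B := subst _ _ _ _ (xE X) (xE Y)
  (derive_bracket e e' oUc img (sf c 2%N) (dX _ vX) (dX _ vY)).
rewrite (E _ _ vX) (E _ _ vY); exact: esym B.
Qed.

(** [lie] is defined with the chart of each point, but [der_lie] applied to the coordinates of an
    arbitrary chart gives its components there by the same formula. *)
Lemma vfield_lie U X Y : opn U -> vfield U X -> vfield U Y -> vfield U (lie X Y).
Proof.
move=> oU vX vY c; have oUc := opnI oU (opn_dom c).
have sU A : vfield U A -> vfield (U `&` dom c) A by apply: vfieldS => p [].
have sc : smooth (U `&` dom c) (crd c) by apply: smoothS (smooth_crd c) => p [].
have s A A' : vfield U A -> vfield U A' -> smooth (U `&` dom c) (der A (der A' (crd c))).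
  by move=> vZ vZ'; do ?[apply: smooth_der => //; try exact: sU].
have sB := smoothD oUc (s _ _ vX vY) (smoothN e oUc (s _ _ vY vX)).
apply: smooth_eq sB => // p [Up cp]; rewrite -(der_lie e oUc)//; exact: sU.
Qed.

Lemma lie_local U X X' Y Y' p : opn U -> U p -> (forall q, U q -> X q = X' q) ->
  (forall q, U q -> Y q = Y' q) -> lie X Y p = lie X' Y' p.
Proof.
move=> oU Up XX YY.
have H A A' B B' : (forall q, U q -> A q = A' q) ->
    (forall q, U q -> B q = B' q) ->
    der A (der B (crd (chart_at p))) p = der A' (der B' (crd (chart_at p))) p.
  move=> AA BB; apply: (der_local oU Up); first exact: AA.
  by move=> q Uq; rewrite /der BB.
exact: (congr2 (fun a b => a - b) (H _ _ _ _ XX YY) (H _ _ _ _ YY XX)).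
Qed.

Lemma lieC X Y p : lie X Y p = - lie Y X p.
Proof. by rewrite /lie opprB. Qed.

Lemma lie_self X p : lie X X p = 0.
Proof. by rewrite /lie subrr. Qed.

Lemma diff_at_comp U X p : vfield U X -> U p -> diff_at (der X (crd (chart_at p))) p.
Proof. by move=> /(_ (chart_at p)) vX Up; exact: smooth_diff vX _ _. Qed.

Lemma lieZr U X Y (f : N -> R) p : opn U -> U p -> vfield U X -> vfield U Y ->
  smooth U f ->
  lie X (fun q => f q *: Y q) p = der X f p *: Y p + f p *: lie X Y p.
Proof.
move=> oU Up vX vY sf; rewrite /lie; set c := chart_at p.
have oUc := opnI oU (opn_dom c).
have Ucp : (U `&` dom c) p by split => //; exact: dom_chart_at.
rewrite (der_local (X' := X) (g := fun q => f q *: der Y (crd c) q) oUc Ucp)//; last first.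
  by move=> q [_ cq]; rewrite /der differentialZ//; exact: diff_at_crd.
rewrite (derZ e); [|exact: smooth_diff_at sf Up|exact: diff_at_comp vY Up].
rewrite der_crd -addrA scalerBr; congr (_ + (_ - _)).
by rewrite derZ_dir//; exact: diff_at_comp vX Up.
Qed.

Lemma lieDr U X Y Y' p : opn U -> U p -> vfield U X -> vfield U Y ->
  vfield U Y' -> lie X (fun q => Y q + Y' q) p = lie X Y p + lie X Y' p.
Proof.
move=> oU Up vX vY vY'; rewrite /lie; set c := chart_at p.
have oUc := opnI oU (opn_dom c).
have Ucp : (U `&` dom c) p by split => //; exact: dom_chart_at.
rewrite (der_local (X' := X) (g := fun q => der Y (crd c) q + der Y' (crd c) q)
  oUc Ucp)//; last first.
  by move=> q [_ cq]; rewrite /der differentialD//; exact: diff_at_crd.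
rewrite derD; [|exact: diff_at_comp vY Up|exact: diff_at_comp vY' Up].
rewrite derD_dir; last exact: diff_at_comp vX Up.
by rewrite opprD addrACA.
Qed.

End Atlas.

(** * The tangent manifold *)

Section PairCalculus.
Context {R : realType}.
Implicit Types V W Z : normedModType R.

Lemma class_C_pair V W Z k (A : set V) (f : V -> W) (g : V -> Z) : open A ->
  class_C k A f -> class_C k A g -> class_C k A (fun x => (f x, g x)).
Proof.
move=> oA; elim: k f g => [|k IH] f g /=.
  by move=> cf cg x Ax; apply: cvg_pair; [exact: cf|exact: cg].
move=> [df Df] [dg Dg]; split=> [x Ax|v].
  by apply: differentiable_pair; [exact: df|exact: dg].
apply: (class_C_eq oA (f := fun x => ('D_v f x, 'D_v g x))); last exact: IH.
move=> x Ax; have dfx := df x Ax; have dgx := dg x Ax.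
rewrite (deriveE _ dfx) (deriveE _ dgx).
by rewrite (deriveE _ (differentiable_pair dfx dgx)) (diff_pair dfx dgx).
Qed.

Lemma class_C_id V k (A : set V) : class_C k A (idfun : V -> V).
Proof.
elim: k => [x _|k IH]; first exact: cvg_id.
split=> [x _|v]; first by [].
rewrite (_ : 'D_v idfun = cst v); first exact: class_C_cst.
by apply/funext => x; rewrite derive_id.
Qed.

Lemma derive_snd V W Z (f : (V * W)%type -> Z) (x : V) (y w : W) :
  'D_(0, w) f (x, y) = 'D_w (fun y => f (x, y)) y.
Proof.
pose q (h : R) := h^-1 *: ((f \o shift (x, y)) (h *: (0, w)) - f (x, y)).
pose q' (h : R) := h^-1 *: (f (x, h *: w + y) - f (x, y)).
rewrite /derive -/q -/q'; suff -> : q = q' by [].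
apply/funext => h; rewrite /q /q' /=; congr (_ *: (f _ - _)).
have -> : h *: ((0, w) : (V * W)%type) = (h *: 0, h *: w) by [].
rewrite scaler0; have -> : ((0, h *: w) : (V * W)%type) + (x, y) = (0 + x, h *: w + y) by [].
by rewrite add0r.
Qed.

End PairCalculus.

Section Tangent.
Context {R : realType} {n : nat}.
Variables (M : charted 'rV[R]_n) (hM : atlas M).
Local Notation TM := (tangent M).
Local Notation V1 := 'rV[R]_n.
Local Notation V2 := ('rV[R]_n * 'rV[R]_n)%type.
Local Notation e1 := (@rV_frame R n).
Local Notation e2 := (prod_frame e1 e1).
Implicit Types (c d : chart M) (p : M) (z : TM) (U : set TM).
Implicit Types (X Y G : TM -> V2).

Lemma transition_diff c d p : dom c p -> dom d p ->
  differentiable (loc c (crd d)) (crd c p).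
Proof. by move=> cp dp; exact: smooth_diff (smooth_crd hM d) dp cp. Qed.

Lemma differential_transition c d p v : dom c p -> dom d p ->
  differential_at (crd d) p v =
  'D_(differential_at (crd c) p v) (loc c (crd d)) (crd c p).
Proof.
by move=> cp dp; apply: differential_loc => //; exact: transition_diff.
Qed.

Lemma differential_inj c p v w : dom c p ->
  differential_at (crd c) p v = differential_at (crd c) p w -> v = w.
Proof.
move=> cp vw; have c0p := dom_chart_at hM p.
rewrite -(differential_crd hM p v) -(differential_crd hM p w).
by rewrite !(differential_transition _ cp c0p) vw.
Qed.

(** A preimage of w is the derivative along w of the reverse transition map, since the two
    transitions compose to the identity. *)
Lemma differential_surj c p w : dom c p ->
  exists v, differential_at (crd c) p v = w.
Proof.
move=> cp; have c0p := dom_chart_at hM p; set c0 := chart_at p in c0p *.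
exists ('D_w (loc c (crd c0)) (crd c p)).
rewrite (differential_transition _ c0p cp) differential_crd//.
have dt := transition_diff cp c0p; have dt' := transition_diff c0p cp.
have tp : loc c (crd c0) (crd c p) = crd c0 p by rewrite (locE hM).
rewrite -[in LHS]tp -derive_chain//; last by rewrite tp.
rewrite -[RHS](derive_id (crd c p)).
apply: near_eq_derive; apply: (near_open (opn_dom hM c0 c)).
  by exists p.
by move=> _ [q [c0q cq] <-]; rewrite /= !(locE hM).
Qed.

Lemma crd_tangent_inj c : {in @dom _ TM c &, injective (@crd _ TM c)}.
Proof.
move=> [p v] [q w]; rewrite !inE /= => cp cq [] /(crd_inj hM cp cq) pq.
by move: pq cp => <- cp /(differential_inj cp) ->.
Qed.

(** Differentials of charts are onto, so induced charts contain whole fibres and their images are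
    cylinders; openness on [TM] thus reduces to [M]. *)
Lemma image_crd_tangent c (A : set M) :
  @crd _ TM c @` ([set z | A z.1] `&` @dom _ TM c) =
  fst @^-1` (crd c @` (A `&` dom c)).
Proof.
apply/seteqP; split=> [_ [[p v] [Ap cp] <-]|[_ y] [p [Ap cp] /= <-]].
  by exists p.
by have [v <-] := differential_surj y cp; exists (p, v).
Qed.

Lemma atlas_tangent : atlas TM.
Proof.
have opnTM c d : open (@crd _ TM c @` (@dom _ TM c `&` @dom _ TM d)).
  rewrite setIC (image_crd_tangent c (@dom _ M d)).
  have /continuousP : continuous (fst : V2 -> V1) by move=> x; exact: cvg_fst.
  by apply; exact: opn_dom.
split=> // [z|c|c d]; [exact: (dom_chart_at hM z.1)|exact: crd_tangent_inj|move=> k].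
have cfst : continuous (fst : V2 -> V1) by move=> x; exact: cvg_fst.
have csnd : continuous (snd : V2 -> V1) by move=> x; exact: cvg_snd.
pose t := @loc R _ M _ c (@crd _ M d).
pose O := @crd _ M c @` (@dom _ M d `&` @dom _ M c).
have oO : open O := opn_dom hM d c.
have st : class_Coo O t := smooth_crd hM d c.
have EO : @crd _ TM c @` (@dom _ TM c `&` @dom _ TM d) = fst @^-1` O.
  by rewrite setIC (image_crd_tangent c (@dom _ M d)).
(* The transition map (x, y) |-> (t x, dt_x y), its second component expanded in the frame so that
   its class is visible. *)
pose T (xy : V2) : V2 :=
  (t xy.1, \sum_i fcoord e1 i xy.2 *: 'D_(fvec e1 i) t xy.1).
apply: (@class_C_eq R V2 V2 k _ T _ (opnTM c d)).
  move=> _ [[p v] [cp dp] <-].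
  rewrite (loc_inj _ (@crd_tangent_inj c))//.
  transitivity ((@crd _ M d p, differential_at (@crd _ M d) p v) : V2) => //.
  rewrite /T; congr pair; first by rewrite /t/= (locE hM).
  rewrite (differential_transition _ cp dp) [RHS](derive_frame e1)//.
  exact: transition_diff.
rewrite EO; have oE : open (fst @^-1` O : set V2) by rewrite -EO.
apply: class_C_pair => //.
  exact: (class_C_precomp (L := fst) oO cfst (st k)).
apply: class_C_sum => // i; apply: (class_CZ e1) => //.
  apply: (class_C_lin (f := (snd : V2 -> V1)) oE (fcoord_continuous e1 i)).
  apply: (class_C_lin (L := snd) (f := (idfun : V2 -> V2)) oE csnd).
  exact: class_C_id.
exact: (class_C_precomp (L := fst) oO cfst ((st k.+1).2 _)).
Qed.

End Tangent.

(** * Vertical fields, J and Euler's relation in induced charts *)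

Section TangentCalculus.
Context {R : realType} {n : nat}.
Variables (M : charted 'rV[R]_n) (hM : atlas M).
Local Notation TM := (tangent M).
Local Notation V1 := 'rV[R]_n.
Local Notation V2 := ('rV[R]_n * 'rV[R]_n)%type.
Local Notation e1 := (@rV_frame R n).
Local Notation e2 := (prod_frame e1 e1).
Local Notation hT := (atlas_tangent hM).
Implicit Types (c d : chart M) (p : M) (z : TM) (U : set TM).
Implicit Types (X Y G : TM -> V2) (W : TM -> V1).

Lemma fst_cont : continuous (fst : V2 -> V1). Proof. by move=> x; exact: cvg_fst. Qed.
Lemma snd_cont : continuous (snd : V2 -> V1). Proof. by move=> x; exact: cvg_snd. Qed.

Lemma loc_tangent (W : normedModType R) c (f : TM -> W) z : @dom _ M c z.1 ->
  @loc _ _ TM _ c f (@crd _ TM c z) = f z.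
Proof. by move=> cz; apply: (@locE _ _ TM hT). Qed.

(** The base coordinates of an induced chart depend on the base point alone, so base components
    transform as tangent vectors of [M]. *)
Lemma fst_der_crd c X z : dom c z.1 ->
  (der X (@crd _ TM c) z).1 = differential_at (@crd _ M c) z.1 (X z).1.
Proof.
move=> cz; have dc : diff_at (@crd _ TM c) z := diff_at_crd hT (c := c) cz.
rewrite -(der_lin hT (L := fst) X fst_cont dc).
set c0 : chart M := chart_at z.1.
have c0z : dom c0 z.1 := dom_chart_at hM z.1.
have dt : differentiable (@loc _ _ M _ c0 (@crd _ M c)) (@crd _ M c0 z.1).
  exact: transition_diff.
transitivity ('D_(X z) (@loc _ _ M _ c0 (@crd _ M c) \o (fst : V2 -> V1))
   (@crd _ TM c0 z)).
  apply: near_eq_derive; apply: (near_open (opn_dom hT c c0)).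
    by exists z.
  move=> _ [q [cq c0q] <-]; rewrite [LHS]loc_tangent// [RHS]/=.
  by rewrite [RHS](locE hM).
have df : differentiable (fst : V2 -> V1) (@crd _ TM c0 z).
  exact/linear_differentiable/fst_cont.
have dfE : 'D_(X z) (fst : V2 -> V1) (@crd _ TM c0 z) = (X z).1.
  by rewrite (deriveE _ df) (diff_lin _ fst_cont).
have := derive_chain (X z) df (dt : differentiable _ (fst (@crd _ TM c0 z))).
by rewrite dfE.
Qed.

(** The fibre part of a transition is linear in y, hence its own derivative: vertical vectors
    transform as tangent vectors of [M]. *)
Lemma der_gam_crd c W z : dom c z.1 ->
  der (gam W) (@crd _ TM c) z = (0, differential_at (@crd _ M c) z.1 (W z)).
Proof.
move=> cz; rewrite [LHS]surjective_pairing; congr pair.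
  by rewrite fst_der_crd// differential0.
have dc : diff_at (@crd _ TM c) z := diff_at_crd hT (c := c) cz.
rewrite -(der_lin hT (L := snd) (gam W) snd_cont dc).
set c0 : chart M := chart_at z.1.
have c0z : dom c0 z.1 := dom_chart_at hM z.1.
pose t := @loc _ _ M _ c0 (@crd _ M c).
have dt : differentiable t (@crd _ M c0 z.1) := transition_diff hM c0z cz.
have oO := opn_dom hT c c0.
transitivity ('D_((0, W z) : V2) (fun xy : V2 => 'D_(xy.2) t xy.1) (@crd _ TM c0 z)).
  apply: near_eq_derive; apply: (near_open oO); first by exists z.
  move=> _ [q [cq c0q] <-]; rewrite [LHS]loc_tangent//.
  exact: (differential_transition hM q.2 c0q cq).
rewrite derive_snd /=.
have -> : (fun y => 'D_y t (@crd _ M c0 z.1)) = 'd t (@crd _ M c0 z.1).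
  by apply/funext => y; rewrite (deriveE _ dt).
have cd : continuous ('d t (@crd _ M c0 z.1)) by exact: diff_continuous.
rewrite deriveE; last exact: linear_differentiable.
by rewrite diff_lin// -(deriveE _ dt).
Qed.

Lemma smooth_pair (W1 W2 : normedModType R) U (f : TM -> W1) (g : TM -> W2) :
  opn U -> smooth U f -> smooth U g -> smooth U (fun z => (f z, g z)).
Proof.
move=> oU; apply: (@smooth_loc2 _ _ TM hT W1 W2 (W1 * W2)%type pair) => //.
by move=> *; exact: class_C_pair.
Qed.

(** Through this equivalence the calculus of vector fields also serves for pi-vector fields. *)
Lemma pvfieldP U W : opn U -> pvfield U W <-> vfield U (gam W).
Proof.
move=> oU; split=> vW c; have oUc := opnI hT oU (opn_dom hT c).
  have H := smooth_pair oUc (smooth_cst hT (0 : V1) oUc) (vW c).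
  by apply: (smooth_eq hT oUc _ H) => // z [Uz cz]; rewrite der_gam_crd.
have H := smooth_lin hT (L := snd) oUc snd_cont (vW c).
by apply: (smooth_eq hT oUc _ H) => // z [Uz cz]; rewrite der_gam_crd.
Qed.

Lemma pvfield_rho U X : opn U -> vfield U X -> pvfield U (rho X).
Proof.
move=> oU vX c; have oUc := opnI hT oU (opn_dom hT c).
have H := smooth_lin hT (L := fst) oUc fst_cont (vX c).
by apply: (smooth_eq hT oUc _ H) => // z [Uz cz]; exact: fst_der_crd.
Qed.

Lemma vfield_J U X : opn U -> vfield U X -> vfield U (J X).
Proof. by move=> oU vX; apply/pvfieldP => //; exact: pvfield_rho. Qed.

Lemma pvfield_eta U : opn U -> pvfield U (eta : TM -> V1).
Proof.
move=> oU c; have oUc := opnI hT oU (opn_dom hT c).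
have sc : smooth (U `&` @dom _ TM c) (@crd _ TM c).
  by apply: smoothS (smooth_crd hT c) => z [].
exact: (smooth_lin hT (L := snd) oUc snd_cont sc).
Qed.

Lemma pvfieldS U U' W : U `<=` U' -> pvfield U' W -> pvfield U W.
Proof. by move=> UU' vW c; apply: smoothS (vW c) => z [/UU']. Qed.

Lemma lin_vert : linear (fun v : V2 => (0, v.1) : V2).
Proof.
move=> a u v; transitivity ((a *: 0 + 0, a *: u.1 + v.1) : V2) => //.
by rewrite scaler0 addr0.
Qed.

(* J acts pointwise by [vert]. *)
Definition vert : {linear V2 -> V2} :=
  HB.pack (fun v : V2 => (0, v.1) : V2) (GRing.isLinear.Build _ _ _ _ _ lin_vert).

Lemma vert_cont : continuous vert.
Proof.
move=> x; apply: (@differentiable_continuous _ V2 V2).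
apply: (@differentiable_pair _ V2 V1 V1 (cst 0) fst).
  exact: differentiable_cst.
exact/linear_differentiable/fst_cont.
Qed.

Lemma der_J_crd c X z : dom c z.1 ->
  der (J X) (@crd _ TM c) z = vert (der X (@crd _ TM c) z).
Proof. by move=> cz; rewrite der_gam_crd// /rho -fst_der_crd. Qed.

(** In every induced chart J has the constant matrix [vert], which therefore passes through
    derivatives. *)
Lemma der_der_J U X Y z : opn U -> U z -> vfield U Y ->
  der X (der (J Y) (@crd _ TM (chart_at z))) z =
  vert (der X (der Y (@crd _ TM (chart_at z))) z).
Proof.
move=> oU Uz vY; have oUc := opnI hT oU (opn_dom hT (chart_at z)).
have Ucz : (U `&` dom (chart_at z)) z by split => //; exact: (dom_chart_at hT).
rewrite -(der_lin hT (L := vert) X vert_cont); last first.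
  exact: (diff_at_comp hT) vY Uz.
by apply: (der_local hT oUc Ucz) => // q [Uq cq]; exact: der_J_crd.
Qed.

(** This is N_J = 0, the term J^2 [X, Y] having vanished. In coordinates each J comes out as [vert],
    and the terms that receive it twice disappear. *)
Lemma lie_J_J U X Y z : opn U -> U z -> vfield U X -> vfield U Y ->
  lie (J X) (J Y) z = J (fun q => lie (J X) Y q + lie X (J Y) q) z.
Proof.
move=> oU Uz vX vY; set C := @crd _ TM (chart_at z).
have key (a b x y : V2) : vert a - vert b = vert ((a - vert x) + (vert y - b)).
  have vv v : vert (vert v) = 0 by [].
  by rewrite linearD !linearB !vv subr0 sub0r.
have E1 := der_der_J (J X) oU Uz vY; have E2 := der_der_J (J Y) oU Uz vX.
have E3 := der_der_J Y oU Uz vX; have E4 := der_der_J X oU Uz vY.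
pose a := der (J X) (der Y C) z; pose b := der (J Y) (der X C) z.
transitivity (vert a - vert b); first exact: (congr2 (fun u v => u - v) E1 E2).
rewrite (key a b (der Y (der X C) z) (der X (der Y C) z)).
exact: (congr2 (fun u v => vert ((a - u) + (v - b))) (esym E3) (esym E4)).
Qed.

Lemma lie_gam_gam U W W' z : opn U -> U z -> pvfield U W -> pvfield U W' ->
  (lie (gam W) (gam W') z).1 = 0.
Proof.
move=> oU Uz vW vW'.
have E A B : pvfield U B -> (der A (der (gam B) (@crd _ TM (chart_at z))) z).1 = 0.
  move=> vB; have vgB := (pvfieldP _ oU).1 vB.
  rewrite -(der_lin hT (L := fst) A fst_cont); last exact: (diff_at_comp hT) vgB Uz.
  have oUc := opnI hT oU (opn_dom hT (chart_at z)).
  apply: (der_cst hT (w := 0) A oUc); first by split => //; exact: (dom_chart_at hT).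
  by move=> q [Uq cq]; rewrite der_gam_crd.
have key (a b : V2) : a.1 = 0 -> b.1 = 0 -> (a - b).1 = 0.
  by move=> a0 b0; have -> : (a - b).1 = a.1 - b.1 by []; rewrite a0 b0 subrr.
exact: key (E _ _ vW') (E _ _ vW).
Qed.

(** This is J [JX, G] = JX for a semispray. G differentiates the base coordinates into the fibre
    coordinates, and JX differentiates these into the base components of X; the other half of the
    bracket is vertical. *)
Lemma rho_lie_J U X G z : opn U -> U z -> vfield U X -> vfield U G ->
  (forall q, U q -> rho G q = q.2) -> (lie (J X) G z).1 = (X z).1.
Proof.
move=> oU Uz vX vG rG; set C := @crd _ TM (chart_at z).
have oUc := opnI hT oU (opn_dom hT (chart_at z)).
have Ucz : (U `&` dom (chart_at z)) z by split => //; exact: (dom_chart_at hT).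
have E1 : (der (J X) (der G C) z).1 = (X z).1.
  rewrite -(der_lin hT (L := fst) (J X) fst_cont); last first.
    exact: (diff_at_comp hT) vG Uz.
  have CE q : (U `&` dom (chart_at z)) q -> (der G C q).1 = (C q).2.
    move=> [Uq cq]; pose c0 : chart M := chart_at z.1.
    have CqE : (C q).2 = differential_at (@crd _ M c0) q.1 q.2 by [].
    rewrite CqE -(rG q Uq); exact: (@fst_der_crd c0 G q cq).
  rewrite (der_local hT oUc Ucz (erefl (J X z)) CE).
  rewrite (der_lin hT (L := snd) (J X) snd_cont); last first.
    by apply: (diff_at_crd hT); exact: (dom_chart_at hT).
  by rewrite (der_crd hT).
have key2 (a b v w : V2) : a.1 = v.1 -> b = vert w -> (a - b).1 = v.1.
  by move=> av ->; have -> : (a - vert w).1 = a.1 - 0 by []; rewrite subr0.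
exact: key2 E1 (der_der_J G oU Uz vX).
Qed.

(** Euler's relation: on the ray t |-> (1 + t) y, F equals (1 + t) F(y) as long as 1 + t is
    positive. *)
Lemma der_liouville (F : TM -> R) z : diff_at F z ->
  (forall l : R, 0 < l -> F (z.1, l *: z.2) = l * F z) ->
  der liouville F z = F z.
Proof.
move=> dF hF; set c : chart M := chart_at z.1.
have cz : dom c z.1 := dom_chart_at hM z.1.
pose x := @crd _ M c z.1; pose f := @loc _ _ TM _ c F.
have xE : @crd _ TM c z = (x, z.2).
  by congr pair; exact: (differential_crd hM).
have dF' : differentiable f (x, z.2) by rewrite -xE.
rewrite /der /differential_at -/f xE.
have lE (t : R) : (x, z.2) + t *: ((0, z.2) : V2) = (x, (1 + t) *: z.2).
  transitivity ((x + t *: 0, z.2 + t *: z.2) : V2) => //.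
  by rewrite scaler0 addr0 scalerDl scale1r.
have := @line_derive R V2 R f (x, z.2) (0, z.2) 0.
rewrite scale0r addr0 => /(_ dF') [_ <-].
have near1 : \forall t \near (0 : R), (1 + t) * F z = f ((x, z.2) + t *: ((0, z.2) : V2)).
  near=> t; have t0 : 0 < 1 + t.
    have : `|t| < 1 by near: t; exact: cvgr0_norm_lt.
    by rewrite ltr_norml => /andP[? _]; rewrite -ltrBlDl sub0r.
  rewrite lE -hF//.
  have <- : @crd _ TM c (z.1, (1 + t) *: z.2) = (x, (1 + t) *: z.2).
    by congr pair; exact: (differential_crd hM).
  by rewrite /f loc_tangent.
rewrite -(near_eq_derive _ near1).
have [_ ->] : is_derive (0 : R) (1 : R) (fun t : R => (1 + t) * F z) (F z).
  apply: is_derive_eq; rewrite /GRing.scale /=.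
  by ring.
by [].
Unshelve. all: by end_near. Qed.

End TangentCalculus.

(** * The operators d_J and dd_J *)

(* Unification of two distinct instances of [der] or [lie] unfolds them down to
   limits and hardly ever ends.  Hence the generalization of these atoms before
   calling a decision procedure, and below the use of explicit proof terms and
   of [rewrite ->], which matches syntactically. *)
Ltac atoms := repeat match goal with
  | |- context [ddJ ?f ?X ?Y ?z] => generalize (ddJ f X Y z); intro
  | |- context [dJ ?f ?X ?z] => generalize (dJ f X z); intro
  | |- context [der ?X ?f ?z] => generalize (der X f z); intro
  | |- context [pair2 ?g ?X ?Y ?z] => generalize (pair2 g X Y z); intro
  end.

Ltac clear_eqs := repeat match goal with H : _ = _ |- _ => clear H end.
Ltac atoms_lra := atoms; clear_eqs; intros; lra.

Section ExteriorCalculus.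
Context {R : realType} {n : nat}.
Variables (M : charted 'rV[R]_n) (hM : atlas M).
Local Notation TM := (tangent M).
Local Notation V1 := 'rV[R]_n.
Local Notation V2 := ('rV[R]_n * 'rV[R]_n)%type.
Local Notation e1 := (@rV_frame R n).
Local Notation e2 := (prod_frame e1 e1).
Local Notation hT := (atlas_tangent hM).
Variables (U : set TM) (oU : opn U).
Local Opaque lie differential_at.
Implicit Types (z q : TM) (X Y Z G : TM -> V2) (W : TM -> V1) (f h a b : TM -> R).

Lemma real_frame : frame R.
Proof.
apply: (@Frame R R 1 (fun=> 1) (fun=> idfun)) => [_ x|v]; first exact: cvg_id.
rewrite big_ord1; exact: esym (mulr1 v).
Qed.

Lemma JE X z : J X z = vert (X z). Proof. by []. Qed.

Lemma smooth_derR X f : vfield U X -> smooth U f -> smooth U (der X f).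
Proof. by move=> vX sf; refine (smooth_der e2 hT real_frame oU vX sf). Qed.

Lemma smooth_dJ X f : vfield U X -> smooth U f -> smooth U (dJ f X).
Proof. by move=> vX sf; refine (smooth_derR (vfield_J hM oU vX) sf). Qed.

Lemma vf_lie X Y : vfield U X -> vfield U Y -> vfield U (lie X Y).
Proof. by move=> vX vY; refine (vfield_lie e2 hT oU vX vY). Qed.

Lemma vf_add X Y : vfield U X -> vfield U Y -> vfield U (fun z => X z + Y z).
Proof. by move=> vX vY; refine (vfieldD hT oU vX vY). Qed.

Lemma vf_opp X : vfield U X -> vfield U (fun z => - X z).
Proof. by move=> vX; refine (vfieldN e2 hT oU vX). Qed.

Lemma vf_scale a X : smooth U a -> vfield U X -> vfield U (fun z => a z *: X z).
Proof. by move=> sa vX; refine (vfieldZ e2 hT oU sa vX). Qed.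

Lemma vf_sub X Y : vfield U X -> vfield U Y -> vfield U (fun z => X z - Y z).
Proof. by move=> vX vY; refine (vf_add vX (vf_opp vY)). Qed.

Lemma smR_opp f : smooth U f -> smooth U (fun z => - f z).
Proof. by move=> sf; refine (smoothN hT real_frame oU sf). Qed.

Lemma smR_sub f h : smooth U f -> smooth U h -> smooth U (fun z => f z - h z).
Proof. by move=> sf sh; refine (smoothD hT oU sf (smR_opp sh)). Qed.

Section AtPoint.
Variables (z : TM) (Uz : U z).

Lemma dat f : smooth U f -> diff_at f z.
Proof. by move=> sf; refine (smooth_diff_at hT sf Uz). Qed.

Lemma derR_lie X Y f : vfield U X -> vfield U Y -> smooth U f ->
  der (lie X Y) f z = der X (der Y f) z - der Y (der X f) z.
Proof. by move=> vX vY sf; refine (der_lie e2 hT real_frame oU Uz vX vY sf). Qed.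

Lemma derRD X f h : smooth U f -> smooth U h ->
  der X (fun q => f q + h q) z = der X f z + der X h z.
Proof. by move=> sf sh; refine (derD hT X (dat sf) (dat sh)). Qed.

Lemma derRM X f h : smooth U f -> smooth U h ->
  der X (fun q => f q * h q) z = der X f z * h z + f z * der X h z.
Proof. by move=> sf sh; refine (derZ hT real_frame X (dat sf) (dat sh)). Qed.

Lemma derR_cst X (k : R) : der X (fun=> k : R) z = 0.
Proof. exact: (der_cst hT (w := k) X oU Uz). Qed.

Lemma derRN X f : smooth U f -> der X (fun q => - f q) z = - der X f z.
Proof.
move=> sf; have := derRM X (smooth_cst hT (-1 : R) oU) sf.
rewrite derR_cst mul0r add0r mulN1r => <-.
by apply: (der_local hT oU Uz) => // q _; rewrite mulN1r.
Qed.

Lemma derRB X f h : smooth U f -> smooth U h ->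
  der X (fun q => f q - h q) z = der X f z - der X h z.
Proof. by move=> sf sh; rewrite (derRD X sf (smR_opp sh)) (derRN X sh). Qed.

Lemma derRcM X (k : R) f : smooth U f ->
  der X (fun q => k * f q) z = k * der X f z.
Proof.
move=> sf; rewrite (derRM X (smooth_cst hT k oU) sf).
by rewrite derR_cst mul0r add0r.
Qed.

Lemma derRV X f : smooth U f -> f z != 0 ->
  der X (fun q => (f q)^-1) z = - (der X f z / f z ^+ 2).
Proof. by move=> sf f0; refine (derV hT X (dat sf) f0). Qed.

Lemma der_vecD f X Y Z : smooth U f -> Z z = X z + Y z ->
  der Z f z = der X f z + der Y f z.
Proof.
by move=> sf ZXY; rewrite {1}/der ZXY differentialD//; exact: dat.
Qed.

Lemma der_vecB f X Y Z : smooth U f -> Z z = X z - Y z ->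
  der Z f z = der X f z - der Y f z.
Proof.
move=> sf ZXY; apply/eqP; rewrite eq_sym subr_eq; apply/eqP.
by apply: der_vecD => //; rewrite ZXY subrK.
Qed.

Lemma der_vecZ f (k : R) X Z : smooth U f -> Z z = k *: X z ->
  der Z f z = k * der X f z.
Proof.
by move=> sf ZX; rewrite {1}/der ZX; refine (differentialZ _ _ (dat sf)).
Qed.

Lemma der_vec0 f Z : Z z = 0 -> der Z f z = 0.
Proof. by move=> Z0; rewrite /der Z0 differential0. Qed.

Lemma der_vec f X Z : X z = Z z -> der X f z = der Z f z.
Proof. by rewrite /der => ->. Qed.

Lemma derR_eq X X' f h : X z = X' z -> (forall q, U q -> f q = h q) ->
  der X f z = der X' h z.
Proof. by move=> XX fh; refine (der_local hT oU Uz XX fh). Qed.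

Lemma lie_eq X X' Y Y' : (forall q, U q -> X q = X' q) ->
  (forall q, U q -> Y q = Y' q) -> lie X Y z = lie X' Y' z.
Proof. by move=> XX YY; refine (lie_local hT oU Uz XX YY). Qed.

Lemma lie0l X Y : (forall q, U q -> X q = 0) -> vfield U Y -> lie X Y z = 0.
Proof.
(* On U the zero field is Y - Y, so additivity and [Y, Y] = 0 apply. *)
move=> X0 vY; rewrite (lie_eq (X' := fun q => Y q - Y q) (Y' := Y))//.
  rewrite lieC (lieDr hT oU Uz vY vY (vf_opp vY)).
  rewrite lie_self add0r.
  rewrite (lie_eq (X' := Y) (Y' := fun q => cst (-1 : R) q *: Y q))//; last first.
    by move=> q _; rewrite scaleN1r.
  rewrite (lieZr e2 hT oU Uz vY vY (smooth_cst hT (-1 : R) oU)).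
  by rewrite derR_cst scale0r lie_self scaler0 addr0 oppr0.
by move=> q Uq; rewrite subrr X0.
Qed.

Lemma lieZ_r X Y a : vfield U X -> vfield U Y -> smooth U a ->
  lie X (fun q => a q *: Y q) z = der X a z *: Y z + a z *: lie X Y z.
Proof. by move=> vX vY sa; refine (lieZr e2 hT oU Uz vX vY sa). Qed.

Lemma lieD_r X Y Z : vfield U X -> vfield U Y -> vfield U Z ->
  lie X (fun q => Y q + Z q) z = lie X Y z + lie X Z z.
Proof. by move=> vX vY vZ; refine (lieDr hT oU Uz vX vY vZ). Qed.

Lemma lieD_l X Y Z : vfield U X -> vfield U Y -> vfield U Z ->
  lie (fun q => X q + Y q) Z z = lie X Z z + lie Y Z z.
Proof.
move=> vX vY vZ; rewrite lieC (lieD_r vZ vX vY) opprD.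
exact: (congr2 (fun u v => u + v) (esym (lieC X Z z)) (esym (lieC Y Z z))).
Qed.

Lemma lieZ_l X Y a : vfield U X -> vfield U Y -> smooth U a ->
  lie (fun q => a q *: X q) Y z = a z *: lie X Y z - der Y a z *: X z.
Proof.
move=> vX vY sa; rewrite lieC (lieZ_r vY vX sa) opprD addrC.
by rewrite (lieC X Y z) scalerN.
Qed.

Lemma dJ_vecD f X Y Z : smooth U f -> Z z = X z + Y z ->
  dJ f Z z = dJ f X z + dJ f Y z.
Proof. by move=> sf ZXY; apply: der_vecD => //; rewrite !JE ZXY linearD. Qed.

Lemma dJ_vecB f X Y Z : smooth U f -> Z z = X z - Y z ->
  dJ f Z z = dJ f X z - dJ f Y z.
Proof. by move=> sf ZXY; apply: der_vecB => //; rewrite !JE ZXY linearB. Qed.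

Lemma dJ_vecZ f (k : R) X Z : smooth U f -> Z z = k *: X z ->
  dJ f Z z = k * dJ f X z.
Proof. by move=> sf ZX; apply: der_vecZ => //; rewrite !JE ZX linearZ. Qed.

Lemma dJ_vec0 f X : (X z).1 = 0 -> dJ f X z = 0.
Proof. by move=> X0; apply: der_vec0; rewrite /J /gam /rho X0. Qed.

Lemma dJ_vec f X Y : (X z).1 = (Y z).1 -> dJ f X z = dJ f Y z.
Proof. by move=> XY; apply: der_vec; rewrite /J /gam /rho XY. Qed.

Lemma ddJE f X Y :
  ddJ f X Y z = der X (dJ f Y) z - der Y (dJ f X) z - dJ f (lie X Y) z.
Proof. by []. Qed.

Lemma ddJC f X Y : smooth U f -> ddJ f X Y z = - ddJ f Y X z.
Proof.
move=> sf; have E : dJ f (lie X Y) z = (-1) * dJ f (lie Y X) z.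
  by refine (dJ_vecZ sf _); rewrite scaleN1r; exact: lieC.
rewrite !ddJE.
rewrite -> E; atoms; ring.
Qed.

Lemma ddJ_self f X : ddJ f X X z = 0.
Proof.
have E : dJ f (lie X X) z = 0 by apply: dJ_vec0; rewrite lie_self.
by rewrite ddJE; rewrite -> E; rewrite subrr subr0.
Qed.

Lemma ddJ_eq f X X' Y Y' : (forall q, U q -> X q = X' q) ->
  (forall q, U q -> Y q = Y' q) -> ddJ f X Y z = ddJ f X' Y' z.
Proof.
move=> XX YY.
have dJq A B q : U q -> (forall q, U q -> A q = B q) -> dJ f A q = dJ f B q.
  by move=> Uq AB; rewrite /dJ /der /J /gam /rho AB.
have E1 := derR_eq (XX z Uz) (fun q Uq => dJq Y Y' q Uq YY).
have E2 := derR_eq (YY z Uz) (fun q Uq => dJq X X' q Uq XX).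
have E3 : dJ f (lie X Y) z = dJ f (lie X' Y') z.
  by apply: dJ_vec; rewrite -> (lie_eq XX YY).
by rewrite !ddJE; rewrite -> E1, E2, E3; reflexivity.
Qed.

(** Tensoriality of dd_J f in its first argument: the term (Y a) d_J f(X) from differentiating d_J
    f(a X) cancels against the one from [a X, Y]. *)
Lemma ddJ_vecZD f a X Z Y : smooth U f -> smooth U a -> vfield U X ->
  vfield U Z -> vfield U Y ->
  ddJ f (fun q => a q *: X q + Z q) Y z = a z * ddJ f X Y z + ddJ f Z Y z.
Proof.
move=> sf sa vX vZ vY; have vaX := vf_scale sa vX.
pose T := fun q => a q *: X q + Z q; rewrite -/T.
have saX : smooth U (fun q => a q * dJ f X q).
  by refine (smoothM hT oU sa (smooth_dJ vX sf)).
have dT q : U q -> dJ f T q = a q * dJ f X q + dJ f Z q.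
  move=> Uq; have daZ := smooth_diff_at hT sf Uq.
  by rewrite /dJ /der !JE linearD linearZ (differentialD _ _ daZ) (differentialZ _ _ daZ).
have E1 : der T (dJ f Y) z = a z * der X (dJ f Y) z + der Z (dJ f Y) z.
  have sY := smooth_dJ vY sf.
  have D1 := @der_vecD _ (fun q => a q *: X q) Z T sY erefl.
  have D2 := @der_vecZ _ (a z) X (fun q => a q *: X q) sY erefl.
  rewrite -> D1.
  rewrite -> D2.
  reflexivity.
have E2 : der Y (dJ f T) z =
    der Y a z * dJ f X z + a z * der Y (dJ f X) z + der Y (dJ f Z) z.
  have D1 := derR_eq (erefl (Y z)) dT.
  have D2 := derRD Y saX (smooth_dJ vZ sf).
  have D3 := derRM Y sa (smooth_dJ vX sf).
  exact (etrans D1 (etrans D2 (congr1 (fun u => u + der Y (dJ f Z) z) D3))).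
have E3 : dJ f (lie T Y) z =
    a z * dJ f (lie X Y) z - der Y a z * dJ f X z + dJ f (lie Z Y) z.
  have D1 := @dJ_vecD f _ _ (lie T Y) sf (lieD_l vaX vZ vY).
  pose T1 := fun q => a q *: lie X Y q; pose T2 := fun q => der Y a q *: X q.
  have D2 := @dJ_vecB f T1 T2 (lie (fun q => a q *: X q) Y) sf (lieZ_l vX vY sa).
  have D3 := @dJ_vecZ f (a z) (lie X Y) T1 sf erefl.
  have D4 := @dJ_vecZ f (der Y a z) X T2 sf erefl.
  by rewrite -> D1, D2, D3, D4; reflexivity.
by rewrite !ddJE; rewrite -> E1, E2, E3; atoms; ring.
Qed.

Lemma ddJ_vec0 f X Y : vfield U Y -> (forall q, U q -> X q = 0) ->
  ddJ f X Y z = 0.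
Proof.
move=> vY X0; have D1 : der X (dJ f Y) z = 0 := der_vec0 _ (X0 z Uz).
have D2 : der Y (dJ f X) z = 0.
  have dX0 q : U q -> dJ f X q = 0.
    move=> Uq; rewrite /dJ /der /J /gam /rho; rewrite -> (X0 q Uq).
    exact: differential0.
  exact (etrans (@derR_eq Y Y (dJ f X) (fun=> 0) erefl dX0) (derR_cst Y 0)).
have D3 : dJ f (lie X Y) z = 0.
  have L0 : (lie X Y z).1 = 0 by rewrite -> (lie0l X0 vY); reflexivity.
  exact (dJ_vec0 f L0).
rewrite -> ddJE, D1, D2, D3; by rewrite !subr0.
Qed.

Lemma ddJ_vecN f X Y : smooth U f -> vfield U X -> vfield U Y ->
  ddJ f (fun q => - X q) Y z = - ddJ f X Y z.
Proof.
move=> sf vX vY; pose O : TM -> V2 := fun=> 0.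
have D1 := ddJ_vecZD sf (smooth_cst hT (-1 : R) oU) vX (vfield0 hT oU) vY.
have D2 : ddJ f O Y z = 0 := ddJ_vec0 f vY (fun q _ => erefl).
have D3 : ddJ f (fun q => - X q) Y z = ddJ f (fun q => -1 *: X q + O q) Y z.
  refine (ddJ_eq f _ (fun q _ => erefl)) => q _.
  by rewrite scaleN1r addr0.
rewrite -> D3; refine (etrans D1 (etrans (congr1 (fun u => _ + u) D2) _)).
by rewrite addr0; exact: mulN1r.
Qed.

(** The rule d(a d_J f + b d_J h) = da /\ d_J f + a dd_J f + db /\ d_J h + b dd_J h, needed for
    energies expressed through F and Phi. *)
Lemma ddJ_comb f h l a b X Y : smooth U f -> smooth U h -> smooth U a ->
  smooth U b -> vfield U X -> vfield U Y ->
  (forall Z q, vfield U Z -> U q -> dJ l Z q = a q * dJ f Z q + b q * dJ h Z q) ->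
  ddJ l X Y z =
    (der X a z * dJ f Y z - der Y a z * dJ f X z + a z * ddJ f X Y z) +
    (der X b z * dJ h Y z - der Y b z * dJ h X z + b z * ddJ h X Y z).
Proof.
move=> sf sh sa sb vX vY lE.
have E A B : vfield U A -> vfield U B -> der A (dJ l B) z =
    (der A a z * dJ f B z + a z * der A (dJ f B) z) +
    (der A b z * dJ h B z + b z * der A (dJ h B) z).
  move=> vA vB; have sfB := smooth_dJ vB sf; have shB := smooth_dJ vB sh.
  have D1 := derR_eq (erefl (A z)) (fun q => lE B q vB).
  have D2 := derRD A (smoothM hT oU sa sfB) (smoothM hT oU sb shB).
  have D3 := derRM A sa sfB; have D4 := derRM A sb shB.
  exact (etrans D1 (etrans D2 (congr2 (fun u v => u + v) D3 D4))).
have vL := vf_lie vX vY.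
by rewrite !ddJE; rewrite -> (E X Y vX vY), (E Y X vY vX), (lE _ _ vL Uz); atoms; ring.
Qed.

End AtPoint.

Lemma smooth_ddJ f X Y : smooth U f -> vfield U X -> vfield U Y ->
  smooth U (ddJ f X Y).
Proof.
move=> sf vX vY.
refine (smR_sub (smR_sub (smooth_derR vX (smooth_dJ vY sf))
  (smooth_derR vY (smooth_dJ vX sf))) (smooth_dJ (vf_lie vX vY) sf)).
Qed.

End ExteriorCalculus.

(** * The geodesic spray and its Barthel connection *)

Section Spray.
Context {R : realType} {n : nat}.
Variables (M : charted 'rV[R]_n) (hM : atlas M).
Local Notation TM := (tangent M).
Local Notation V1 := 'rV[R]_n.
Local Notation V2 := ('rV[R]_n * 'rV[R]_n)%type.
Local Notation hT := (atlas_tangent hM).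
Variables (U : set TM) (oU : opn U).
Implicit Types (z q : TM) (X Y Z : TM -> V2) (W : TM -> V1) (f h a b : TM -> R).

Section Barthel.
Variables (G : TM -> V2) (vG : vfield U G).

Lemma barthel_eq X Y z : U z -> (forall q, U q -> X q = Y q) ->
  barthel G X z = barthel G Y z.
Proof.
move=> Uz XY.
have E1 : lie (J X) G z = lie (J Y) G z.
  apply: (lie_eq hM oU Uz) => // q Uq.
  by rewrite /J /gam /rho; rewrite -> (XY q Uq).
have E2 : lie X G z = lie Y G z by exact: (lie_eq hM oU Uz).
rewrite /barthel; exact: (congr2 (fun u v => u - vert v) E1 E2).
Qed.

Lemma barthelD X Y z : U z -> vfield U X -> vfield U Y ->
  barthel G (fun q => X q + Y q) z = barthel G X z + barthel G Y z.
Proof.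
move=> Uz vX vY; have vJX := vfield_J hM oU vX; have vJY := vfield_J hM oU vY.
have E1 : lie (J (fun q => X q + Y q)) G z = lie (J X) G z + lie (J Y) G z.
  rewrite <- (lieD_l hM oU Uz vJX vJY vG).
  apply: (lie_eq hM oU Uz) => // q Uq; exact: (linearD vert).
have E2 := lieD_l hM oU Uz vX vY vG.
have key (u v u' v' : V2) : u + v - vert (u' + v') = (u - vert u') + (v - vert v').
  by rewrite linearD opprD addrACA.
exact: (etrans (congr2 (fun u v => u - vert v) E1 E2) (key _ _ _ _)).
Qed.

Lemma vf_barthel X : vfield U X -> vfield U (barthel G X).
Proof.
move=> vX; refine (vf_sub hM oU (vf_lie hM oU (vfield_J hM oU vX) vG) _).
exact (vfield_J hM oU (vf_lie hM oU vX vG)).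
Qed.

Lemma vf_hproj X : vfield U X -> vfield U (hproj G X).
Proof.
move=> vX; refine (vf_scale hM oU (smooth_cst hT (2^-1 : R) oU) _).
exact (vf_add hM oU vX (vf_barthel vX)).
Qed.

Lemma hproj_eq X Y z : U z -> (forall q, U q -> X q = Y q) ->
  hproj G X z = hproj G Y z.
Proof.
move=> Uz XY; exact: (congr2 (fun u v => 2^-1 *: (u + v)) (XY z Uz) (barthel_eq Uz XY)).
Qed.

Lemma hprojD X Y z : U z -> vfield U X -> vfield U Y ->
  hproj G (fun q => X q + Y q) z = hproj G X z + hproj G Y z.
Proof.
move=> Uz vX vY.
have key (u v u' v' : V2) : 2^-1 *: (u + v + (u' + v')) =
    2^-1 *: (u + u') + 2^-1 *: (v + v').
  by rewrite addrACA scalerDr.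
have E := barthelD Uz vX vY.
exact: (etrans (congr1 (fun u => 2^-1 *: (X z + Y z + u)) E) (key _ _ _ _)).
Qed.

Hypothesis rhoG : forall q, U q -> rho G q = q.2.

(** J^2 = 0 removes one bracket and J [JX, G] = JX evaluates the other: vertical fields are
    eigenvectors of the Barthel connection for -1. *)
Lemma barthel_J X z : U z -> vfield U X -> barthel G (J X) z = - J X z.
Proof.
move=> Uz vX.
have E1 : lie (J (J X)) G z = 0 by exact: (lie0l hM oU Uz (fun q _ => erefl) vG).
have E2 := rho_lie_J hM oU Uz vX vG rhoG.
have key (u : V2) x : u.1 = x -> 0 - vert u = - ((0, x) : V2).
  by move=> <-; rewrite sub0r.
exact: (etrans (congr1 (fun u => u - vert (lie (J X) G z)) E1) (key _ _ E2)).
Qed.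

End Barthel.

Variables (F : TM -> R) (G : TM -> V2).
Local Notation E := (energy F).
Hypothesis sF : smooth U F.
Hypothesis homF : forall z (l : R), 0 < l -> F (z.1, l *: z.2) = l * F z.
Hypothesis vG : vfield U G.
Hypothesis JG : forall q, U q -> J G q = liouville q.
Hypothesis CG : forall q, U q -> lie liouville G q = G q.
Hypothesis EL : forall X q, vfield U X -> U q -> ddJ E G X q = - der X E q.

Lemma smooth_energy : smooth U E.
Proof.
refine (smoothM hT oU (smooth_cst hT (2^-1 : R) oU) (smoothM hT oU sF sF)).
Qed.

Lemma der_energy X z : U z -> der X E z = F z * der X F z.
Proof.
move=> Uz; have D1 := derRcM hM oU Uz X 2^-1 (smoothM hT oU sF sF).
have D2 := derRM hM Uz X sF sF.
transitivity (2^-1 * der X (fun q => F q * F q) z); first exact D1.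
rewrite -> D2; generalize (F z); atoms_lra.
Qed.

Lemma der_liouville_F z : U z -> der liouville F z = F z.
Proof. by move=> Uz; refine (der_liouville hM (dat hM Uz sF) (homF z)). Qed.

Lemma der_liouville_energy z : U z -> der liouville E z = 2 * E z.
Proof.
move=> Uz; rewrite (der_energy _ Uz); rewrite -> (der_liouville_F Uz).
by rewrite /energy; lra.
Qed.

Lemma rho_spray q : U q -> rho G q = q.2.
Proof. by move=> Uq; exact: (congr1 snd (JG Uq)). Qed.

Lemma vf_liouville : vfield U (liouville : TM -> V2).
Proof. by refine ((pvfieldP hM _ oU).1 (pvfield_eta hM oU)). Qed.

(* That is, [J, C] = J; it follows from N_J = 0 and J[JX, G] = JX. *)
Lemma lie_J_liouville X z : U z -> vfield U X ->
  lie (J X) liouville z = J X z + J (lie X liouville) z.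
Proof.
move=> Uz vX; have vJX := vfield_J hM oU vX.
have E1 : lie (J X) liouville z = lie (J X) (J G) z.
  exact (lie_eq hM oU Uz (fun q _ => erefl) (fun q Uq => esym (JG Uq))).
have E2 := lie_J_J hM oU Uz vX vG.
have E3 := rho_lie_J hM oU Uz vX vG rho_spray.
have E4 : lie X liouville z = lie X (J G) z.
  exact (lie_eq hM oU Uz (fun q _ => erefl) (fun q Uq => esym (JG Uq))).
rewrite -> E1, E2.
transitivity (vert (lie (J X) G z) + vert (lie X (J G) z)).
  exact: (linearD vert).
exact: (congr2 (fun u v => ((0, u) : V2) + vert v) E3 (esym E4)).
Qed.

(** The Euler-Lagrange equation evaluated on G itself, where the 2-form vanishes. *)
Lemma der_spray_energy z : U z -> der G E z = 0.
Proof.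
move=> Uz; have := EL vG Uz; rewrite -> (ddJ_self z E G) => /eqP.
by rewrite eq_sym oppr_eq0 => /eqP.
Qed.

Lemma dJ_energy_spray z : U z -> dJ E G z = 2 * E z.
Proof.
move=> Uz; rewrite <- (der_liouville_energy Uz); exact: (der_vec E (JG Uz)).
Qed.

Lemma der_dJ_energy_spray X z : U z -> der X (dJ E G) z = 2 * der X E z.
Proof.
move=> Uz; rewrite <- (derRcM hM oU Uz X 2 smooth_energy).
exact: (derR_eq hM oU Uz (erefl (X z)) dJ_energy_spray).
Qed.

Lemma dJ_lieC f X Y z : U z -> smooth U f ->
  dJ f (lie X Y) z = - dJ f (lie Y X) z.
Proof.
move=> Uz sf; transitivity (-1 * dJ f (lie Y X) z); last exact: mulN1r.
by refine (dJ_vecZ hM Uz sf _); rewrite scaleN1r; exact: lieC.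
Qed.

Lemma der_barthel_energy X z : U z -> vfield U X ->
  der (barthel G X) E z = - der X E z.
Proof.
move=> Uz vX; have sE := smooth_energy; have vJX := vfield_J hM oU vX.
have D1 : der (barthel G X) E z = der (lie (J X) G) E z - dJ E (lie X G) z.
  exact (@der_vecB _ _ _ hM _ _ Uz E (lie (J X) G) (J (lie X G)) (barthel G X) sE erefl).
have D2 : der (lie (J X) G) E z = der (J X) (der G E) z - der G (dJ E X) z.
  exact (derR_lie hM oU Uz vJX vG sE).
have D3 : der (J X) (der G E) z = 0.
  rewrite <- (derR_cst hM oU Uz (J X) 0).
  exact: (derR_eq hM oU Uz (erefl (J X z)) der_spray_energy).
have D4 := EL vX Uz; rewrite -> ddJE in D4.
have D5 := der_dJ_energy_spray X Uz.
have D6 := @dJ_lieC E G X z Uz sE.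
revert D1 D2 D3 D4 D5 D6; atoms_lra.
Qed.

(* d_h E = 0, because d_[J,G] E = d_J (G E) - L_G d_J E = - dE. *)
Lemma der_hproj_energy X z : U z -> vfield U X -> der (hproj G X) E z = 0.
Proof.
move=> Uz vX; have sE := smooth_energy.
have D1 := @der_vecZ _ _ _ hM _ _ Uz E 2^-1 (fun q => X q + barthel G X q) (hproj G X) sE erefl.
have D2 := @der_vecD _ _ _ hM _ _ Uz E X (barthel G X) (fun q => X q + barthel G X q) sE erefl.
have D3 := der_barthel_energy Uz vX.
rewrite -> D1, D2, D3; atoms_lra.
Qed.

(** The homogeneity [C, G] = G, with JG = C, is what makes the spray horizontal. *)
Lemma barthel_spray z : U z -> barthel G G z = G z.
Proof.
move=> Uz.
have E1 : lie (J G) G z = G z.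
  rewrite <- (CG Uz); exact: (lie_eq hM oU Uz JG (fun q _ => erefl)).
have E2 : lie G G z = 0 := lie_self G z.
have key (u : V2) : u - vert 0 = u by rewrite linear0 subr0.
exact: (etrans (congr2 (fun u v => u - vert v) E1 E2) (key _)).
Qed.

(** As d_J E vanishes on C, the left side is the Lie derivative of d_J E along C; C(E) = 2 E and
    [J, C] = J give 2 d_J E - d_J E. *)
Lemma ddJ_energy_liouville X z : U z -> vfield U X ->
  ddJ E liouville X z = dJ E X z.
Proof.
move=> Uz vX; have sE := smooth_energy; have vJX := vfield_J hM oU vX.
have D1 : der X (dJ E liouville) z = 0.
  rewrite <- (derR_cst hM oU Uz X 0).
  apply: (derR_eq hM oU Uz (erefl (X z))) => q Uq; exact: dJ_vec0.
have D2 : der (lie liouville (J X)) E z =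
    der liouville (dJ E X) z - der (J X) (der liouville E) z.
  exact (derR_lie hM oU Uz vf_liouville vJX sE).
have D3 : der (J X) (der liouville E) z = 2 * dJ E X z.
  transitivity (der (J X) (fun q => 2 * E q) z).
    exact: (derR_eq hM oU Uz (erefl (J X z)) der_liouville_energy).
  exact (derRcM hM oU Uz (J X) 2 sE).
have D4 : der (lie (J X) liouville) E z = dJ E X z + dJ E (lie X liouville) z.
  exact (@der_vecD _ _ _ hM _ _ Uz E (J X) (J (lie X liouville)) _ sE (lie_J_liouville Uz vX)).
have D5 : der (lie (J X) liouville) E z = - der (lie liouville (J X)) E z.
  transitivity (-1 * der (lie liouville (J X)) E z); last exact: mulN1r.
  refine (der_vecZ hM Uz sE _).
  by rewrite scaleN1r; exact: lieC.
have D6 := @dJ_lieC E X liouville z Uz sE.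
rewrite -> ddJE; revert D1 D2 D3 D4 D5 D6; atoms_lra.
Qed.

(** Symmetry of the metric. The difference of the two sides is [JX, JY] E - d_J E([JX, Y] +
    [X, JY]), which is zero by N_J = 0. *)
Lemma ddJ_energy_sym X Y z : U z -> vfield U X -> vfield U Y ->
  ddJ E (J X) Y z = ddJ E (J Y) X z.
Proof.
move=> Uz vX vY; have sE := smooth_energy.
have vJX := vfield_J hM oU vX; have vJY := vfield_J hM oU vY.
have D0 A B : der A (dJ E (J B)) z = 0.
  rewrite <- (derR_cst hM oU Uz A 0).
  apply: (derR_eq hM oU Uz (erefl (A z))) => q Uq; exact: dJ_vec0.
have D1 : der (lie (J X) (J Y)) E z = der (J X) (dJ E Y) z - der (J Y) (dJ E X) z.
  exact (derR_lie hM oU Uz vJX vJY sE).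
have D2 : der (lie (J X) (J Y)) E z = dJ E (lie (J X) Y) z + dJ E (lie X (J Y)) z.
  have D := @der_vecD _ _ _ hM _ _ Uz E (J (lie (J X) Y)) (J (lie X (J Y))) (lie (J X) (J Y)) sE.
  apply: D; rewrite -> (lie_J_J hM oU Uz vX vY); exact: (linearD vert).
have D3 := @dJ_lieC E X (J Y) z Uz sE.
have D4 := D0 X Y; have D5 := D0 Y X.
rewrite -> !ddJE; revert D1 D2 D3 D4 D5; atoms_lra.
Qed.

End Spray.

(** * Concurrent vector fields *)

Section Concurrent.
Context {R : realType} {n : nat}.
Variables (M : charted 'rV[R]_n) (hM : atlas M).
Local Notation TM := (tangent M).
Local Notation V1 := 'rV[R]_n.
Local Notation V2 := ('rV[R]_n * 'rV[R]_n)%type.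
Local Notation hT := (atlas_tangent hM).
Variables (U : set TM) (oU : opn U).
Implicit Types (z q : TM) (X Y Z : TM -> V2) (W A B : TM -> V1).
Variables (F : TM -> R) (G : TM -> V2) (g : TM -> V1 -> V1 -> R).
Variables (beta : (TM -> V1) -> TM -> V2) (phi : TM -> V1).
Local Notation E := (energy F).
Hypothesis sF : smooth U F.
Hypothesis homF : forall z (l : R), 0 < l -> F (z.1, l *: z.2) = l * F z.
Hypothesis vG : vfield U G.
Hypothesis JG : forall q, U q -> J G q = liouville q.
Hypothesis CG : forall q, U q -> lie liouville G q = G q.
Hypothesis EL : forall X q, vfield U X -> U q -> ddJ E G X q = - der X E q.
Hypothesis hg : forall X Y q, vfield U X -> vfield U Y -> U q ->
  pair2 g (rho X) (rho Y) q = ddJ E (J X) Y q.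
Hypothesis vbeta : forall W, pvfield U W -> vfield U (beta W).
Hypothesis rbeta : forall W q, pvfield U W -> U q -> rho (beta W) q = W q.
Hypothesis hbeta : forall W q, pvfield U W -> U q -> hproj G (beta W) q = beta W q.
Hypothesis vphi : pvfield U phi.
(** The condition D_(gam W) phi = 0, seen through the formula of the Berwald connection. The next
    two hypotheses are the formulas of the Cartan connection with nabla_(gam W) phi = 0 and
    nabla_(beta A) phi = - A put in on the left. *)
Hypothesis vertical_phi : forall W q, pvfield U W -> U q ->
  rho (lie (gam W) (beta phi)) q = 0.
Hypothesis cartan_vertical : forall W A q, pvfield U W -> pvfield U A -> U q ->
  2 * g q 0 (A q) = der (gam W) (pair2 g phi A) q
    + pair2 g phi (rho (lie (beta A) (gam W))) q
    + pair2 g A (rho (lie (gam W) (beta phi))) q.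
Hypothesis cartan_horizontal : forall A B q, pvfield U A -> pvfield U B -> U q ->
  2 * g q (- A q) (B q) = der (beta A) (pair2 g phi B) q
    + der (beta phi) (pair2 g B A) q
    - der (beta B) (pair2 g A phi) q
    - pair2 g A (rho (lie (beta phi) (beta B))) q
    + pair2 g phi (rho (lie (beta B) (beta A))) q
    + pair2 g B (rho (lie (beta A) (beta phi))) q.

Let sE : smooth U E. Proof. exact: (smooth_energy hM oU sF). Qed.
Let veta : pvfield U (eta : TM -> V1). Proof. exact: (pvfield_eta hM oU). Qed.
Let vgam W : pvfield U W -> vfield U (gam W).
Proof. by move=> vW; refine ((pvfieldP hM W oU).1 vW). Qed.

(** [g] is accessible only through projections of vector fields; lifting by [beta] makes its
    symmetry, smoothness and behaviour under sign consequences of properties of dd_J E. *)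
Lemma pair2_ddJ A B q : pvfield U A -> pvfield U B -> U q ->
  pair2 g A B q = ddJ E (J (beta A)) (beta B) q.
Proof.
move=> vA vB Uq; transitivity (pair2 g (rho (beta A)) (rho (beta B)) q).
  by rewrite /pair2; rewrite -> (rbeta vA Uq), (rbeta vB Uq); reflexivity.
exact (hg (vbeta vA) (vbeta vB) Uq).
Qed.

Lemma pair2C A B q : pvfield U A -> pvfield U B -> U q ->
  pair2 g A B q = pair2 g B A q.
Proof.
move=> vA vB Uq; rewrite -> (pair2_ddJ vA vB Uq), (pair2_ddJ vB vA Uq).
exact: (ddJ_energy_sym hM oU sF Uq (vbeta vA) (vbeta vB)).
Qed.

Lemma smooth_pair2 A B : pvfield U A -> pvfield U B -> smooth U (pair2 g A B).
Proof.
move=> vA vB.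
have s := smooth_ddJ hM oU sE (vfield_J hM oU (vbeta vA)) (vbeta vB).
by refine (smooth_eq hT oU (fun q Uq => esym (pair2_ddJ vA vB Uq)) s).
Qed.

Lemma pair2_Nl A B q : pvfield U A -> pvfield U B -> U q ->
  g q (- A q) (B q) = - pair2 g A B q.
Proof.
move=> vA vB Uq; pose X := fun q => - beta A q.
have vX : vfield U X := vf_opp hM oU (vbeta vA).
have vJA := vfield_J hM oU (vbeta vA).
have E1 : g q (- A q) (B q) = pair2 g (rho X) (rho (beta B)) q.
  rewrite /pair2; rewrite -> (rbeta vB Uq); congr (g q _ _).
  rewrite -(rbeta vA Uq); reflexivity.
have E2 : ddJ E (J X) (beta B) q = ddJ E (fun p => - J (beta A) p) (beta B) q.
  exact (ddJ_eq hM oU Uq E (fun p _ => linearN vert _) (fun p _ => erefl)).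
rewrite -> (pair2_ddJ vA vB Uq), E1, (hg vX (vbeta vB) Uq), E2.
exact (ddJ_vecN hM oU Uq sE vJA (vbeta vB)).
Qed.

Lemma pair2_Nr A B q : pvfield U A -> pvfield U B -> U q ->
  g q (A q) (- B q) = - pair2 g A B q.
Proof.
move=> vA vB Uq; have vNB : pvfield U (fun q => - B q).
  refine ((pvfieldP hM _ oU).2 _).
  refine (vfield_eq hT oU _ (vf_opp hM oU (vgam vB))) => p _.
  transitivity ((- 0, - B p) : V2) => //; by rewrite oppr0.
transitivity (pair2 g A (fun q => - B q) q) => //.
rewrite -> (pair2C vA vNB Uq), (pair2C vA vB Uq); exact: pair2_Nl.
Qed.

Lemma pair2_0l B q : pvfield U B -> U q -> g q 0 (B q) = 0.
Proof.
move=> vB Uq; pose Z : TM -> V1 := fun=> 0.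
have vZ : pvfield U Z.
  refine ((pvfieldP hM _ oU).2 _); exact (vfield0 hT oU).
have := pair2_Nl vZ vB Uq; rewrite /Z /pair2 oppr0; lra.
Qed.

Lemma pair2_0r A q : pvfield U A -> U q -> g q (A q) 0 = 0.
Proof.
move=> vA Uq; pose Z : TM -> V1 := fun=> 0.
have vZ : pvfield U Z.
  refine ((pvfieldP hM _ oU).2 _); exact (vfield0 hT oU).
transitivity (pair2 g A Z q) => //; rewrite -> (pair2C vA vZ Uq).
exact: pair2_0l.
Qed.

Lemma pair2_lieC A X Y q : pvfield U A -> vfield U X -> vfield U Y -> U q ->
  pair2 g A (rho (lie X Y)) q = - pair2 g A (rho (lie Y X)) q.
Proof.
move=> vA vX vY Uq; have vL := pvfield_rho hM oU (vf_lie hM oU vY vX).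
rewrite <- (pair2_Nr vA vL Uq).
exact: (congr1 (g q (A q)) (congr1 fst (lieC X Y q))).
Qed.

(** Since eta = rho G and JG = C, pairing with eta is contraction of dd_J E with C, which is d_J E
    by homogeneity. *)
Lemma pair2_eta X q : vfield U X -> U q -> pair2 g eta (rho X) q = dJ E X q.
Proof.
move=> vX Uq; rewrite <- (ddJ_energy_liouville hM oU sF homF vG JG Uq vX).
transitivity (pair2 g (rho G) (rho X) q).
  rewrite /pair2; rewrite -> (rho_spray JG Uq); reflexivity.
rewrite -> (hg vG vX Uq).
exact: (ddJ_eq hM oU Uq E JG (fun p _ => erefl)).
Qed.

Lemma split_vert X : vfield U X -> (forall q, U q -> rho X q = 0) ->
  exists2 W, pvfield U W & forall q, U q -> X q = gam W q.
Proof.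
move=> vX X0; pose W : TM -> V1 := fun q => (X q).2.
have XW q : U q -> X q = gam W q.
  by move=> Uq; rewrite [LHS]surjective_pairing (X0 q Uq : (X q).1 = 0).
exists W; last exact XW.
refine ((pvfieldP hM _ oU).2 _).
exact (vfield_eq hT oU XW vX).
Qed.

Lemma barthel_gam W q : pvfield U W -> U q -> barthel G (gam W) q = - gam W q.
Proof.
move=> vW Uq; have JB p : U p -> gam W p = J (beta W) p.
  by move=> Up; rewrite /J /gam; rewrite -> (rbeta vW Up); reflexivity.
rewrite -> (barthel_eq hM oU G Uq JB).
rewrite -> (barthel_J hM oU vG (rho_spray JG) Uq (vbeta vW)).
exact: (congr1 -%R (esym (JB q Uq))).
Qed.

(* Both sides have the same projection by rho, and h kills vertical fields. *)
Lemma beta_eta q : U q -> beta eta q = G q.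
Proof.
move=> Uq; have vT := vf_sub hM oU (vbeta veta) vG.
have [p Up|W vW TW] := split_vert vT.
  transitivity (rho (beta eta) p - rho G p) => //.
  rewrite -> (rbeta veta Up), (rho_spray JG Up); exact: subrr.
have bE p : U p -> beta eta p = G p + gam W p.
  by move=> Up; rewrite -> (esym (TW p Up)); rewrite addrC subrK.
have E1 := barthel_eq hM oU G Uq bE.
have E2 := barthelD hM oU vG Uq vG (vgam vW).
have E3 := barthel_spray hM oU JG CG Uq.
have E4 := barthel_gam vW Uq.
(* The horizontal projector maps G + gam W to the half-sum of G + gam W and G - gam W, that is to
   G. *)
have key (b u w c : V2) : b = u + w -> c = u - w -> 2^-1 *: (b + c) = b -> b = u.
  move=> -> -> <-; have -> : u + w + (u - w) = (2 : R) *: u.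
    by rewrite addrACA subrr addr0 scaler_nat mulr2n.
  by rewrite scalerA mulVf ?scale1r// pnatr_eq0.
refine (key _ _ _ _ (bE q Uq) _ (hbeta veta Uq)).
exact (etrans E1 (etrans E2 (congr2 (fun u v => u + v) E3 E4))).
Qed.

(** In the vertical Cartan formula the left side is zero, and the Berwald condition annihilates the
    bracket containing [beta phi]; one bracket remains. *)
Lemma der_vertical W A q : pvfield U W -> pvfield U A -> U q ->
  der (gam W) (pair2 g phi A) q = pair2 g phi (rho (lie (gam W) (beta A))) q.
Proof.
move=> vW vA Uq; have D1 := cartan_vertical vW vA Uq.
have D2 := pair2_0l vA Uq.
have D3 : pair2 g A (rho (lie (gam W) (beta phi))) q = 0.
  by rewrite /pair2; rewrite -> (vertical_phi vW Uq); exact: pair2_0r.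
have D4 := pair2_lieC vphi (vbeta vA) (vgam vW) Uq.
rewrite -> D2 in D1.
revert D1 D3 D4; atoms_lra.
Qed.

Local Notation Phi := (pair2 g phi eta).

(** The case A = eta of [der_vertical]: there beta eta = G, and the bracket with G is evaluated by J
    [JX, G] = JX. *)
Lemma dJ_Phi X q : vfield U X -> U q -> dJ Phi X q = pair2 g phi (rho X) q.
Proof.
move=> vX Uq; have vW := pvfield_rho hM oU vX.
have E1 := der_vertical vW veta Uq.
transitivity (pair2 g phi (rho (lie (gam (rho X)) (beta eta))) q); first exact E1.
have E2 : lie (gam (rho X)) (beta eta) q = lie (J X) G q.
  exact (lie_eq hM oU Uq (fun p _ => erefl) beta_eta).
have E3 := rho_lie_J hM oU Uq vX vG (rho_spray JG).
exact: (congr1 (g q (phi q)) (etrans (congr1 fst E2) E3)).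
Qed.

Lemma dJ_Phi_beta A q : pvfield U A -> U q -> dJ Phi (beta A) q = pair2 g phi A q.
Proof.
move=> vA Uq; rewrite -> (dJ_Phi (vbeta vA) Uq).
by rewrite /pair2; rewrite -> (rbeta vA Uq); reflexivity.
Qed.

Let sPhi : smooth U Phi. Proof. exact: smooth_pair2. Qed.

(** d_J Phi vanishes on vertical fields, and [dJ_Phi] turns the two remaining terms into the two
    sides of [der_vertical]. *)
Lemma ddJ_Phi_vh W A q : pvfield U W -> pvfield U A -> U q ->
  ddJ Phi (gam W) (beta A) q = 0.
Proof.
move=> vW vA Uq; have D1 := der_vertical vW vA Uq.
have D2 : der (gam W) (dJ Phi (beta A)) q = der (gam W) (pair2 g phi A) q.
  exact (derR_eq hM oU Uq (erefl (gam W q)) (fun p => dJ_Phi_beta vA)).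
have D3 : der (beta A) (dJ Phi (gam W)) q = 0.
  rewrite <- (derR_cst hM oU Uq (beta A) 0).
  apply: (derR_eq hM oU Uq (erefl (beta A q))) => p Up; exact: dJ_vec0.
have D4 := dJ_Phi (vf_lie hM oU (vgam vW) (vbeta vA)) Uq.
rewrite -> ddJE; revert D1 D2 D3 D4; atoms_lra.
Qed.

Lemma ddJ_Phi_vv W A q : pvfield U W -> pvfield U A -> U q ->
  ddJ Phi (gam W) (gam A) q = 0.
Proof.
move=> vW vA Uq.
have D B B' : der (gam B) (dJ Phi (gam B')) q = 0.
  rewrite <- (derR_cst hM oU Uq (gam B) 0).
  apply: (derR_eq hM oU Uq (erefl (gam B q))) => p Up; exact: dJ_vec0.
have D1 := D W A; have D2 := D A W.
have D3 : dJ Phi (lie (gam W) (gam A)) q = 0.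
  by apply: dJ_vec0; exact: (lie_gam_gam hM oU Uq vW vA).
rewrite -> ddJE; revert D1 D2 D3; atoms_lra.
Qed.

(* Antisymmetrize in A and B the formula defining nabla_(beta A) phi = - A. *)
Lemma ddJ_Phi_hh A B q : pvfield U A -> pvfield U B -> U q ->
  ddJ Phi (beta A) (beta B) q = 0.
Proof.
move=> vA vB Uq; have vA' := vbeta vA; have vB' := vbeta vB.
have vphi' := vbeta vphi.
have H1 := cartan_horizontal vA vB Uq; have H2 := cartan_horizontal vB vA Uq.
rewrite -> (pair2_Nl vA vB Uq) in H1; rewrite -> (pair2_Nl vB vA Uq) in H2.
have S1 := pair2C vA vB Uq.
have dS X C D : pvfield U C -> pvfield U D ->
    der X (pair2 g C D) q = der X (pair2 g D C) q.
  move=> vC vD; exact (derR_eq hM oU Uq (erefl (X q)) (fun p => pair2C vC vD)).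
have S2 := dS (beta phi) _ _ vB vA.
have S3 := dS (beta B) _ _ vA vphi; have S4 := dS (beta A) _ _ vB vphi.
have L1 := pair2_lieC vA vphi' vB' Uq.
have L2 := pair2_lieC vB vphi' vA' Uq.
have L3 := pair2_lieC vphi vB' vA' Uq.
have D1 : der (beta A) (dJ Phi (beta B)) q = der (beta A) (pair2 g phi B) q.
  exact (derR_eq hM oU Uq (erefl (beta A q)) (fun p => dJ_Phi_beta vB)).
have D2 : der (beta B) (dJ Phi (beta A)) q = der (beta B) (pair2 g phi A) q.
  exact (derR_eq hM oU Uq (erefl (beta B q)) (fun p => dJ_Phi_beta vA)).
have D3 := dJ_Phi (vf_lie hM oU vA' vB') Uq.
rewrite -> ddJE; revert H1 H2 S1 S2 S3 S4 L1 L2 L3 D1 D2 D3; atoms_lra.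
Qed.

(** The remainder of X after lifting its projection is killed by rho, hence vertical. The
    coefficient 1 gives the shape expected by [ddJ_vecZD]. *)
Lemma split_hv X : vfield U X -> exists A W,
  [/\ pvfield U A, pvfield U W & forall q, U q -> X q = 1 *: beta A q + gam W q].
Proof.
move=> vX; have vA := pvfield_rho hM oU vX.
have vT := vf_sub hM oU vX (vbeta vA).
have [p Up|W vW TW] := split_vert vT.
  transitivity (rho X p - rho (beta (rho X)) p) => //.
  rewrite -> (rbeta vA Up); exact: subrr.
exists (rho X), W; split => // q Uq.
by rewrite -> (esym (TW q Uq)); rewrite scale1r addrC subrK.
Qed.

Lemma ddJ_Phi X Y q : vfield U X -> vfield U Y -> U q -> ddJ Phi X Y q = 0.
Proof.
move=> vX vY Uq.
have [A [W [vA vW XE]]] := split_hv vX; have [B [Z [vB vZ YE]]] := split_hv vY.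
have s1 := smooth_cst hT (1 : R) oU.
have D1 : ddJ Phi X Y q = 1 * ddJ Phi (beta A) Y q + ddJ Phi (gam W) Y q.
  rewrite <- (ddJ_vecZD hM oU Uq sPhi s1 (vbeta vA) (vgam vW) vY).
  exact (ddJ_eq hM oU Uq Phi XE (fun p _ => erefl)).
have D2 T : vfield U T ->
    ddJ Phi Y T q = 1 * ddJ Phi (beta B) T q + ddJ Phi (gam Z) T q.
  move=> vT; rewrite <- (ddJ_vecZD hM oU Uq sPhi s1 (vbeta vB) (vgam vZ) vT).
  exact (ddJ_eq hM oU Uq Phi YE (fun p _ => erefl)).
have D3 := D2 _ (vbeta vA); have D4 := D2 _ (vgam vW).
have C1 := ddJC hM Uq (beta A) Y sPhi; have C2 := ddJC hM Uq (gam W) Y sPhi.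
have C3 := ddJC hM Uq (beta B) (gam W) sPhi.
have H1 := ddJ_Phi_hh vB vA Uq; have H2 := ddJ_Phi_vh vZ vA Uq.
have H3 := ddJ_Phi_vh vW vB Uq; have H4 := ddJ_Phi_vv vZ vW Uq.
revert D1 D3 D4 C1 C2 C3 H1 H2 H3 H4; atoms_lra.
Qed.

Lemma der_beta_energy A q : pvfield U A -> U q -> der (beta A) E q = 0.
Proof.
move=> vA Uq.
rewrite <- (der_hproj_energy hM oU sF homF vG JG EL Uq (vbeta vA)).
exact (der_vec E (esym (hbeta vA Uq))).
Qed.

(* The formula defining nabla_(beta eta) phi = - eta, paired with eta; the
   bracket term is computed by dd_J E (G, beta phi) = - dE (beta phi) = 0. *)
Lemma der_spray_Phi q : U q -> der G Phi q = - F q ^+ 2.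
Proof.
move=> Uq; have H := cartan_horizontal veta veta Uq.
rewrite -> (pair2_Nl veta veta Uq) in H.
have bE := vbeta veta; have bP := vbeta vphi.
have gEE p : U p -> pair2 g eta eta p = 2 * E p.
  move=> Up; transitivity (pair2 g eta (rho G) p).
    by rewrite /pair2; rewrite -> (rho_spray JG Up); reflexivity.
  rewrite -> (pair2_eta vG Up).
  exact (dJ_energy_spray hM oU sF homF JG Up).
have D1 : der (beta phi) (pair2 g eta eta) q = 2 * der (beta phi) E q.
  rewrite <- (derRcM hM oU Uq (beta phi) 2 sE).
  exact (derR_eq hM oU Uq (erefl (beta phi q)) gEE).
have D2 := der_beta_energy vphi Uq.
have S3 : der (beta eta) (pair2 g eta phi) q = der (beta eta) Phi q.
  exact (derR_eq hM oU Uq (erefl (beta eta q)) (fun p => pair2C veta vphi)).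
have L1 := pair2_lieC veta bP bE Uq.
have L2 : pair2 g phi (rho (lie (beta eta) (beta eta))) q = 0.
  by have := pair2_lieC vphi bE bE Uq; atoms_lra.
have L3 := pair2_eta (vf_lie hM oU bE bP) Uq.
have D3 := EL bP Uq.
have D4 : ddJ E G (beta phi) q = ddJ E (beta eta) (beta phi) q.
  exact (ddJ_eq hM oU Uq E (fun p Up => esym (beta_eta Up)) (fun p _ => erefl)).
rewrite -> (ddJE q E (beta eta)) in D4.
have D5 : der (beta eta) (dJ E (beta phi)) q = der (beta eta) Phi q.
  apply: (derR_eq hM oU Uq (erefl (beta eta q))) => p Up.
  rewrite -> (pair2C vphi veta Up).
  rewrite <- (pair2_eta bP Up); rewrite /pair2; rewrite -> (rbeta vphi Up).
  reflexivity.
have D6 : der (beta phi) (dJ E (beta eta)) q = 2 * der (beta phi) E q.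
  rewrite <- (derRcM hM oU Uq (beta phi) 2 sE).
  apply: (derR_eq hM oU Uq (erefl (beta phi q))) => p Up.
  rewrite <- (dJ_energy_spray hM oU sF homF JG Up).
  by apply: dJ_vec; rewrite -> (beta_eta Up); reflexivity.
have D7 : der (beta eta) Phi q = der G Phi q := der_vec Phi (beta_eta Uq).
have D8 := gEE q Uq.
have D9 : 2 * E q = F q ^+ 2 by rewrite /energy mulrA divff ?mul1r// pnatr_eq0.
revert H D1 D2 S3 L1 L2 L3 D3 D4 D5 D6 D7 D8 D9.
generalize (E q) (F q ^+ 2); atoms_lra.
Qed.

End Concurrent.

(** * The spray of the Matsumoto metric *)

Section MatsumotoSpray.
Context {R : realType} {n : nat}.
Variables (M : charted 'rV[R]_n) (hM : atlas M).
Local Notation TM := (tangent M).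
Local Notation V1 := 'rV[R]_n.
Local Notation V2 := ('rV[R]_n * 'rV[R]_n)%type.
Local Notation hT := (atlas_tangent hM).
Variables (U : set TM) (oU : opn U).
Implicit Types (z q : TM) (X Y Z : TM -> V2).
Variables (F Phi p2 : TM -> R) (G : TM -> V2) (phi : TM -> V1).
Local Notation E := (energy F).
Hypotheses (sF : smooth U F) (sPhi : smooth U Phi) (sp2 : smooth U p2).
Hypotheses (vG : vfield U G) (vphi : pvfield U phi).
Let C : TM -> V2 := liouville.
Let K : TM -> V2 := gam phi.
Let Delta : TM -> R := fun q => F q * (1 + 2 * p2 q) - 3 * Phi q.
Let f1 : TM -> R := fun q => F q * (4 * Phi q - F q) / Delta q.
Let f2 : TM -> R := fun q => 2 * F q ^+ 3 / Delta q.
Hypothesis F0 : forall q, U q -> F q != 0.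
Hypothesis m0 : forall q, U q -> F q - Phi q != 0.
Hypothesis Delta0 : forall q, U q -> Delta q != 0.
Hypothesis rhoG : forall q, U q -> rho G q = q.2.
Hypothesis GF : forall q, U q -> der G F q = 0.
Hypothesis GPhi : forall q, U q -> der G Phi q = - F q ^+ 2.
Hypothesis CF : forall q, U q -> der C F q = F q.
Hypothesis CPhi : forall q, U q -> der C Phi q = Phi q.
Hypothesis KF : forall q, U q -> F q * der K F q = Phi q.
Hypothesis KPhi : forall q, U q -> der K Phi q = p2 q.
Hypothesis ddPhi : forall X Y q, vfield U X -> vfield U Y -> U q ->
  ddJ Phi X Y q = 0.
Hypothesis EG : forall Y q, vfield U Y -> U q -> ddJ E G Y q = - der Y E q.
Hypothesis EC : forall Y q, vfield U Y -> U q -> ddJ E C Y q = dJ E Y q.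
Hypothesis EK : forall Y q, vfield U Y -> U q -> ddJ E K Y q = dJ Phi Y q.

Let vC : vfield U C. Proof. exact: (vf_liouville hM oU). Qed.
Let vK : vfield U K. Proof. by refine ((pvfieldP hM phi oU).1 vphi). Qed.
Let s_cst (k : R) : smooth U (fun=> k). Proof. exact: (smooth_cst hT k oU). Qed.

Lemma smooth_Delta : smooth U Delta.
Proof.
refine (smR_sub hM oU (smoothM hT oU sF (smoothD hT oU (s_cst 1)
  (smoothM hT oU (s_cst 2) sp2))) (smoothM hT oU (s_cst 3) sPhi)).
Qed.

Lemma smooth_f1 : smooth U f1.
Proof.
refine (smoothM hT oU (smoothM hT oU sF (smR_sub hM oU
  (smoothM hT oU (s_cst 4) sPhi) sF)) (smoothV hT oU Delta0 smooth_Delta)).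
Qed.

Lemma smooth_f2 : smooth U f2.
Proof.
have s3 : smooth U (fun q => F q ^+ 3).
  refine (smoothM hT oU sF (smoothM hT oU sF sF)).
refine (smoothM hT oU (smoothM hT oU (s_cst 2) s3)
  (smoothV hT oU Delta0 smooth_Delta)).
Qed.

(** The candidate for the new spray, with its summands nested so that [ddJ_vecZD] applies twice. *)
Definition spray_change : TM -> V2 :=
  fun q => f2 q *: K q + (- f1 q *: C q + G q).

Local Notation G' := spray_change.

Let vCG : vfield U (fun q => - f1 q *: C q + G q).
Proof.
refine (vf_add hM oU (vf_scale hM oU (smR_opp hM oU smooth_f1) vC) vG).
Qed.

Lemma vf_spray_change : vfield U G'.
Proof. refine (vf_add hM oU (vf_scale hM oU smooth_f2 vK) vCG). Qed.

Let im : TM -> R := fun q => (F q - Phi q)^-1.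
Let Fhat : TM -> R := fun q => F q ^+ 2 / (F q - Phi q).
Let cube (f : TM -> R) : TM -> R := fun q => f q * f q * f q.
(** With [b], the partial derivatives of F^4 / (2 (F - Phi)^2) in F and Phi, kept as products so
    that the product rule differentiates them again. *)
Let a : TM -> R := fun q => cube F q * (F q - 2 * Phi q) * cube im q.
Let b : TM -> R := fun q => cube F q * F q * cube im q.

Let sim : smooth U im.
Proof. refine (smoothV hT oU m0 (smR_sub hM oU sF sPhi)). Qed.
Let s_cube f : smooth U f -> smooth U (cube f).
Proof. move=> sf; refine (smoothM hT oU (smoothM hT oU sf sf) sf). Qed.
Let sFhat : smooth U Fhat.
Proof. refine (smoothM hT oU (smoothM hT oU sF sF) sim). Qed.
Let s2 : smooth U (fun q => F q - 2 * Phi q).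
Proof. refine (smR_sub hM oU sF (smoothM hT oU (s_cst 2) sPhi)). Qed.
Let sa : smooth U a.
Proof. refine (smoothM hT oU (smoothM hT oU (s_cube sF) s2) (s_cube sim)). Qed.
Let sb : smooth U b.
Proof. refine (smoothM hT oU (smoothM hT oU (s_cube sF) sF) (s_cube sim)). Qed.

Let der_cube X f q : U q -> smooth U f ->
  der X (cube f) q = 3 * f q * f q * der X f q.
Proof.
move=> Uq sf; pose f2' : TM -> R := fun p => f p * f p.
have s2' : smooth U f2' := smoothM hT oU sf sf.
have D1 : der X (cube f) q = der X f2' q * f q + f2' q * der X f q :=
  derRM hM Uq X s2' sf.
have D2 : der X f2' q = der X f q * f q + f q * der X f q := derRM hM Uq X sf sf.
rewrite -> D1, D2; rewrite /f2'; generalize (der X f q) (f q); clear_eqs.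
move=> x y; ring.
Qed.

Let der_im X q : U q ->
  der X im q = - ((der X F q - der X Phi q) / (F q - Phi q) ^+ 2).
Proof.
move=> Uq; have D1 : der X im q = _ := derRV hM Uq X (smR_sub hM oU sF sPhi) (m0 Uq).
have D2 := derRB hM oU Uq X sF sPhi.
exact (etrans D1 (congr1 (fun u => - (u / (F q - Phi q) ^+ 2)) D2)).
Qed.

Let der_a X q : U q -> der X a q =
  (F q ^+ 4 - 4 * F q ^+ 3 * Phi q + 6 * F q ^+ 2 * Phi q ^+ 2) /
    (F q - Phi q) ^+ 4 * der X F q +
  (F q ^+ 4 - 4 * F q ^+ 3 * Phi q) / (F q - Phi q) ^+ 4 * der X Phi q.
Proof.
move=> Uq.
pose l : TM -> R := fun p => F p - 2 * Phi p.
pose c : TM -> R := fun p => cube F p * l p.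
have sc : smooth U c := smoothM hT oU (s_cube sF) s2.
have D1 : der X a q = der X c q * cube im q + c q * der X (cube im) q :=
  derRM hM Uq X sc (s_cube sim).
have D2 : der X c q = der X (cube F) q * l q + cube F q * der X l q :=
  derRM hM Uq X (s_cube sF) s2.
have D4 := derRcM hM oU Uq X 2 sPhi.
have D3 : der X l q = der X F q - 2 * der X Phi q := etrans
  (derRB hM oU Uq X sF (smoothM hT oU (s_cst 2) sPhi))
  (congr1 (fun u => der X F q - u) D4).
have D5 := der_cube X Uq sF; have D6 := der_cube X Uq sim; have D7 := der_im X Uq.
rewrite -> D1, D2, D3, D5, D6, D7.
rewrite /c /l /cube /im; have := m0 Uq.
generalize (der X F q) (der X Phi q) (F q) (Phi q); clear_eqs.
move=> x y u v uv0; field; exact: uv0.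
Qed.

Let der_b X q : U q -> der X b q =
  (F q ^+ 4 - 4 * F q ^+ 3 * Phi q) / (F q - Phi q) ^+ 4 * der X F q +
  3 * F q ^+ 4 / (F q - Phi q) ^+ 4 * der X Phi q.
Proof.
move=> Uq.
pose c : TM -> R := fun p => cube F p * F p.
have sc : smooth U c := smoothM hT oU (s_cube sF) sF.
have D1 : der X b q = der X c q * cube im q + c q * der X (cube im) q :=
  derRM hM Uq X sc (s_cube sim).
have D2 : der X c q = der X (cube F) q * F q + cube F q * der X F q :=
  derRM hM Uq X (s_cube sF) sF.
have D5 := der_cube X Uq sF; have D6 := der_cube X Uq sim; have D7 := der_im X Uq.
rewrite -> D1, D2, D5, D6, D7.
rewrite /c /cube /im; have := m0 Uq.
generalize (der X F q) (der X Phi q) (F q) (Phi q); clear_eqs.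
move=> x y u v uv0; field; exact: uv0.
Qed.

Let der_Ehat X q : U q ->
  der X (energy Fhat) q = a q * der X F q + b q * der X Phi q.
Proof.
move=> Uq; have D1 := der_energy hM oU sFhat X Uq.
pose c : TM -> R := fun p => F p * F p.
have sc : smooth U c := smoothM hT oU sF sF.
have D2 : der X Fhat q = der X c q * im q + c q * der X im q := derRM hM Uq X sc sim.
have D3 : der X c q = der X F q * F q + F q * der X F q := derRM hM Uq X sF sF.
have D4 := der_im X Uq.
rewrite -> D1, D2, D3, D4; rewrite /c /a /b /Fhat /cube /im; have := m0 Uq.
generalize (der X F q) (der X Phi q) (F q) (Phi q); clear_eqs.
move=> x y u v uv0; field; exact: uv0.
Qed.

Let ddJ_E X Y q : vfield U X -> vfield U Y -> U q ->
  ddJ E X Y q = der X F q * dJ F Y q - der Y F q * dJ F X q + F q * ddJ F X Y q.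
Proof.
(* [ddJ_comb] expects two summands; the second one is given the coefficient zero. *)
move=> vX vY Uq; pose o : TM -> R := fun=> 0.
have D := @ddJ_comb _ _ _ hM _ oU _ Uq F F E F o X Y sF sF sF (s_cst 0) vX vY.
have H Z p : vfield U Z -> U p -> dJ E Z p = F p * dJ F Z p + o p * dJ F Z p.
  move=> vZ Up; rewrite mul0r addr0; exact (der_energy hM oU sF (J Z) Up).
have Z1 : der X o q = 0 := derR_cst hM oU Uq X 0.
have Z2 : der Y o q = 0 := derR_cst hM oU Uq Y 0.
rewrite -> (D H), Z1, Z2; rewrite /o; generalize (F q); atoms; clear_eqs => *; ring.
Qed.

(** In dd_J E = dF /\ d_J F + F dd_J F, contraction of the first summand with G already gives - F dF
    = - dE, because G(F) = 0 and d_J F(G) = F. The fields C and K are treated in the same way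
    below. *)
Let ddJ_F_G Y q : vfield U Y -> U q -> ddJ F G Y q = 0.
Proof.
move=> vY Uq; have D1 := ddJ_E vG vY Uq; have D2 := EG vY Uq.
have D3 := der_energy hM oU sF Y Uq.
have D4 : dJ F G q = F q.
  rewrite <- (CF Uq); apply: der_vec; rewrite /J /gam; rewrite -> (rhoG Uq); reflexivity.
rewrite -> (GF Uq), D2, D3, D4 in D1; apply: (mulfI (F0 Uq)).
revert D1; generalize (F q); atoms; clear_eqs => *; lra.
Qed.

Let dJ_vert0 f W q : dJ f (gam W : TM -> V2) q = 0.
Proof. exact: dJ_vec0. Qed.

Let ddJ_F_C Y q : vfield U Y -> U q -> ddJ F C Y q = 0.
Proof.
move=> vY Uq; have D1 := ddJ_E vC vY Uq; have D2 := EC vY Uq.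
have D3 : dJ E Y q = F q * dJ F Y q := der_energy hM oU sF (J Y) Uq.
have D4 : dJ F C q = 0 := dJ_vert0 F eta q.
rewrite -> (CF Uq), D2, D3, D4 in D1; apply: (mulfI (F0 Uq)).
revert D1; generalize (F q); atoms; clear_eqs => *; lra.
Qed.

Let ddJ_F_K Y q : vfield U Y -> U q ->
  F q * ddJ F K Y q = dJ Phi Y q - der K F q * dJ F Y q.
Proof.
move=> vY Uq; have D1 := ddJ_E vK vY Uq; have D2 := EK vY Uq.
have D4 : dJ F K q = 0 := dJ_vert0 F phi q.
rewrite -> D2, D4 in D1; revert D1; generalize (F q); atoms; clear_eqs => *; lra.
Qed.

Let der_G' f q : smooth U f -> U q ->
  der G' f q = f2 q * der K f q - f1 q * der C f q + der G f q.
Proof.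
move=> sf Uq.
have D1 := @der_vecD _ _ _ hM _ _ Uq f (fun p => f2 p *: K p)
  (fun p => - f1 p *: C p + G p) G' sf erefl.
have D2 := @der_vecD _ _ _ hM _ _ Uq f (fun p => - f1 p *: C p) G
  (fun p => - f1 p *: C p + G p) sf erefl.
have D3 := @der_vecZ _ _ _ hM _ _ Uq f (f2 q) K (fun p => f2 p *: K p) sf erefl.
have D4 := @der_vecZ _ _ _ hM _ _ Uq f (- f1 q) C (fun p => - f1 p *: C p) sf erefl.
rewrite -> D1, D2, D3, D4; atoms; clear_eqs => *; ring.
Qed.

Let dJ_G' f q : dJ f G' q = dJ f G q.
Proof.
apply: dJ_vec.
transitivity (f2 q *: (0 : V1) + (- f1 q *: (0 : V1) + (G q).1)) => //.
by rewrite !scaler0 !add0r.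
Qed.

Let ddJ_G' f Y q : smooth U f -> vfield U Y -> U q ->
  ddJ f G' Y q = f2 q * ddJ f K Y q + (- f1 q * ddJ f C Y q + ddJ f G Y q).
Proof.
move=> sf vY Uq.
have D1 := ddJ_vecZD hM oU Uq sf smooth_f2 vK vCG vY.
have D2 := ddJ_vecZD hM oU Uq sf (smR_opp hM oU smooth_f1) vC vG vY.
exact (etrans D1 (congr1 (fun u => f2 q * ddJ f K Y q + u) D2)).
Qed.

(* Write L = energy Fhat as a function of F and Phi.  Then
   d_J L = a d_J F + b d_J Phi with a = dL/dF and b = dL/dPhi, and the claim
   reduces to a rational identity. *)
Lemma spray_change_EL Y q : vfield U Y -> U q ->
  ddJ (energy Fhat) G' Y q = - der Y (energy Fhat) q.
Proof.
move=> vY Uq.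
have D := ddJ_comb hM oU Uq sF sPhi sa sb vf_spray_change vY
  (fun Z p _ Up => der_Ehat (J Z) Up).
rewrite -> D, (der_Ehat Y Uq).
rewrite -> (ddJ_G' sF vY Uq), (ddPhi vf_spray_change vY Uq).
rewrite -> (ddJ_F_C vY Uq), (ddJ_F_G vY Uq).
rewrite -> (der_a G' Uq), (der_b G' Uq), (der_a Y Uq), (der_b Y Uq).
rewrite -> (der_G' sF Uq), (der_G' sPhi Uq).
rewrite -> (GF Uq), (GPhi Uq), (CF Uq), (CPhi Uq), (KPhi Uq).
rewrite -> (dJ_G' F q), (dJ_G' Phi q).
have JGC : J G q = C q by rewrite /J /gam; rewrite -> (rhoG Uq); reflexivity.
have -> : dJ F G q = F q by rewrite <- (CF Uq); exact (der_vec F JGC).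
have -> : dJ Phi G q = Phi q by rewrite <- (CPhi Uq); exact (der_vec Phi JGC).
have k1 := KF Uq; have k2 := ddJ_F_K vY Uq.
have E1 : der K F q = Phi q / F q by rewrite -k1 mulrAC divff ?mul1r//; exact: F0.
rewrite -> E1 in k2.
have E2 : ddJ F K Y q = (dJ Phi Y q - Phi q / F q * dJ F Y q) / F q.
  by rewrite -k2 mulrAC divff ?mul1r//; exact: F0.
rewrite -> E1, E2; rewrite /f1 /f2 /a /b /cube /im.
have := F0 Uq; have := m0 Uq; have := Delta0 Uq; rewrite /Delta.
clear D k1 k2 E1 E2 JGC.
generalize (dJ Phi Y q) (dJ F Y q) (der Y F q) (der Y Phi q) (F q) (Phi q) (p2 q).
(* The identity is linear in v, u, s, t, the values on Y of d_J Phi, d_J F, dF and dPhi, with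
   coefficients rational in F, Phi and p2. *)
move=> v u s t x y p h3 h2 h1; field.
by rewrite h1 h2 h3.
Qed.

End MatsumotoSpray.

(** * Effect of the change of spray on the Barthel connection *)

Section BarthelChange.
Context {R : realType} {n : nat}.
Variables (M : charted 'rV[R]_n) (hM : atlas M).
Local Notation TM := (tangent M).
Local Notation V1 := 'rV[R]_n.
Local Notation V2 := ('rV[R]_n * 'rV[R]_n)%type.
Local Notation hT := (atlas_tangent hM).
Variables (U : set TM) (oU : opn U).
Implicit Types (z q : TM) (X Y T : TM -> V2).

Lemma barthel_addG T T' X q : U q -> vfield U T -> vfield U T' -> vfield U X ->
  barthel (fun p => T p + T' p) X q = barthel T X q + barthel T' X q.
Proof.
move=> Uq vT vT' vX; have vJX := vfield_J hM oU vX.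
have E1 := lieD_r hM oU Uq vJX vT vT'.
have E2 := lieD_r hM oU Uq vX vT vT'.
have key (u v u' v' : V2) : u + v - vert (u' + v') = (u - vert u') + (v - vert v').
  by rewrite linearD opprD addrACA.
exact: (etrans (congr2 (fun u v => u - vert v) E1 E2) (key _ _ _ _)).
Qed.

(** In [J, f T] = f [J, T] + d_J f (x) T - df (x) JT the last term vanishes because T is vertical at
    q. *)
Lemma barthel_scaleG (f : TM -> R) T X q : U q -> smooth U f -> vfield U T ->
  vfield U X -> (T q).1 = 0 ->
  barthel (fun p => f p *: T p) X q = dJ f X q *: T q + f q *: barthel T X q.
Proof.
move=> Uq sf vT vX T0; have vJX := vfield_J hM oU vX.
have E1 := lieZ_r hM oU Uq vJX vT sf.
have E2 := lieZ_r hM oU Uq vX vT sf.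
have key (k k' l : R) (t u v : V2) : t.1 = 0 ->
    k *: t + l *: u - vert (k' *: t + l *: v) = k *: t + l *: (u - vert v).
  move=> t0; have vt : vert t = 0 by rewrite /vert /= t0.
  by rewrite linearD !linearZ_LR vt scaler0 add0r scalerBr addrA.
exact: (etrans (congr2 (fun u v => u - vert v) E1 E2) (key _ _ _ _ _ _ T0)).
Qed.

Variables (G : TM -> V2) (phi : TM -> V1) (B : TM -> V2).
Hypothesis vG : vfield U G.
Hypothesis JG : forall q, U q -> J G q = liouville q.
Hypothesis vphi : pvfield U phi.
Hypothesis vB : vfield U B.
Hypothesis rB : forall q, U q -> rho B q = phi q.
Hypothesis vertical_phi : forall W q, pvfield U W -> U q ->
  rho (lie (gam W) B) q = 0.

Lemma barthel_liouville X q : U q -> vfield U X -> barthel liouville X q = J X q.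
Proof.
move=> Uq vX; have E := lie_J_liouville hM oU vG JG Uq vX.
have key (u v w : V2) : u = v + w -> u - w = v by move=> ->; rewrite addrK.
exact: (key _ _ _ E).
Qed.

(** With gam phi = JB, the identity N_J = 0 reduces [J, gam phi] X to J [JX, B], which the Berwald
    condition makes zero. *)
Lemma barthel_gam_phi X q : U q -> vfield U X -> barthel (gam phi) X q = 0.
Proof.
move=> Uq vX; have JB p : U p -> gam phi p = J B p.
  by move=> Up; rewrite /J /gam; rewrite -> (rB Up); reflexivity.
have E1 : lie (J X) (gam phi) q = lie (J X) (J B) q.
  exact (lie_eq hM oU Uq (fun p _ => erefl) JB).
have E2 : lie X (gam phi) q = lie X (J B) q.
  exact (lie_eq hM oU Uq (fun p _ => erefl) JB).
have E3 := lie_J_J hM oU Uq vX vB.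
have E4 : (lie (J X) B q).1 = 0 := vertical_phi (pvfield_rho hM oU vX) Uq.
have key (u v : V2) : u.1 = 0 -> vert (u + v) - vert v = 0.
  by move=> u0; rewrite linearD addrK /vert /= u0.
exact (etrans (congr2 (fun u v => u - vert v) (etrans E1 E3) E2) (key _ _ E4)).
Qed.

Lemma barthel_spray_change (f1 f2 : TM -> R) X q : smooth U f1 -> smooth U f2 ->
  vfield U X -> U q ->
  barthel (fun p => f2 p *: gam phi p + (- f1 p *: liouville p + G p)) X q =
  barthel G X q -
    (f1 q *: J X q + dJ f1 X q *: gam eta q - dJ f2 X q *: gam phi q).
Proof.
move=> s1 s2 vX Uq; have sN := smR_opp hM oU s1.
have vC := vf_liouville hM oU.
have vK : vfield U (gam phi) by refine ((pvfieldP hM phi oU).1 vphi).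
have vfC := vf_scale hM oU sN vC; have vfK := vf_scale hM oU s2 vK.
have D1 := barthel_addG Uq vfK (vf_add hM oU vfC vG) vX.
have D2 := barthel_addG Uq vfC vG vX.
have D3 := barthel_scaleG Uq s2 vK vX erefl.
have D4 := barthel_scaleG Uq sN vC vX erefl.
have D5 := barthel_gam_phi Uq vX; have D6 := barthel_liouville Uq vX.
have D7 : dJ (fun p => - f1 p) X q = - dJ f1 X q := derRN hM oU Uq (J X) s1.
have key (a a' b b' c : R) (k e j x kb cb : V2) : kb = 0 -> cb = j -> c = - a' ->
    b' *: k + b *: kb + ((c *: e + - a *: cb) + x) =
    x - (a *: j + a' *: e - b' *: k).
  move=> -> -> ->; rewrite scaler0 addr0 addrC -addrA addrC -addrA; congr (_ + _).
  by rewrite !scaleNr !opprD opprK addrC (addrC (- (a' *: e))).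
exact (etrans D1 (etrans (congr2 (fun u v => u + v) D3
  (etrans D2 (congr1 (fun u => u + barthel G X q) D4))) (key _ _ _ _ _ _ _ _ _ _ _ D5 D6 D7))).
Qed.

End BarthelChange.

(** * Polarization of the Froelicher-Nijenhuis bracket *)

Section FNBracket.
Context {R : realType} {n : nat}.
Variables (M : charted 'rV[R]_n) (hM : atlas M).
Local Notation TM := (tangent M).
Local Notation V2 := ('rV[R]_n * 'rV[R]_n)%type.
Local Notation e2 := (prod_frame (@rV_frame R n) (@rV_frame R n)).
Variables (U : set TM) (oU : opn U).
Implicit Types (z q : TM) (X Y L : TM -> V2).

Lemma frame_inj (u v : V2) : (forall i, fcoord e2 i u = fcoord e2 i v) -> u = v.
Proof.
by move=> uv; rewrite (frameE e2 u) (frameE e2 v); apply: eq_bigr => i _; rewrite uv.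
Qed.

(** The properties used in expanding the bracket, relative to one open set; they are common to
    [hproj G] and to S. *)
Definition additive_form (K : vform TM) : Prop :=
  [/\ forall X, vfield U X -> vfield U (K X),
      forall X Y q, U q -> (forall p, U p -> X p = Y p) -> K X q = K Y q
    & forall X Y q, U q -> vfield U X -> vfield U Y ->
        K (fun p => X p + Y p) q = K X q + K Y q].

(** K is compared with H + S only on vector fields over U. Every nested bracket is therefore first
    shown to be such a field and rewritten on all of U, and biadditivity is used afterwards. *)
Lemma fn_bracketDD (H S K : vform TM) X Y q : additive_form H -> additive_form S ->
  (forall X p, vfield U X -> U p -> K X p = H X p + S X p) ->
  vfield U X -> vfield U Y -> U q ->
  fn_bracket K K X Y q = fn_bracket H H X Y q + 2 *: fn_bracket H S X Y q
    + fn_bracket S S X Y q.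
Proof.
move=> [vH eH dH] [vS eS dS] KE vX vY Uq.
have vHX := vH _ vX; have vSX := vS _ vX; have vHY := vH _ vY; have vSY := vS _ vY.
have vL := vf_lie hM oU vX vY.
have vK A : vfield U A -> vfield U (K A).
  move=> vA; have vD := vf_add hM oU (vH _ vA) (vS _ vA).
  exact (vfield_eq (atlas_tangent hM) oU (fun p Up => esym (KE A p vA Up)) vD).
have KD A B D : vfield U A -> vfield U B -> vfield U D ->
    (forall p, U p -> D p = A p + B p) ->
    K D q = (H A q + H B q) + (S A q + S B q).
  move=> vA vB vD DE.
  have F1 := etrans (eH _ _ q Uq DE) (dH A B q Uq vA vB).
  have F2 := etrans (eS _ _ q Uq DE) (dS A B q Uq vA vB).
  exact (etrans (KE D q vD Uq) (congr2 (fun u v => u + v) F1 F2)).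
have liel A B p : vfield U A -> vfield U B -> U p ->
    lie (K A) B p = lie (H A) B p + lie (S A) B p.
  move=> vA vB Up.
  exact (etrans (lie_eq hM oU Up (fun r => KE A r vA) (fun r _ => erefl))
    (lieD_l hM oU Up (vH _ vA) (vS _ vA) vB)).
have lier A B p : vfield U A -> vfield U B -> U p ->
    lie A (K B) p = lie A (H B) p + lie A (S B) p.
  move=> vA vB Up.
  exact (etrans (lie_eq hM oU Up (fun r _ => erefl) (fun r => KE B r vB))
    (lieD_r hM oU Up vA (vH _ vB) (vS _ vB))).
have E1 : lie (K X) (K Y) q = (lie (H X) (H Y) q + lie (S X) (H Y) q)
    + (lie (H X) (S Y) q + lie (S X) (S Y) q).
  refine (etrans (lier _ _ q (vK _ vX) vY Uq) _).
  exact (congr2 (fun u v => u + v) (liel _ _ q vX vHY Uq) (liel _ _ q vX vSY Uq)).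
have E2 := KD _ _ _ (vH _ vL) (vS _ vL) (vK _ vL) (fun p => KE _ p vL).
have E3 := KD _ _ _ (vf_lie hM oU vHX vY) (vf_lie hM oU vSX vY)
  (vf_lie hM oU (vK _ vX) vY) (fun p => liel X Y p vX vY).
have E4 := KD _ _ _ (vf_lie hM oU vX vHY) (vf_lie hM oU vX vSY)
  (vf_lie hM oU vX (vK _ vY)) (fun p => lier X Y p vX vY).
have B A D : fn_bracket A D X Y q =
  lie (A X) (D Y) q + lie (D X) (A Y) q + A (D (lie X Y)) q + D (A (lie X Y)) q
  - A (lie (D X) Y) q - A (lie X (D Y)) q - D (lie (A X) Y) q - D (lie X (A Y)) q.
  by [].
rewrite -> (B K K), (B H H), (B H S), (B S S), E1, E2, E3, E4.
(* The linear identity is decided for real numbers and carried to vectors coordinate by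
   coordinate. *)
have keyR (l1 l2 l3 l4 k1 k2 k3 k4 c1 c2 c3 c4 d1 d2 d3 d4 : R) :
    (l1 + l2 + (l3 + l4)) + (l1 + l2 + (l3 + l4)) + (k1 + k2 + (k3 + k4))
      + (k1 + k2 + (k3 + k4)) - (c1 + c2 + (c3 + c4)) - (d1 + d2 + (d3 + d4))
      - (c1 + c2 + (c3 + c4)) - (d1 + d2 + (d3 + d4))
    = (l1 + l1 + k1 + k1 - c1 - d1 - c1 - d1)
      + ((l3 + l2 + k2 + k3 - c2 - d2 - c3 - d3)
         + (l3 + l2 + k2 + k3 - c2 - d2 - c3 - d3))
      + (l4 + l4 + k4 + k4 - c4 - d4 - c4 - d4) by lra.
have keyV (l1 l2 l3 l4 k1 k2 k3 k4 c1 c2 c3 c4 d1 d2 d3 d4 : V2) :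
    (l1 + l2 + (l3 + l4)) + (l1 + l2 + (l3 + l4)) + (k1 + k2 + (k3 + k4))
      + (k1 + k2 + (k3 + k4)) - (c1 + c2 + (c3 + c4)) - (d1 + d2 + (d3 + d4))
      - (c1 + c2 + (c3 + c4)) - (d1 + d2 + (d3 + d4))
    = (l1 + l1 + k1 + k1 - c1 - d1 - c1 - d1)
      + 2 *: (l3 + l2 + k2 + k3 - c2 - d2 - c3 - d3)
      + (l4 + l4 + k4 + k4 - c4 - d4 - c4 - d4).
  rewrite scaler_nat mulr2n; apply: frame_inj => i.
  rewrite !(linearD (fcoord e2 i), linearN (fcoord e2 i)).
  exact: keyR.
exact: keyV.
Qed.

End FNBracket.

(** * The semi-basic form S *)

Section SemiBasic.
Context {R : realType} {n : nat}.
Variables (M : charted 'rV[R]_n) (hM : atlas M).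
Local Notation TM := (tangent M).
Local Notation V1 := 'rV[R]_n.
Local Notation V2 := ('rV[R]_n * 'rV[R]_n)%type.
Local Notation hT := (atlas_tangent hM).
Local Notation e2 := (prod_frame (@rV_frame R n) (@rV_frame R n)).
Variables (f1 f2 : TM -> R) (phi : TM -> V1).
Implicit Types (q : TM) (X Y : TM -> V2).

Definition change_form : vform TM := fun X z =>
  - (2^-1 *: (f1 z *: J X z + dJ f1 X z *: gam eta z - dJ f2 X z *: gam phi z)).
Local Notation S := change_form.

Section On.
Variables (U : set TM) (oU : opn U).
Hypotheses (s1 : smooth U f1) (s2 : smooth U f2) (vphi : pvfield U phi).

Lemma vf_change_form X : vfield U X -> vfield U (S X).
Proof.
move=> vX; have vC := vf_liouville hM oU.
have vK : vfield U (gam phi) by refine ((pvfieldP hM phi oU).1 vphi).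
refine (vf_opp hM oU (vf_scale hM oU (smooth_cst hT (2^-1 : R) oU) _)).
refine (vf_sub hM oU (vf_add hM oU (vf_scale hM oU s1 (vfield_J hM oU vX))
  (vf_scale hM oU (smooth_dJ hM oU vX s1) vC))
  (vf_scale hM oU (smooth_dJ hM oU vX s2) vK)).
Qed.

Lemma change_form_eq X Y q : X q = Y q -> S X q = S Y q.
Proof.
by move=> XY; rewrite /change_form /dJ /der /J /gam /rho; rewrite -> XY; reflexivity.
Qed.

Lemma change_form_lin (k : TM -> R) X Y q : U q ->
  S (fun p => k p *: X p + Y p) q = k q *: S X q + S Y q.
Proof.
move=> Uq; pose T : TM -> V2 := fun p => k p *: X p.
have D f : smooth U f ->
    dJ f (fun p => k p *: X p + Y p) q = k q * dJ f X q + dJ f Y q.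
  move=> sf; have D1 := @dJ_vecD _ _ _ hM _ _ Uq f T Y (fun p => T p + Y p) sf erefl.
  have D2 := @dJ_vecZ _ _ _ hM _ _ Uq f (k q) X T sf erefl.
  exact (etrans D1 (congr1 (fun u => u + dJ f Y q) D2)).
have D0 : J (fun p => k p *: X p + Y p) q = k q *: J X q + J Y q.
  exact: (linearP vert).
have key (a b b' c c' r h : R) (x y e g : V2) :
  - (h *: (a *: (r *: x + y) + (r * b + b') *: e - (r * c + c') *: g)) =
  r *: - (h *: (a *: x + b *: e - c *: g)) + - (h *: (a *: y + b' *: e - c' *: g)).
  apply: frame_inj => i; rewrite !(linearD (fcoord e2 i), linearN (fcoord e2 i),
    linearZ_LR (fcoord e2 i)).
  have keyR (x' y' e' g' : R) :
    - (h * (a * (r * x' + y') + (r * b + b') * e' - (r * c + c') * g')) =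
    r * - (h * (a * x' + b * e' - c * g')) + - (h * (a * y' + b' * e' - c' * g')).
    by ring.
  exact: keyR.
pose form (j : V2) (d d' : R) : V2 :=
  - (2^-1 *: (f1 q *: j + d *: gam eta q - d' *: gam phi q)).
exact (etrans (f_equal3 form D0 (D _ s1) (D _ s2)) (key _ _ _ _ _ _ _ _ _ _ _)).
Qed.

Lemma additive_change_form : additive_form U S.
Proof.
split=> [X vX|X Y q Uq XY|X Y q Uq _ _].
- exact: vf_change_form.
- exact: change_form_eq (XY q Uq).
- have L := change_form_lin (fun=> 1) X Y Uq.
  have E : S (fun p => X p + Y p) q = S (fun p => 1 *: X p + Y p) q.
    by apply: change_form_eq; rewrite scale1r.
  refine (etrans E (etrans L _)); by rewrite scale1r.
Qed.

End On.

Lemma semibasic_change_form (A : set TM) : smooth A f1 -> smooth A f2 ->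
  pvfield A phi -> semibasic A S.
Proof.
move=> s1 s2 vphi.
(* All three summands of S are vertical, which gives JS = 0; SJ = 0 will follow from J^2 = 0, as d_J
   f also vanishes on JX. *)
have J0 (k a b c : R) (w u v : V1) :
    (- (k *: (a *: ((0, w) : V2) + b *: ((0, u) : V2) - c *: ((0, v) : V2)))).1 = 0.
  rewrite -[LHS]/(- (k *: (a *: (0 : V1) + b *: (0 : V1) - c *: (0 : V1)))).
  by rewrite !scaler0 addr0 subr0 scaler0 oppr0.
split.
- move=> U oU UA; have s1U := smoothS UA s1; have s2U := smoothS UA s2.
  have vU := pvfieldS UA vphi.
  split=> [X vX|X Y _ _ XY q qU|f X Y _ _ _ q /set_mem Uq].
  + exact (vf_change_form oU s1U s2U vU vX).
  + exact (change_form_eq (XY q qU)).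
  + exact (change_form_lin s1U s2U f X Y Uq).
- move=> U X oU UA vX q qU.
  exact: (congr1 (fun u : V1 => (0, u) : V2) (J0 _ _ _ _ _ _ _)).
- move=> U X oU UA vX q qU; rewrite /= /change_form.
  have D f : dJ f (J X) q = 0 by exact: dJ_vec0.
  have J1 : J (J X) q = 0 by [].
  pose form (j : V2) (d d' : R) : V2 :=
    - (2^-1 *: (f1 q *: j + d *: gam eta q - d' *: gam phi q)).
  refine (etrans (f_equal3 form J1 (D f1) (D f2)) _).
  by rewrite /form scaler0 !scale0r addr0 subr0 scaler0 oppr0.
Qed.

End SemiBasic.

(** * The given Finsler data on open subsets, and the comparison of both structures *)

Section Main.
Context {R : realType} {n : nat}.
Variables (M : charted 'rV[R]_n) (hM : atlas M).
Local Notation TM := (tangent M).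
Local Notation V1 := 'rV[R]_n.
Local Notation V2 := ('rV[R]_n * 'rV[R]_n)%type.
Local Notation hT := (atlas_tangent hM).
Variables (F : TM -> R) (G : TM -> V2) (g : TM -> V1 -> V1 -> R).
Variables (beta : (TM -> V1) -> TM -> V2).
Variables (Do nabla : (TM -> V2) -> (TM -> V1) -> TM -> V1) (phi : TM -> V1).
Hypotheses (hF : finsler F) (hG : geodesic_spray slit F G).
Hypotheses (hg : metric_tensor slit F g) (hbeta : horizontal_map slit G beta).
Hypotheses (hDo : berwald slit G beta Do) (hnabla : cartan slit g beta nabla).
Hypothesis hphi : concurrent beta nabla Do phi.

Section Local.
Variables (U : set TM) (oU : opn U) (Us : U `<=` slit).

Lemma loc_sF : smooth U F.
Proof. by case: hF => _ sF _ _ _; exact: smoothS sF. Qed.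

Lemma loc_homF z (l : R) : 0 < l -> F (z.1, l *: z.2) = l * F z.
Proof. by case: hF => _ _ _ h _ l0; exact: h. Qed.

Lemma loc_vG : vfield U G.
Proof. by case: hG => vG _ _ _; exact: vfieldS vG. Qed.

Lemma loc_JG q : U q -> J G q = liouville q.
Proof. by case: hG => _ h _ _ /Us Uq; exact (h q (mem_set Uq)). Qed.

Lemma loc_CG q : U q -> lie liouville G q = G q.
Proof. by case: hG => _ _ h _ /Us Uq; exact (h q (mem_set Uq)). Qed.

Lemma loc_EL X q : vfield U X -> U q -> ddJ (energy F) G X q = - der X (energy F) q.
Proof. by case: hG => _ _ _ h vX Uq; exact (h U X oU Us vX q (mem_set Uq)). Qed.

Lemma loc_hg X Y q : vfield U X -> vfield U Y -> U q ->
  pair2 g (rho X) (rho Y) q = ddJ (energy F) (J X) Y q.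
Proof. by move=> vX vY Uq; exact (hg oU Us vX vY (mem_set Uq)). Qed.

Lemma loc_vbeta W : pvfield U W -> vfield U (beta W).
Proof. by move=> vW; case: (hbeta oU Us vW). Qed.

Lemma loc_rbeta W q : pvfield U W -> U q -> rho (beta W) q = W q.
Proof. by move=> vW Uq; case: (hbeta oU Us vW) => _ h _; exact (h q (mem_set Uq)). Qed.

Lemma loc_hbeta W q : pvfield U W -> U q -> hproj G (beta W) q = beta W q.
Proof. by move=> vW Uq; case: (hbeta oU Us vW) => _ _ h; exact (h q (mem_set Uq)). Qed.

Lemma loc_vphi : pvfield U phi.
Proof. by case: hphi => v _ _; exact: pvfieldS v. Qed.

Lemma loc_vertical_phi W q : pvfield U W -> U q ->
  rho (lie (gam W) (beta phi)) q = 0.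
Proof.
move=> vW Uq; have qU := mem_set Uq; case: hDo => _ _ h; case: hphi => _ _ h'.
have E1 := h U W phi oU Us vW loc_vphi q qU.
case: (h' U W oU Us vW) => _ _ _ E2.
exact (etrans (esym E1) (E2 q qU)).
Qed.

Lemma loc_cartan_vertical W A q : pvfield U W -> pvfield U A -> U q ->
  2 * g q 0 (A q) = der (gam W) (pair2 g phi A) q
    + pair2 g phi (rho (lie (beta A) (gam W))) q
    + pair2 g A (rho (lie (gam W) (beta phi))) q.
Proof.
move=> vW vA Uq; have qU := mem_set Uq; case: hnabla => _ h _; case: hphi => _ _ h'.
have E1 := h U W phi A oU Us vW loc_vphi vA q qU.
case: (h' U W oU Us vW) => _ _ E2 _.
exact (etrans (congr1 (fun u => 2 * g q u (A q)) (esym (E2 q qU))) E1).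
Qed.

Lemma loc_cartan_horizontal A B q : pvfield U A -> pvfield U B -> U q ->
  2 * g q (- A q) (B q) = der (beta A) (pair2 g phi B) q
    + der (beta phi) (pair2 g B A) q
    - der (beta B) (pair2 g A phi) q
    - pair2 g A (rho (lie (beta phi) (beta B))) q
    + pair2 g phi (rho (lie (beta B) (beta A))) q
    + pair2 g B (rho (lie (beta A) (beta phi))) q.
Proof.
move=> vA vB Uq; have qU := mem_set Uq; case: hnabla => _ _ h; case: hphi => _ _ h'.
have E1 := h U A phi B oU Us vA loc_vphi vB q qU.
case: (h' U A oU Us vA) => E2 _ _ _.
exact (etrans (congr1 (fun u => 2 * g q u (B q)) (esym (E2 q qU))) E1).
Qed.

(** Where F vanishes, so does the contraction of dd_J E with C, which is d_J E = F d_J F; maximal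
    rank would then make C zero, contrary to y being nonzero on the slit bundle. *)
Lemma finsler_neq0 q : U q -> F q != 0.
Proof.
move=> Uq; apply/eqP => F0; case: hF => _ _ _ _ mr.
have vC := vf_liouville hM oU.
have C0 : (liouville : TM -> V2) q = 0.
  refine (mr U q liouville oU Us Uq vC _) => Y vY.
  rewrite -> (ddJ_energy_liouville hM oU loc_sF loc_homF loc_vG loc_JG Uq vY).
  refine (etrans (der_energy hM oU loc_sF (J Y) Uq) _).
  by rewrite F0 mul0r.
by have /eqP := Us Uq; apply; exact (congr1 snd C0).
Qed.

Local Notation Phi := (pair2 g phi eta).
Local Notation p2 := (pair2 g phi phi).

Lemma loc_sPhi : smooth U Phi.
Proof.
refine (smooth_pair2 hM oU loc_sF loc_hg loc_vbeta loc_rbeta loc_vphi _).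
exact (pvfield_eta hM oU).
Qed.

Lemma loc_sp2 : smooth U p2.
Proof.
exact (smooth_pair2 hM oU loc_sF loc_hg loc_vbeta loc_rbeta loc_vphi loc_vphi).
Qed.

Lemma loc_dJ_Phi X q : vfield U X -> U q -> dJ Phi X q = pair2 g phi (rho X) q.
Proof.
exact (@dJ_Phi _ _ _ hM _ oU _ _ _ _ _ loc_sF loc_vG loc_JG loc_CG loc_hg loc_vbeta
  loc_rbeta loc_hbeta loc_vphi loc_vertical_phi loc_cartan_vertical X q).
Qed.

Lemma loc_gam_phi q : U q -> gam phi q = J (beta phi) q.
Proof.
by move=> Uq; rewrite /J /gam; rewrite -> (loc_rbeta loc_vphi Uq); reflexivity.
Qed.

Hypothesis m0 : forall q, U q -> F q - Phi q != 0.
Hypothesis Delta0 : forall q, U q -> F q * (1 + 2 * p2 q) - 3 * Phi q != 0.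

(** The inputs of [spray_change_EL] are collected: G(F) = 0 follows from G(E) = 0 by dividing by F,
    F K(F) = K(E) = g(eta, phi), K(Phi) = g(phi, phi), and contraction of dd_J E with K = J (beta
    phi) is g(phi, rho .) = d_J Phi. *)
Lemma matsumoto_EL Y q : vfield U Y -> U q ->
  ddJ (energy (fun z => F z ^+ 2 / (F z - Phi z)))
      (spray_change F Phi p2 G phi) Y q =
  - der Y (energy (fun z => F z ^+ 2 / (F z - Phi z))) q.
Proof.
move=> vY Uq; have sF := loc_sF; have vG := loc_vG; have vP := loc_vphi.
have vbP := loc_vbeta vP.
have F0 p : U p -> F p != 0 := @finsler_neq0 p.
have GF p : U p -> der G F p = 0.
  move=> Up; refine (mulfI (F0 p Up) _).
  exact (etrans (esym (der_energy hM oU sF G Up))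
    (etrans (der_spray_energy vG loc_EL Up) (esym (mulr0 _)))).
have GPhi p : U p -> der G Phi p = - F p ^+ 2.
  exact (@der_spray_Phi _ _ _ hM _ oU _ _ _ _ _ sF loc_homF vG loc_JG loc_CG
    loc_EL loc_hg loc_vbeta loc_rbeta loc_hbeta vP loc_cartan_horizontal p).
have CF p : U p -> der liouville F p = F p.
  exact (@der_liouville_F _ _ _ hM _ _ sF loc_homF p).
have CPhi p : U p -> der liouville Phi p = Phi p.
  move=> Up; have E1 := loc_dJ_Phi vG Up.
  refine (etrans (der_vec Phi (esym (loc_JG Up))) (etrans E1 _)).
  exact (congr1 (g p (phi p)) (rho_spray loc_JG Up)).
have KF p : U p -> F p * der (gam phi) F p = Phi p.
  move=> Up; refine (etrans (esym (der_energy hM oU sF (gam phi) Up)) _).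
  have E1 := pair2_eta hM oU sF loc_homF vG loc_JG loc_hg vbP Up.
  have E2 := pair2C hM oU sF loc_hg loc_vbeta loc_rbeta (pvfield_eta hM oU) vP Up.
  refine (etrans (der_vec (energy F) (loc_gam_phi Up)) (etrans (esym E1) _)).
  refine (etrans _ E2).
  exact (congr1 (g p (eta p)) (loc_rbeta vP Up)).
have KPhi p : U p -> der (gam phi) Phi p = p2 p.
  move=> Up; have E1 := loc_dJ_Phi vbP Up.
  refine (etrans (der_vec Phi (loc_gam_phi Up)) (etrans E1 _)).
  exact (congr1 (g p (phi p)) (loc_rbeta vP Up)).
have ddPhi A B p : vfield U A -> vfield U B -> U p -> ddJ Phi A B p = 0.
  exact (@ddJ_Phi _ _ _ hM _ oU _ _ _ _ _ sF vG loc_JG loc_CG loc_hg loc_vbeta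
    loc_rbeta loc_hbeta vP loc_vertical_phi loc_cartan_vertical
    loc_cartan_horizontal A B p).
have EC B p : vfield U B -> U p ->
    ddJ (energy F) liouville B p = dJ (energy F) B p.
  move=> vB Up; exact (ddJ_energy_liouville hM oU sF loc_homF vG loc_JG Up vB).
have EK B p : vfield U B -> U p -> ddJ (energy F) (gam phi) B p = dJ Phi B p.
  move=> vB Up; have E1 := loc_hg vbP vB Up; have E2 := loc_dJ_Phi vB Up.
  have E3 : ddJ (energy F) (gam phi) B p = ddJ (energy F) (J (beta phi)) B p.
    exact (ddJ_eq hM oU Up _ loc_gam_phi (fun r _ => erefl)).
  refine (etrans E3 (etrans (esym E1) (etrans _ (esym E2)))).
  exact (congr1 (fun u => g p u (rho B p)) (loc_rbeta vP Up)).
exact (spray_change_EL hM oU sF loc_sPhi loc_sp2 vG vP F0 m0 Delta0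
  (rho_spray loc_JG) GF GPhi CF CPhi KF KPhi ddPhi loc_EL EC EK vY Uq).
Qed.

End Local.
End Main.

Theorem corollary3p4 (R : realType) (n : nat) (M : charted 'rV[R]_n)
    (F : tangent M -> R)
    (G : tangent M -> 'rV[R]_n * 'rV[R]_n)
    (g : tangent M -> 'rV[R]_n -> 'rV[R]_n -> R)
    (beta : (tangent M -> 'rV[R]_n) -> tangent M -> 'rV[R]_n * 'rV[R]_n)
    (Do nabla : (tangent M -> 'rV[R]_n * 'rV[R]_n) ->
       (tangent M -> 'rV[R]_n) -> tangent M -> 'rV[R]_n)
    (phi : tangent M -> 'rV[R]_n)
    (hM : manifold M)
    (hF : finsler F)
    (hG : geodesic_spray slit F G)
    (hg : metric_tensor slit F g)
    (hbeta : horizontal_map slit G beta)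
    (hDo : berwald slit G beta Do)
    (hnabla : cartan slit g beta nabla)
    (hphi : concurrent beta nabla Do phi) :
  let Phi : tangent M -> R := iform g phi eta in
  let p2 : tangent M -> R := pair2 g phi phi in
  let D : set (tangent M) := [set z | slit z /\ Phi z < F z] in
  let Fhat : tangent M -> R := fun z => F z ^+ 2 / (F z - Phi z) in
  let Delta : tangent M -> R :=
    fun z => F z * (1 + 2 * p2 z) - 3 * Phi z in
  conic_pseudo_finsler D Fhat ->
  (forall z, D z -> Delta z != 0) ->
  forall Ghat : tangent M -> 'rV[R]_n * 'rV[R]_n,
  geodesic_spray D Fhat Ghat ->
  let f1 : tangent M -> R := fun z => F z * (4 * Phi z - F z) / Delta z in
  let f2 : tangent M -> R := fun z => 2 * F z ^+ 3 / Delta z in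
  let S : vform (tangent M) := fun X z =>
    - (2^-1 *: (f1 z *: J X z + dJ f1 X z *: gam eta z
                - dJ f2 X z *: gam phi z)) in
  [/\ semibasic D S,
      eq_vform D (hproj Ghat) (fun X => hproj G X \+ S X),
      eq_vform D (vproj Ghat) (fun X => vproj G X \- S X)
    & eq_vform2 D (curvature Ghat) (fun X Y =>
        curvature G X Y \- fn_bracket (hproj G) S X Y \- nijenhuis S X Y)].
Proof.
move=> Phi p2 D Fhat Delta hFhat Delta0 Ghat hGhat f1 f2 S.
have aM : atlas M by case: hM => ? ? ? ? _; split.
have [[Ds [_ oD] _ _ _] [_ sFhat _ mr]] := hFhat.
have [vGhat _ _ ELhat] := hGhat.
have m0 q : D q -> F q - Phi q != 0 by case=> _ FP; rewrite subr_eq0 gt_eqF.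
have sF := loc_sF hF Ds; have vG := loc_vG hG Ds; have vP := loc_vphi hphi Ds.
have sPhi : smooth D Phi := loc_sPhi aM hF hg hbeta hphi oD Ds.
have sp2 : smooth D p2 := loc_sp2 aM hF hg hbeta hphi oD Ds.
have s1 : smooth D f1 := smooth_f1 aM oD sF sPhi sp2 Delta0.
have s2 : smooth D f2 := smooth_f2 aM oD sF sPhi sp2 Delta0.
pose G' := spray_change F Phi p2 G phi.
have vG' : vfield D G' := vf_spray_change aM oD sF sPhi sp2 vG vP Delta0.
(* Maximal rank makes the solution of the Euler-Lagrange equation unique. *)
have GE q : D q -> Ghat q = G' q.
  (* The difference of the two candidates, in the shape expected by [ddJ_vecZD]; it lies in the
     kernel of the 2-form at q. *)
  move=> Dq; pose T := fun p => -1 *: G' p + Ghat p.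
  have sN := smooth_cst (atlas_tangent aM) (-1 : R) oD.
  have sE := smooth_energy aM oD sFhat.
  have vT : vfield D T := vf_add aM oD (vf_scale aM oD sN vG') vGhat.
  have T0 : T q = 0.
    refine (mr D q T oD (fun _ h => h) Dq vT _) => Y vY.
    have E1 := ddJ_vecZD aM oD Dq sE sN vG' vGhat vY.
    have E2 := matsumoto_EL aM hF hG hg hbeta hDo hnabla hphi oD Ds m0 Delta0 vY Dq.
    have E3 := ELhat D Y oD (fun _ h => h) vY q (mem_set Dq).
    refine (etrans E1 (etrans (congr2 (fun u v => -1 * u + v) E2 E3) _)).
    by rewrite /= mulN1r opprK addrC addNr.
  by apply/eqP; rewrite -subr_eq0 -[X in _ == X]T0 /T scaleN1r addrC.
(* Identities of vector forms are required on every open U inside D; the equality of the sprays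
   restricts to U, and brackets at q see only values on U. *)
have BE U X q : opn U -> U `<=` D -> vfield U X -> U q ->
    barthel Ghat X q = barthel G X q -
      (f1 q *: J X q + dJ f1 X q *: gam eta q - dJ f2 X q *: gam phi q).
  move=> oU UD vX Uq; have Us := subset_trans UD Ds.
  have GEU p : U p -> Ghat p = G' p by move=> Up; exact (GE p (UD p Up)).
  have E1 := lie_eq aM oU Uq (fun p _ => erefl (J X p)) GEU.
  have E2 := lie_eq aM oU Uq (fun p _ => erefl (X p)) GEU.
  have vPU := loc_vphi hphi Us.
  refine (etrans (congr2 (fun u v => u - vert v) E1 E2) _).
  exact (barthel_spray_change aM oU (loc_vG hG Us) (loc_JG hG Us) vPU
    (loc_vbeta hbeta oU Us vPU) (fun p => loc_rbeta hbeta oU Us vPU)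
    (loc_vertical_phi hDo hphi oU Us)
    (smoothS UD s1) (smoothS UD s2) vX Uq).
have HE U X q : opn U -> U `<=` D -> vfield U X -> U q ->
    hproj Ghat X q = hproj G X q + S X q.
  move=> oU UD vX Uq.
  have key (x b s : 'rV[R]_n * 'rV[R]_n) :
    2^-1 *: (x + (b - s)) = 2^-1 *: (x + b) + - (2^-1 *: s).
    by rewrite addrA scalerBr.
  exact (etrans (congr1 (fun u => 2^-1 *: (X q + u)) (BE U X q oU UD vX Uq))
    (key _ _ _)).
split.
- exact: (semibasic_change_form aM s1 s2 vP).
- by move=> U X oU UD vX q /set_mem; exact: HE.
- move=> U X oU UD vX q /set_mem Uq.
  have key (x b s : 'rV[R]_n * 'rV[R]_n) :
    2^-1 *: (x - (b - s)) = 2^-1 *: (x - b) - - (2^-1 *: s).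
    by rewrite opprK -scalerDr opprB -addrA (addrC (- b)).
  exact (etrans (congr1 (fun u => 2^-1 *: (X q - u)) (BE U X q oU UD vX Uq))
    (key _ _ _)).
- move=> U X Y oU UD vX vY q /set_mem Uq; have vGU := vfieldS UD vG.
  have aH : additive_form U (hproj G).
    split=> [A vA|A B p Up AB|A B p Up vA vB].
    + exact: (vf_hproj aM oU vGU vA).
    + exact: (hproj_eq aM oU G Up AB).
    + exact: (hprojD aM oU vGU Up vA vB).
  have aS := additive_change_form aM oU (smoothS UD s1) (smoothS UD s2)
    (pvfieldS UD vP).
  have E := fn_bracketDD aM oU aH aS (fun A p vA => HE U A p oU UD vA) vX vY Uq.
  (* Multiplying the polarized bracket by -1/2 turns the three terms into the curvature of G, -
     [h, S] and - N_S. *)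
  have key (a b c : 'rV[R]_n * 'rV[R]_n) :
    - (2^-1 *: (a + 2 *: b + c)) = - (2^-1 *: a) - b - 2^-1 *: c.
    by rewrite !scalerDr scalerA mulVf ?pnatr_eq0// scale1r !opprD.
  exact (etrans (congr1 (fun u => - (2^-1 *: u)) E) (key _ _ _)).
Qed.
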